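(* Let $n\ge 1$ and $i\ge 1$ be integers. The family $\{D^i_{a_1,\dots,a_{2n-1}}\}$, indexed by all sequences $(a_1,\dots,a_{2n-1})$ of non-negative integers such that $a_1=a_{2n-1}=i$ and $(a_m,a_{m-1},i)$ is an admissible triple for every $2\le m\le 2n-1$, is a basis of the $\mathbb{Q}(A)$-vector space $TL_{(n,i)}$.
   Context: Let $A$ be an indeterminate, work over the field $\mathbb{Q}(A)$, and put $\delta=-A^{2}-A^{-2}$. For $m,n\ge 0$ let $TL(m,n)$ be the vector space with basis the isotopy classes of crossingless diagrams (without closed loops) in a rectangle with $m$ marked points on the bottom and $n$ on the top. Diagrams are composed by stacking, $XY$ meaning $X$ on top of $Y$, each closed loop being removed at the cost of a factor $\delta$; $\otimes$ denotes horizontal juxtaposition; $\mathrm{id}_n$ is the identity diagram. $TL_n=TL(n,n)$ is the Temperley-Lieb algebra, generated by $1,e_1,\dots,e_{n-1}$ with $e_j^2=\delta e_j$, $e_je_{j\pm1}e_j=e_j$, $e_je_l=e_le_j$ for $|j-l|>1$. The map $X\mapsto X^*$, $TL(m,n)\to TL(n,m)$, is the $\mathbb{Q}(A)$-linear extension of reflecting diagrams in a horizontal line. The Jones-Wenzl idempotent $f_n\in TL_n$ is the unique nonzero idempotent with $e_jf_n=f_ne_j=0$ for all $1\le j\le n-1$ ($f_0$ is the empty diagram). Colored Temperley-Lieb algebra: let $F=f_i^{\otimes k}\in TL_{ki}$ (one copy of $f_i$ on each of $k$ consecutive groups of $i$ strands). Then $TL_{(k,i)}=\{FXF: X\in TL_{ki}\}$,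 an algebra with identity $F$. Admissibility: a triple $(x,y,z)$ of non-negative integers is admissible if $x+y+z$ is even and $x\le y+z$, $y\le x+z$, $z\le x+y$. For $(x,y,z)$ admissible put $p=\frac{x+y-z}{2}$, $r=\frac{x+z-y}{2}$, $q=\frac{y+z-x}{2}$; the trivalent vertex is $V_{x,y}^{z}=f_z\,E\,(f_x\otimes f_y)\in TL(x+y,z)$, where $E\in TL(x+y,z)$ is the diagram joining the last $p$ of the first $x$ bottom points to the first $p$ of the last $y$ bottom points by nested arcs, and the remaining $r+q=z$ bottom points to the top points without crossings. Graph elements: for a sequence $s=(s_1,\dots,s_k)$ of non-negative integers with $s_1=i$ and $(s_{j-1},s_j,i)$ admissible for $1<j\le k$, define $v_s\in TL(ki,s_k)$ recursively by $v_{(i)}=f_i$ and $v_{(s_1,\dots,s_m)}=V_{s_{m-1},i}^{s_m}\,(v_{(s_1,\dots,s_{m-1})}\otimes \mathrm{id}_i)$. For a sequence $(a_1,\dots,a_{2n-1})$ with $a_1=a_{2n-1}=i$ and all $(a_m,a_{m-1},i)$ admissible, $D^i_{a_1,\dots,a_{2n-1}}=v_s^{*}\,v_t\in TL_{(n,i)}$ where $s=(a_1,\dots,a_n)$ and $t=(a_{2n-1},a_{2n-2},\dots,a_n)$. *)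

(* Defs.v *)
From HB Require Import structures.
From mathcomp Require Import all_boot all_order all_algebra.
From mathcomp Require Import boolp classical_sets.

Set Implicit Arguments.
Unset Strict Implicit.
Unset Printing Implicit Defensive.

Import GRing.Theory.
Local Open Scope ring_scope.

Definition K : fieldType := {fraction {poly rat}}.
Definition A : K := tofrac ('X : {poly rat}).
Definition delta : K := - A ^+ 2 - A ^- 2.

(* [inl u] is the [u]-th bottom point and [inr w] the [w]-th top point, both
   numbered from the left, starting at 0. *)
Definition point (m n : nat) : finType := ('I_m + 'I_n)%type.

(* Position on the boundary of the rectangle: bottom side from left to right,
   then top side from right to left. *)
Definition pos m n (p : point m n) : nat :=
  match p with inl u => u | inr w => (m + rev_ord w)%N end.

(* A crossingless diagram without closed loops is determined up to isotopy by
   the pairing of the marked points. *)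
Definition crossingless m n (d : {ffun point m n -> point m n}) : bool :=
  [&& [forall p, d p != p], [forall p, d (d p) == p]
    & [forall p, forall q, ~~ [&& pos p < pos q, pos q < pos (d p)
                                & pos (d p) < pos (d q)]]]%N.

Record diagram m n := Diagram {
  diagram_fun :> {ffun point m n -> point m n};
  _ : crossingless diagram_fun }.
HB.instance Definition _ m n := [isSub for @diagram_fun m n].
HB.instance Definition _ m n := [Finite of diagram m n by <:].

Definition TL m n := {ffun diagram m n -> K^o}.

(* The basis vector given by the diagram whose strands are exactly the pairs
   related by [R]; it is 0 if there is no such diagram. *)
Definition diag_of m n (R : rel (point m n)) : TL m n :=
  [ffun d : diagram m n => ([forall p, forall q, (d p == q) == R p q])%:R : K^o].

(* Strands specified by the numbers of their endpoints: [bb] for bottom-bottom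
   strands, [bt] for bottom-top strands and [tt] for top-top strands. *)
Definition strands (bb bt tt : rel nat) {m n} : rel (point m n) := fun p q =>
  match p, q with
  | inl u, inl v => bb u v
  | inl u, inr w => bt u w
  | inr w, inl u => bt u w
  | inr w, inr z => tt w z
  end.

Definition no_strand : rel nat := fun _ _ => false.

Definition id_tl n : TL n n := diag_of (strands no_strand eq_op no_strand).

Section Stacking.
Variables (a b c : nat) (x : diagram b c) (y : diagram a b).

(* Bottom points of [y], glued points, top points of [x]. *)
Definition stack_point : finType := ('I_a + 'I_b + 'I_c)%type.

Definition of_upper (p : point b c) : stack_point :=
  match p with inl v => inl (inr v) | inr w => inr w end.
Definition of_lower (p : point a b) : stack_point := inl p.
Definition of_outer (p : point a c) : stack_point :=
  match p with inl u => inl (inl u) | inr w => inr w end.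

Definition stack_edge : rel stack_point := fun v w =>
  [exists p, (v == of_upper p) && (w == of_upper (x p))]
  || [exists p, (v == of_lower p) && (w == of_lower (y p))].

Definition stack_strand : rel (point a c) := fun p q =>
  (p != q) && connect stack_edge (of_outer p) (of_outer q).

Definition stack_loops : nat :=
  n_comp stack_edge [pred v | [forall p, ~~ connect stack_edge v (of_outer p)]].

End Stacking.

Definition comp a b c (X : TL b c) (Y : TL a b) : TL a c :=
  \sum_(x : diagram b c) \sum_(y : diagram a b)
    (X x * Y y * delta ^+ stack_loops x y : K) *: diag_of (stack_strand x y).

Notation "X ∘ Y" := (comp X Y) (at level 40, left associativity) : ring_scope.

Definition point_split m1 m2 n1 n2 (p : point (m1 + m2) (n1 + n2)) :
    point m1 n1 + point m2 n2 :=
  match p with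
  | inl u => match split u with inl v => inl (inl v) | inr v => inr (inl v) end
  | inr u => match split u with inl v => inl (inr v) | inr v => inr (inr v) end
  end.

Definition juxt_strand m1 n1 m2 n2 (x : diagram m1 n1) (y : diagram m2 n2) :
    rel (point (m1 + m2) (n1 + n2)) := fun p q =>
  match point_split p, point_split q with
  | inl p', inl q' => x p' == q'
  | inr p', inr q' => y p' == q'
  | _, _ => false
  end.

Definition tens m1 n1 m2 n2 (X : TL m1 n1) (Y : TL m2 n2) :
    TL (m1 + m2) (n1 + n2) :=
  \sum_(x : diagram m1 n1) \sum_(y : diagram m2 n2)
    (X x * Y y : K) *: diag_of (juxt_strand x y).

Notation "X ⊗ Y" := (tens X Y) (at level 40, left associativity) : ring_scope.

Definition point_flip m n (p : point m n) : point n m :=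
  match p with inl u => inr u | inr w => inl w end.

Definition star m n (X : TL m n) : TL n m :=
  \sum_(x : diagram m n)
    (X x : K) *: diag_of (fun p q => x (point_flip p) == point_flip q).

(* [hook j] is the strand joining the points number [j] and [j.+1]. *)
Definition hook (j : nat) : rel nat := fun u v =>
  ((u == j) && (v == j.+1)) || ((u == j.+1) && (v == j)).

(* As marked points are numbered from 0, [cupcap n j] is e_{j+1}. *)
Definition cupcap n (j : nat) : TL n n :=
  diag_of (strands (hook j)
                   (fun u w => [&& u == w, u != j & u != j.+1])
                   (hook j)).

Definition is_jones_wenzl n (f : TL n n) : Prop :=
  [/\ f != 0, f ∘ f = f
    & forall j, (j.+1 < n)%N -> cupcap n j ∘ f = 0 /\ f ∘ cupcap n j = 0].

Definition jw n : TL n n := xget 0 [set f | is_jones_wenzl f]%classic.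

Fixpoint jw_pow (i k : nat) : TL (k * i) (k * i) :=
  match k with
  | 0 => id_tl 0
  | k'.+1 => jw i ⊗ jw_pow i k'
  end.

(* The algebra TL_(k,i), as the image of the linear map X |-> F X F
   (see [colored_tlP]). *)
Definition colored_tl (k i : nat) : {vspace TL (k * i) (k * i)} :=
  limg (linfun (fun X : TL (k * i) (k * i) => jw_pow i k ∘ X ∘ jw_pow i k)).

Definition admissible (x y z : nat) : bool :=
  [&& ~~ odd (x + y + z), x <= y + z, y <= x + z & z <= x + y]%N.

(* With p = (x+y-z)/2, the bottom points numbered x-p, ..., x+p-1 are joined by
   nested arcs, u being joined to 2x-1-u; the others go up to the top. *)
Definition vertex_diagram (x y z : nat) : TL (x + y) z :=
  let p := ((x + y - z)./2)%N in
  diag_of (strands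
    (fun u v => (x - p <= minn u v) && ((u + v).+1 == 2 * x))%N
    (fun u w => ((u < x - p) && (w == u))
                || ((x + p <= u) && (w + 2 * p == u)))%N
    no_strand).

Definition vertex (x y z : nat) : TL (x + y) z :=
  jw z ∘ vertex_diagram x y z ∘ (jw x ⊗ jw y).

(* Transport of [X] along the equalities of dimensions, 0 if they fail. *)
Definition conform m n m' n' (X : TL m n) : TL m' n' :=
  match m =P m', n =P n' with
  | ReflectT em, ReflectT en =>
      ecast k (TL m' k) en (ecast k (TL k n) em X)
  | _, _ => 0
  end.
Arguments conform {m n} m' n' X.

(* [graph_upto i s k] is the element v_(s_1,...,s_(k+1)). *)
Fixpoint graph_upto (i : nat) (s : seq nat) (k : nat) :
    TL (k.+1 * i) (nth 0%N s k) :=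
  match k with
  | 0 => conform _ _ (jw i)
  | k'.+1 => conform _ _
      (vertex (nth 0%N s k') i (nth 0%N s k'.+1)
        ∘ (graph_upto i s k' ⊗ id_tl i))
  end.

Definition graph_elt (i : nat) (s : seq nat) :
    TL (size s * i) (last 0%N s) :=
  conform _ _ (graph_upto i s (size s).-1).

(* [a] is the sequence (a_1, ..., a_(2n-1)) and a_n = nth 0 a n.-1. *)
Definition D (n i : nat) (a : seq nat) : TL (n * i) (n * i) :=
  let s := take n a in
  let t := rev (drop n.-1 a) in
  star (conform (n * i) (nth 0%N a n.-1) (graph_elt i s))
    ∘ conform (n * i) (nth 0%N a n.-1) (graph_elt i t).

Definition admissible_seq (n i : nat) (a : seq nat) : bool :=
  [&& size a == (2 * n - 1)%N, head 0%N a == i, last 0%N a == i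
    & sorted (fun a' a'' => admissible a'' a' i) a].

Lemma comp_linearl a b c (Y : TL a b) :
  linear (fun X : TL b c => X ∘ Y).
Proof.
move=> k X X'; rewrite /comp scaler_sumr -big_split /=; apply: eq_bigr => x _.
rewrite scaler_sumr -big_split /=; apply: eq_bigr => y _.
rewrite scalerA -scalerDl; congr (_ *: _).
by rewrite !ffunE /= !mulrDl !mulrA.
Qed.

Lemma comp_linearr a b c (X : TL b c) :
  linear (fun Y : TL a b => X ∘ Y).
Proof.
move=> k Y Y'; rewrite /comp scaler_sumr -big_split /=; apply: eq_bigr => x _.
rewrite scaler_sumr -big_split /=; apply: eq_bigr => y _.
rewrite scalerA -scalerDl; congr (_ *: _).
by rewrite !ffunE /= mulrDr mulrDl !mulrA [X x * k]mulrC.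
Qed.

Lemma colored_tlP k i (Y : TL (k * i) (k * i)) :
  reflect (exists X, Y = jw_pow i k ∘ X ∘ jw_pow i k) (Y \in colored_tl k i).
Proof.
pose h X := jw_pow i k ∘ X ∘ jw_pow i k.
have h_lin : linear h by move=> c X X'; rewrite /h comp_linearr comp_linearl.
have hE X : linfun h X = h X.
  pose hB := GRing.isLinear.Build _ _ _ _ h h_lin.
  pose hL : {linear _ -> _} := HB.pack h hB.
  exact: (lfunE hL X).
apply: (iffP memv_imgP) => [[X _ ->]|[X ->]]; exists X;
  by rewrite ?hE ?memvf.
Qed.

(* Main.v *)
(* The skein TL(m,n) is represented faithfully by matrices indexed by sign words
   in {+,-}: the vector space V with basis +,- carries a cap and a cup for which
   a closed loop is worth -A^2 - A^-2, so a diagram acts as V^(x)m -> V^(x)n with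
   entries that are products over its arcs.  Functoriality is proved by
   contracting the glued points of a stack one adjacent pair at a time.
   Faithfulness is triangularity with respect to the words that record which
   endpoint of each arc comes first.

   Reflection becomes transposition up to a scalar, and Q(A) is formally real, so
   M^T M = 0 forces M = 0.  Positivity gives the Jones-Wenzl idempotent as the
   projector onto the kernel of a sum of squares of the e_j; its matrix is the
   explicit projector P_n onto q-symmetric tensors, of trace n + 1.  Any diagram
   other than an identity contains a cap or a cup joining neighbours, so
   P_n X P_m is 0 or a multiple of P_n.  Hence the vertices V^z_{x,y} are
   orthogonal for distinct z, with non-zero norms by positivity, and comparing
   traces gives P_x (x) P_y = sum_z theta_z^-1 V_z^T V_z.  By induction the graph
   elements v_s are orthogonal and resolve F = f_i^(x)n, so the v_s^* v_t are
   linearly independent and every F X F is a combination of them. *)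
Require Import Defs.
From mathcomp Require Import all_boot all_order all_algebra.
From HB Require Import structures.
From mathcomp Require classical_sets.
From mathcomp Require Import boolp.
From mathcomp Require Import zify ring.

Set Implicit Arguments.
Unset Strict Implicit.
Unset Printing Implicit Defensive.

Import GRing.Theory Num.Theory.
Local Open Scope ring_scope.

(** * Formal reality of Q(A) *)

(** A cup that is exactly the transpose of the cap is impossible over Q(A): a closed loop would be
    the sum of the squares of the entries of the cap, while delta = -A^2 - A^-2 is minus a non-zero
    sum of squares. The weights are therefore unbalanced. With gamma = -A^2 the cap takes the values
    1 on + - and gamma^-1 on - +, and the cup is gamma times its transpose. Each e_j is still
    symmetric, with block [[gamma, 1], [1, gamma^-1]] on + - and - +, and every use of positivity
    rests on this symmetry. Matrices are attached to planar matchings rather than to generators,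
    because stacking is defined by connected components and loops are counted as components: a
    matching is what this description shares with a product over arcs. Orthogonality only places the
    vertices inside the range of P_x (x) P_y. A count closes the gap: the z + 1, summed over
    admissible z, add up to (x + 1)(y + 1). *)

Lemma poly_sum_sqr_eq0 (ps : seq {poly rat}) :
  \sum_(p <- ps) p ^+ 2 = 0 -> forall p, p \in ps -> p = 0.
Proof.
move=> sum0 p p_ps.
(* At a rational point the hypothesis is a vanishing sum of rational squares, so [p] has the
   [size p] roots 0, 1, 2, ..., more than its degree allows. *)
apply: (@roots_geq_poly_eq0 _ p [seq k%:R | k <- iota 0 (size p)]).
- apply/allP => _ /mapP[k _ ->]; rewrite /root.
  move: (congr1 (fun q : {poly rat} => q.[k%:R]) sum0).
  rewrite horner_sum horner0 => /eqP.
  rewrite psumr_eq0 => [/allP/(_ p p_ps)|q _]; last by rewrite horner_exp sqr_ge0.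
  by rewrite horner_exp sqrf_eq0.
- rewrite map_inj_uniq ?iota_uniq // => k l /eqP.
  by rewrite eqr_nat => /eqP.
- by rewrite size_map size_iota.
Qed.

Section FieldOfFractions.
Variables (F : fieldType) (iota : {rmorphism {poly rat} -> F}).
Hypothesis iota_eq0 : forall p, (iota p == 0) = (p == 0).
Hypothesis numden : forall x, exists n d, d != 0 /\ x * iota d = iota n.

Lemma common_denominator (xs : seq F) :
  exists (q : {poly rat}) (ps : seq {poly rat}),
    q != 0 /\ [seq x * iota q | x <- xs] = [seq iota p | p <- ps].
Proof.
elim: xs => [|x xs [q [ps [q_neq0 def_ps]]]].
  by exists 1, [::]; rewrite oner_neq0.
have [n [d [d_neq0 def_x]]] := numden x.
exists (q * d), (n * q :: [seq p * d | p <- ps]); split.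
  by rewrite mulf_neq0.
rewrite /= !rmorphM [iota q * _]mulrC mulrA def_x; congr (_ :: _).
rewrite -map_comp; transitivity [seq y * iota d | y <- [seq iota p | p <- ps]].
  rewrite -def_ps -map_comp; apply: eq_map => y /=.
  by rewrite mulrA mulrAC.
by rewrite -map_comp; apply: eq_map => p /=; rewrite rmorphM.
Qed.

(** A common denominator turns the relation into one between squares of polynomials. The field is
    kept abstract, so the quotient construction of [K] enters only through the two hypotheses of the
    section. *)
Lemma sum_sqr_eq0_seq (xs : seq F) :
  \sum_(x <- xs) x ^+ 2 = 0 -> forall x, x \in xs -> x = 0.
Proof.
have [q [ps [q_neq0 def_ps]]] := common_denominator xs => sum0 x x_xs.
have /poly_sum_sqr_eq0 ps0 : \sum_(p <- ps) p ^+ 2 = 0.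
  apply/eqP; rewrite -iota_eq0 rmorph_sum; apply/eqP.
  transitivity (\sum_(y <- [seq iota p | p <- ps]) y ^+ 2).
    by rewrite big_map; apply: eq_bigr => p _; rewrite rmorphXn.
  rewrite -def_ps big_map; under eq_bigr do rewrite exprMn.
  by rewrite -mulr_suml sum0 mul0r.
have : x * iota q \in [seq iota p | p <- ps].
  by rewrite -def_ps; apply/mapP; exists x.
case/mapP=> p /ps0 -> /eqP; rewrite rmorph0 mulf_eq0 iota_eq0 (negPf q_neq0) orbF.
by move/eqP.
Qed.

End FieldOfFractions.

Lemma fraction_numden (x : K) : exists n d : {poly rat}, d != 0 /\ x * tofrac d = tofrac n.
Proof.
elim/quotW: x => r; exists (frac r).1, (frac r).2.
split; first exact: denom_ratioP.
rewrite !piE /FracField.mulf /= !numden_Ratio ?oner_neq0 //.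
apply/eqP; rewrite piE FracField.equivfE !numden_Ratio ?mulf_neq0 ?oner_neq0 ?denom_ratioP //.
by rewrite !mulr1 mulrC.
Qed.

Lemma sum_sqr_eq0 (I : eqType) (r : seq I) (F : I -> K) :
  \sum_(i <- r) F i ^+ 2 = 0 -> forall i, i \in r -> F i = 0.
Proof.
move=> sum0 i i_r.
apply: (@sum_sqr_eq0_seq K (@FracField.tofrac _) _ fraction_numden [seq F j | j <- r]).
- by move=> p; rewrite tofrac_eq0.
- by rewrite big_map.
- exact: map_f.
Qed.

Lemma A_neq0 : A != 0.
Proof. by rewrite tofrac_eq0 polyX_eq0. Qed.

(** * Matrices indexed by words of signs *)

(* Words of signs: [true] stands for +, [false] for -.  Matrices carry no
   dimensions, so that no transport along equalities of dimensions is needed;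
   [mulm] takes the inner dimension as an argument. *)
Fixpoint states (n : nat) : seq (seq bool) :=
  if n is n'.+1 then
    [seq true :: s | s <- states n'] ++ [seq false :: s | s <- states n']
  else [:: [::]].

Lemma mem_states n s : (s \in states n) = (size s == n).
Proof.
elim: n s => [|n IHn] [|b s] //=.
  by rewrite mem_cat; apply/negP => /orP[] /mapP[].
rewrite mem_cat eqSS -IHn; case: b.
  rewrite mem_map; last by move=> ? ? [].
  by rewrite orbC; case: mapP => // -[].
rewrite (mem_map (f := cons false)); last by move=> ? ? [].
by case: mapP => // -[].
Qed.

Lemma states_uniq n : uniq (states n).
Proof.
elim: n => //= n IHn; rewrite cat_uniq !map_inj_uniq ?IHn //=.
- by rewrite andbT; apply/hasPn => _ /mapP[s _ ->]; apply/negP => /mapP[].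
- by move=> ? ? [].
- by move=> ? ? [].
Qed.

Section Matrices.
Variable R : fieldType.

Lemma big_statesS n (F : seq bool -> R) :
  \sum_(s <- states n.+1) F s = \sum_(s <- states n) (F (true :: s) + F (false :: s)).
Proof. by rewrite /= big_cat !big_map big_split. Qed.

Lemma big_states_cat m n (F : seq bool -> R) :
  \sum_(s <- states (m + n)) F s =
  \sum_(s <- states m) \sum_(t <- states n) F (s ++ t).
Proof.
elim: m F => [|m IHm] F; first by rewrite big_seq1.
by rewrite addSn !big_statesS IHm; apply: eq_bigr => s _; rewrite big_split.
Qed.

Lemma big_states1 n (t : seq bool) (F : seq bool -> R) : size t = n ->
  \sum_(s <- states n) (s == t)%:R * F s = F t.
Proof.
move=> size_t; rewrite (bigD1_seq t) ?mem_states ?size_t ?states_uniq //=.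
rewrite eqxx mul1r big1 ?addr0 // => s /negPf->.
by rewrite mul0r.
Qed.

Definition mat := seq bool -> seq bool -> R.

Implicit Types (M N L : mat) (u s t : seq bool).

Definition mulm (n : nat) (M N : mat) : mat :=
  fun u s => \sum_(t <- states n) M u t * N t s.

(** The test on the length keeps the matrix zero outside dimension [n], since a [mat] is defined on
    all words. *)
Definition idm (n : nat) : mat := fun u s => ((u == s) && (size s == n))%:R.

Definition trm (M : mat) : mat := fun u s => M s u.

Definition scalem (k : R) (M : mat) : mat := fun u s => k * M u s.

Definition mtrace (n : nat) (M : mat) : R := \sum_(s <- states n) M s s.

(* [r] and [c] are the dimensions of the left factor. *)
Definition tensm (r c : nat) (M N : mat) : mat :=
  fun u s => M (take r u) (take c s) * N (drop r u) (drop c s).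

(** Stands in for the dimensions that the type [mat] does not record. *)
Definition supported (r c : nat) (M : mat) : Prop :=
  forall u s, M u s != 0 -> size u = r /\ size s = c.

Lemma matP (M N : mat) : (forall u s, M u s = N u s) -> M = N.
Proof. by move=> eqMN; apply/funext => u; apply/funext => s. Qed.

Lemma mulmA m n M N L : mulm m M (mulm n N L) = mulm n (mulm m M N) L.
Proof.
apply: matP => u s; rewrite /mulm.
under eq_bigr do rewrite mulr_sumr.
rewrite exchange_big; apply: eq_bigr => t _.
by rewrite mulr_suml; apply: eq_bigr => v _; rewrite mulrA.
Qed.

Lemma supported_eq0 r c M u s : supported r c M ->
  (size u != r) || (size s != c) -> M u s = 0.
Proof.
move=> suppM; apply: contraTeq => /suppM[-> ->].
by rewrite !eqxx.
Qed.

Lemma mul1m r c M : supported r c M -> mulm r (idm r) M = M.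
Proof.
move=> suppM; apply: matP => u s; rewrite /mulm /idm.
have [size_u | size_u] := eqVneq (size u) r.
  rewrite -(@big_states1 r u (fun t => M t s)) //.
  rewrite big_seq [RHS]big_seq; apply: eq_bigr => t; rewrite mem_states => ->.
  by rewrite andbT eq_sym.
rewrite (supported_eq0 suppM) ?size_u // big1_seq // => t /=; rewrite mem_states => /eqP size_t.
by case: eqP => [eq_ut|_]; rewrite ?mul0r //; case/eqP: size_u; rewrite eq_ut.
Qed.

Lemma trm_mul n M N : trm (mulm n M N) = mulm n (trm N) (trm M).
Proof. by apply: matP => u s; apply: eq_bigr => t _; rewrite mulrC. Qed.

Lemma trmK M : trm (trm M) = M.
Proof. exact: matP. Qed.

Lemma trm_id n : trm (idm n) = idm n.
Proof. by apply: matP => u s; rewrite /trm /idm [s == u]eq_sym; case: eqVneq => // ->. Qed.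

Lemma supported_tr r c M : supported r c M -> supported c r (trm M).
Proof. by move=> suppM u s /suppM[]. Qed.

Lemma supported_id n : supported n n (idm n).
Proof.
move=> u s; rewrite /idm.
by case: (u =P s) => [->|_]; case: (size s =P n) => [->|_]; rewrite ?eqxx.
Qed.

Lemma supported_mul r n c M N : supported r n M -> supported n c N ->
  supported r c (mulm n M N).
Proof.
move=> suppM suppN u s neq0.
have [/andP[/eqP-> /eqP->] //|size_us] := boolP ((size u == r) && (size s == c)).
case/eqP: neq0; rewrite /mulm big1 // => t _;
  move: size_us; rewrite negb_and => /orP[size_u|size_s].
  by rewrite (supported_eq0 suppM) ?size_u ?mul0r.
by rewrite (supported_eq0 suppN) ?size_s ?orbT ?mulr0.
Qed.

Lemma mulm1 r c M : supported r c M -> mulm c M (idm c) = M.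
Proof.
by move=> suppM; rewrite -[LHS]trmK trm_mul trm_id (mul1m (supported_tr suppM)) trmK.
Qed.

Lemma mul_scalem n k M N : mulm n (scalem k M) N = scalem k (mulm n M N).
Proof.
apply: matP => u s; rewrite /mulm /scalem mulr_sumr.
by apply: eq_bigr => t _; rewrite mulrA.
Qed.

Lemma mulm_scale n k M N : mulm n M (scalem k N) = scalem k (mulm n M N).
Proof.
apply: matP => u s; rewrite /mulm /scalem mulr_sumr.
by apply: eq_bigr => t _; rewrite mulrCA.
Qed.

Lemma scalemA k l M : scalem k (scalem l M) = scalem (k * l) M.
Proof. by apply: matP => u s; rewrite /scalem mulrA. Qed.

Lemma scale1m M : scalem 1 M = M.
Proof. by apply: matP => u s; rewrite /scalem mul1r. Qed.

Lemma trm_scale k M : trm (scalem k M) = scalem k (trm M).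
Proof. exact: matP. Qed.

Lemma mtrace_mulC m n M N : mtrace m (mulm n M N) = mtrace n (mulm m N M).
Proof.
rewrite /mtrace /mulm exchange_big; apply: eq_bigr => t _; apply: eq_bigr => s _.
by rewrite mulrC.
Qed.

Lemma mtrace_scale n k M : mtrace n (scalem k M) = k * mtrace n M.
Proof. by rewrite /mtrace mulr_sumr. Qed.

Lemma tensm_mul r1 n1 c1 n2 M N M' N' :
  mulm (n1 + n2) (tensm r1 n1 M N) (tensm n1 c1 M' N') =
  tensm r1 c1 (mulm n1 M M') (mulm n2 N N').
Proof.
apply: matP => u s; rewrite /mulm /tensm big_states_cat mulr_suml.
rewrite big_seq [RHS]big_seq; apply: eq_bigr => t; rewrite mem_states => /eqP size_t.
rewrite mulr_sumr; apply: eq_bigr => t' _.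
by rewrite take_size_cat // drop_size_cat // mulrACA.
Qed.

Lemma tensmA r1 c1 r2 c2 M N L :
  tensm r1 c1 M (tensm r2 c2 N L) =
  tensm (r1 + r2) (c1 + c2) (tensm r1 c1 M N) L.
Proof.
apply: matP => u s; rewrite /tensm !take_takel ?leq_addr // !take_drop !drop_drop mulrA.
by rewrite ![(r1 + _)%N]addnC ![(c1 + _)%N]addnC.
Qed.

Lemma trm_tens r c M N : trm (tensm r c M N) = tensm c r (trm M) (trm N).
Proof. exact: matP. Qed.

Lemma scale_tensm k r c M N : tensm r c (scalem k M) N = scalem k (tensm r c M N).
Proof. by apply: matP => u s; rewrite /tensm /scalem mulrA. Qed.

Lemma supported_tens r1 c1 r2 c2 M N :
  supported r1 c1 M -> supported r2 c2 N ->
  supported (r1 + r2) (c1 + c2) (tensm r1 c1 M N).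
Proof.
move=> suppM suppN u s; rewrite mulf_eq0 negb_or => /andP[/suppM[] tu ts /suppN[] du ds].
by rewrite -(cat_take_drop r1 u) -(cat_take_drop c1 s) !size_cat tu ts du ds.
Qed.

Lemma mtrace_tens m n M N :
  mtrace (m + n) (tensm m m M N) = mtrace m M * mtrace n N.
Proof.
rewrite /mtrace big_states_cat mulr_suml.
rewrite big_seq [RHS]big_seq; apply: eq_bigr => s; rewrite mem_states => /eqP size_s.
rewrite mulr_sumr; apply: eq_bigr => t _.
by rewrite /tensm take_size_cat // drop_size_cat.
Qed.

Lemma tens0m M : tensm 0 0 (idm 0) M = M.
Proof. by apply: matP => u s; rewrite /tensm !take0 !drop0 /idm eqxx mul1r. Qed.

Lemma tensm0 r c M : supported r c M -> tensm r c M (idm 0) = M.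
Proof.
move=> suppM; apply: matP => u s; rewrite /tensm /idm.
have [/andP[/eqP su /eqP ss]|] := boolP ((size u == r) && (size s == c)).
  by rewrite -su -ss !take_size !drop_size eqxx mulr1.
rewrite negb_and => us; rewrite [M u s](supported_eq0 suppM) //.
case: eqVneq => [dus|_]; rewrite ?mulr0 //= size_drop.
have [->|/suppM] := eqVneq (M (take r u) (take c s)) 0; first by rewrite mul0r.
rewrite !size_take_min; have := congr1 size dus; rewrite !size_drop.
by case: eqP => //=; rewrite ?mulr0 //; move: us; lia.
Qed.

End Matrices.

Arguments idm {R} n u s.

Definition formally_real (R : fieldType) : Prop :=
  forall (I : eqType) (r : seq I) (F : I -> R),
    \sum_(i <- r) F i ^+ 2 = 0 -> forall i, i \in r -> F i = 0.

(** The diagonal entries of M^T M are the sums of squares of the columns of M. *)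
Lemma mulm_sqr_eq0 (R : fieldType) (real_R : formally_real R) r c (M : mat R) :
  supported r c M -> mulm r (trm M) M = (fun _ _ => 0) ->
  M = fun _ _ => 0.
Proof.
move=> suppM MM0; apply: matP => u s.
have [size_u|size_u] := eqVneq (size u) r; last by rewrite (supported_eq0 suppM) ?size_u.
apply: (@real_R _ (states r) (fun t => M t s)); last by rewrite mem_states size_u.
have := congr1 (fun F => F s s) MM0; rewrite /mulm /trm => {2}<-.
by apply: eq_bigr => t _; rewrite expr2.
Qed.

(* [- A ^+ 2] is the ratio of the two weights of an arc; delta = gamma + gamma^-1. *)
Definition gamma : K := - A ^+ 2.

Lemma gamma_neq0 : gamma != 0.
Proof. by rewrite oppr_eq0 expf_neq0 ?A_neq0. Qed.

Lemma deltaE : delta = gamma + gamma^-1.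
Proof. by rewrite /delta /gamma invrN. Qed.

(** * Contraction of planar matchings *)

(** An edge may be sent to a whole path, as happens when glued points are removed or restored; [P]
    is an invariant carried along the path. *)
Lemma connect_hom (T T' : finType) (e : rel T) (e' : rel T') (P : pred T) (h : T -> T') :
  (forall x y, P x -> e x y -> P y /\ connect e' (h x) (h y)) ->
  forall x y, P x -> connect e x y -> P y /\ connect e' (h x) (h y).
Proof.
move=> hom x y Px /connectP[p]; elim: p x Px => [|z p IHp] x Px /=.
  by move=> _ ->; split.
case/andP=> /(hom _ _ Px)[Pz xz] /(IHp _ Pz) IH /IH[Py zy].
by split=> //; apply: connect_trans zy.
Qed.

(** Separation by [x] is additive modulo 2 along the chain a, l, r, b, and [x] does not separate [l]
    from [r]. *)
Lemma between_addb (l r a b x : nat) : (l < r)%N ->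
  (a < l)%N || (r < a)%N -> (b < l)%N || (r < b)%N -> (x < l)%N || (r < x)%N ->
  x != a -> x != b ->
  (minn a b < x < maxn a b)%N =
  (minn l a < x < maxn l a)%N (+) (minn r b < x < maxn r b)%N.
Proof.
move=> lt_lr /orP[al|al] /orP[bl|bl] /orP[xl|xl] xa xb.
all: have [lab|lab] := leqP a b; have [lla|lla] := leqP l a;
  have [lrb|lrb] := leqP r b; try lia.
all: have [lxa|lxa] := ltnP x a; have [lxb|lxb] := ltnP x b; lia.
Qed.

Section Weights.
Variables (R : fieldType) (gamma : R).

(* Weight of an arc whose first and second endpoints carry the signs [a], [b]. *)
Definition capw (a b : bool) : R :=
  if a then (if b then 0 else 1) else (if b then gamma^-1 else 0).

(* Gluing through a point [e] compensates [capw]: it makes the identity diagram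
   act as the identity and a closed loop count for [gamma + gamma^-1]. *)
Definition glue (e : bool) : R := if e then 1 else gamma.

Definition glue_seq (t : seq bool) : R := \prod_(e <- t) glue e.

Lemma glue_seq_cons e t : glue_seq (e :: t) = glue e * glue_seq t.
Proof. exact: big_cons. Qed.

Hypothesis gamma_neq0 : gamma != 0.

Lemma glue_neq0 e : glue e != 0.
Proof. by case: e; rewrite /= ?oner_neq0 ?gamma_neq0. Qed.

Lemma glue_seq_neq0 t : glue_seq t != 0.
Proof.
rewrite /glue_seq; elim: t => [|e t IHt]; rewrite ?big_nil ?oner_neq0 // big_cons.
by rewrite mulf_neq0 ?glue_neq0.
Qed.

End Weights.

Section Matchings.
Variables (T : finType) (ht : T -> nat).
Hypothesis ht_inj : injective ht.

Definition inside (f : T -> T) (p q : T) : bool :=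
  (minn (ht p) (ht (f p)) < ht q < maxn (ht p) (ht (f p)))%N.

(** Absence of crossings is expressed by the constancy of [inside f p] on every arc. This form is
    symmetric in the two ends of each arc and adds modulo 2 under splicing. *)
Definition planar (S : {set T}) (f : T -> T) : Prop :=
  forall p, p \in S ->
    [/\ f p \in S, f p != p, f (f p) = p
      & forall q, q \in S -> inside f p q = inside f p (f q)].

(** The product in [weight] runs over points, so an arc contributes at its lower end only. *)
Definition arcw (R : fieldType) (gamma : R) (f : T -> T) (s : T -> bool) (p : T) : R :=
  if (ht p < ht (f p))%N then capw gamma (s p) (s (f p)) else 1.

Definition weight (R : fieldType) (gamma : R) (S : {set T}) (f : T -> T) (s : T -> bool) : R :=
  \prod_(p in S) arcw gamma f s p.

Definition splice (l r : T) (f : T -> T) : T -> T := fun p =>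
  if f p == l then f r else if f p == r then f l else f p.

(* A strand that runs through the glued points [l] and [r] keeps its sign, but
   [l] and [r] see it from opposite sides. *)
Definition update (s : T -> bool) (l r : T) (e : bool) : T -> bool := fun p =>
  if p == l then ~~ e else if p == r then e else s p.

Definition consecutive (S : {set T}) (l r : T) : bool :=
  [&& l \in S, r \in S, (ht l < ht r)%N
    & [forall p in S, ~~ (ht l < ht p < ht r)%N]].

Section Splice.
Variables (S : {set T}) (f : T -> T) (l r : T).
Hypothesis (planar_f : planar S f) (lr : consecutive S l r).

Let lS : l \in S. Proof. by case/and4P: lr. Qed.
Let rS : r \in S. Proof. by case/and4P: lr. Qed.
Let lt_lr : (ht l < ht r)%N. Proof. by case/and4P: lr. Qed.
Let adj_lr p : p \in S -> p != l -> p != r -> (ht p < ht l)%N || (ht r < ht p)%N.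
Proof.
case/and4P: lr => _ _ _ /forall_inP adj pS pl pr; have := adj p pS.
by move: pl pr; rewrite -!(inj_eq ht_inj); lia.
Qed.
Let neq_lr : l != r. Proof. by rewrite -(inj_eq ht_inj); move: lt_lr; lia. Qed.

Let fS p : p \in S -> f p \in S. Proof. by case/planar_f. Qed.
Let fK p : p \in S -> f (f p) = p. Proof. by case/planar_f. Qed.
Let f_neq p : p \in S -> f p != p. Proof. by case/planar_f. Qed.

Lemma planar_eq p q : p \in S -> q \in S -> (f p == q) = (p == f q).
Proof. by move=> pS qS; apply/eqP/eqP => [<-|->]; rewrite fK. Qed.

Lemma splice_in p : p \in S :\ l :\ r -> splice l r f p \in S :\ l :\ r.
Proof.
rewrite !inE => /and3P[pr pl pS]; rewrite /splice.
case: ifPn => [/eqP fpl|fpl].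
  have def_p : p = f l by rewrite -fpl fK.
  rewrite fS // f_neq // planar_eq // -def_p eq_sym pr.
  by [].
case: ifPn => [/eqP fpr|fpr].
  have def_p : p = f r by rewrite -fpr fK.
  by rewrite fS // f_neq // planar_eq // -def_p eq_sym pl.
by rewrite fpr fpl fS.
Qed.

(** Being inside the new arc from [f l] to [f r] is the sum modulo 2 of being inside the two old
    arcs ([between_addb]). Both summands are constant on the other arcs, hence so is the sum. *)
Lemma splice_planar : planar (S :\ l :\ r) (splice l r f).
Proof.
move=> p pS1; have [pr pl pS] : [/\ p != r, p != l & p \in S].
  by move: pS1; rewrite !inE => /and3P[].
have neq_fl x : x \in S -> (f x == l) = (x == f l) by move=> xS; rewrite planar_eq.
have neq_fr x : x \in S -> (f x == r) = (x == f r) by move=> xS; rewrite planar_eq.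
have spl x : x \in S ->
    splice l r f x = if x == f l then f r else if x == f r then f l else f x.
  by move=> xS; rewrite /splice neq_fl // neq_fr.
have fl_fr : f l != f r.
  by apply: contraNneq neq_lr => eq_f; rewrite -(fK lS) eq_f fK.
split; first exact: splice_in.
- rewrite spl //; case: (eqVneq p (f l)) => [->|_]; first by rewrite eq_sym.
  by case: (eqVneq p (f r)) => [->|_] //; apply: f_neq.
- rewrite [splice l r f p]spl //.
  case: (eqVneq p (f l)) => [->|pfl]; first by rewrite spl ?fS // eqxx eq_sym (negPf fl_fr).
  case: (eqVneq p (f r)) => [->|pfr]; first by rewrite spl ?fS // eqxx.
  by rewrite spl ?fS // !planar_eq ?fS // !fK // (negPf pl) (negPf pr).
move=> q; rewrite !inE => /and3P[qr ql qS].
have ins x y : x \in S -> y \in S -> inside f x y = inside f x (f y).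
  by move=> xS; case/planar_f: (xS) => _ _ _; apply.
have htE x y : (ht x == ht y) = (x == y) by rewrite (inj_eq ht_inj).
have ql' := adj_lr qS ql qr.
have pl' := adj_lr pS pl pr.
rewrite /inside [splice l r f p]spl // [splice l r f q]spl //.
case: (eqVneq p (f l)) => [def_p|pfl].
  have [->|qfl] := eqVneq q (f l); first by rewrite def_p; clear; lia.
  have [->|qfr] := eqVneq q (f r).
    by rewrite def_p; clear; lia.
  have := ins l q lS qS; have := ins r q rS qS; rewrite /inside.
  have fqS := fS qS.
  have fql : f q != l by rewrite neq_fl.
  have fqr : f q != r by rewrite neq_fr.
  have := adj_lr fqS fql fqr.
  have frS := fS rS.
  have [frl|frl] := eqVneq (f r) l.
    by move: pr; rewrite def_p -frl fK // eqxx.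
  have := adj_lr frS frl (f_neq rS).
  have : f q != f r by apply: contraNneq qr => eq_f; rewrite -(fK qS) eq_f fK.
  have : f q != p.
    by apply: contraNneq ql => eq_f; rewrite -(fK qS) eq_f def_p fK.
  rewrite -!htE => fqp fqfr frlr fqlr insr insl.
  rewrite def_p -!htE in qfl qfr pl' fqp insl insr *.
  by rewrite (between_addb lt_lr pl' frlr ql') // insr insl -(between_addb lt_lr).
case: (eqVneq p (f r)) => [def_p|pfr].
  have [->|qfl] := eqVneq q (f l); first by rewrite def_p; clear; lia.
  have [->|qfr] := eqVneq q (f r).
    by rewrite def_p; clear; lia.
  have := ins l q lS qS; have := ins r q rS qS; rewrite /inside.
  have fqS := fS qS.
  have fql : f q != l by rewrite neq_fl.
  have fqr : f q != r by rewrite neq_fr.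
  have := adj_lr fqS fql fqr.
  have flS := fS lS.
  have [flr|flr] := eqVneq (f l) r.
    by move: pl; rewrite def_p -flr fK // eqxx.
  have := adj_lr flS (f_neq lS) flr.
  have : f q != f l by apply: contraNneq ql => eq_f; rewrite -(fK qS) eq_f fK.
  have : f q != p.
    by apply: contraNneq qr => eq_f; rewrite -(fK qS) eq_f def_p fK.
  rewrite -!htE => fqp fqfl fllr fqlr insr insl.
  rewrite def_p -!htE in qfl qfr pl' fqp insl insr *.
  rewrite minnC maxnC (between_addb lt_lr fllr pl' ql') // insr insl.
  by rewrite -(between_addb lt_lr).
have fpl : f p != l by rewrite neq_fl.
have fpr : f p != r by rewrite neq_fr.
(* An arc that avoids [l] and [r] cannot separate these neighbours, so it has [f l] and [f r] on the
   same side. *)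
have inlr : inside f p l = inside f p r.
  have := adj_lr (fS pS) fpl fpr.
  move: pl' lt_lr pl pr fpl fpr; rewrite /inside -!htE; lia.
have := ins p l pS lS; have := ins p r pS rS; have := ins p q pS qS.
have [->|_] := eqVneq q (f l).
  by rewrite fK // /inside => _ <-; rewrite -/(inside f p r) -inlr => <-.
have [->|_] := eqVneq q (f r).
  by rewrite fK // /inside => _; rewrite -/(inside f p r) -inlr => <-.
by [].
Qed.

(** If [l] and [r] form an arc, both signs contribute, with values gamma^-1 and gamma. Otherwise the
    signs at [f l] and [f r] leave at most one [e], and [glue] corrects the product of two arc
    weights into the weight of the merged arc. *)
Lemma weight_splice (R : fieldType) (gamma : R) (gamma_neq0 : gamma != 0) s :
  \sum_(e : bool) glue gamma e * weight gamma S f (update s l r e) =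
  (if f l == r then (gamma + gamma^-1) else 1) * weight gamma (S :\ l :\ r) (splice l r f) s.
Proof.
have htE x y : (ht x == ht y) = (x == y) by rewrite (inj_eq ht_inj).
have upd_l e : update s l r e l = ~~ e by rewrite /update eqxx.
have upd_r e : update s l r e r = e.
  by rewrite /update eqxx eq_sym (negPf neq_lr).
have upd e p : p != l -> p != r -> update s l r e p = s p.
  by rewrite /update => /negPf-> /negPf->.
have rSl : r \in S :\ l by rewrite !inE eq_sym neq_lr.
have prod2 s' : weight gamma S f s' =
    arcw gamma f s' l * (arcw gamma f s' r * \prod_(p in S :\ l :\ r) arcw gamma f s' p).
  by rewrite /weight (big_setD1 l) // (big_setD1 r).
rewrite big_bool !prod2.
have [flr|flr] := eqVneq (f l) r.
  have frl : f r = l by rewrite -flr fK.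
  have arcE e p : p \in S :\ l :\ r ->
      arcw gamma f (update s l r e) p = arcw gamma (splice l r f) s p.
    rewrite !inE => /and3P[pr pl pS].
    have fpl : f p != l by rewrite planar_eq // flr.
    have fpr : f p != r by rewrite planar_eq // frl.
    by rewrite /arcw /splice (negPf fpl) (negPf fpr) !upd.
  rewrite !(eq_bigr _ (arcE _)) -/(weight _ _ _ _) /arcw flr frl lt_lr.
  rewrite ltnNge (ltnW lt_lr) /= !upd_l !upd_r /=.
  by ring.
have frl : f r != l by rewrite planar_eq // eq_sym.
have neq_f : f l != f r.
  by apply: contraNneq neq_lr => eq_f; rewrite -(fK lS) eq_f fK.
have flS1 : f l \in S :\ l :\ r by rewrite !inE flr f_neq ?fS.
have frS1 : f r \in S :\ l :\ r :\ f l by rewrite !inE eq_sym neq_f f_neq // frl fS.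
have prod2' g s' : \prod_(p in S :\ l :\ r) arcw gamma g s' p =
    arcw gamma g s' (f l) * (arcw gamma g s' (f r) *
      \prod_(p in S :\ l :\ r :\ f l :\ f r) arcw gamma g s' p).
  by rewrite (big_setD1 (f l)) // (big_setD1 (f r)).
rewrite /weight !prod2'.
have arcE e p : p \in S :\ l :\ r :\ f l :\ f r ->
    arcw gamma f (update s l r e) p = arcw gamma (splice l r f) s p.
  rewrite !inE => /and5P[pfr pfl pr pl pS].
  have fpl : f p != l by rewrite planar_eq.
  have fpr : f p != r by rewrite planar_eq.
  by rewrite /arcw /splice (negPf fpl) (negPf fpr) !upd.
rewrite !(eq_bigr _ (arcE _)).
set rest := \prod_(p in _) _; rewrite /arcw /splice !fK // !eqxx [r == l]eq_sym (negPf neq_lr).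
rewrite !upd_l !upd_r !upd ?f_neq //=.
have := adj_lr (fS lS) (f_neq lS) flr.
have := adj_lr (fS rS) frl (f_neq rS).
(* Planarity discards the orders of the four points in which the two old arcs cross. *)
have : inside f l r = inside f l (f r) by case: (planar_f lS) => _ _ _; apply.
rewrite /inside; move: neq_f flr frl (f_neq lS) (f_neq rS); rewrite -!htE.
have g1 : gamma / gamma = 1 by rewrite divff ?gamma_neq0.
case: (ltngtP (ht (f l)) (ht (f r))) => //; case: (ltngtP (ht l) (ht (f l))) => //;
case: (ltngtP (ht r) (ht (f r))) => //=.
all: move: lt_lr; clear -g1 gamma_neq0; try lia.
all: case: (s (f l)); case: (s (f r)) => /= *.
all: try ring.
all: rewrite ?mul1r ?mulr1 ?mul0r ?mulr0 ?addr0 ?add0r //.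
all: rewrite ?mulrA ?g1 ?mul1r //.
Qed.

End Splice.
End Matchings.

(** * Connected components and loops under contraction *)

Section Graphs.
Variables (T : finType) (ht : T -> nat).
Hypothesis ht_inj : injective ht.

Definition glued_edge (S : {set T}) (f : T -> T) (gl : seq (T * T)) : rel T :=
  fun p q => [|| (p \in S) && (q == f p), (p, q) \in gl | (q, p) \in gl].

Fixpoint remaining (S : {set T}) (gl : seq (T * T)) : {set T} :=
  if gl is (l, r) :: gl' then remaining (S :\ l :\ r) gl' else S.

(* Glued pairs are listed from the innermost one outwards. *)
Fixpoint nested (S : {set T}) (gl : seq (T * T)) : bool :=
  if gl is (l, r) :: gl' then consecutive ht S l r && nested (S :\ l :\ r) gl'
  else true.

Definition loops (S : {set T}) (f : T -> T) (gl : seq (T * T)) : nat :=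
  n_comp (glued_edge S f gl)
    [pred p | (p \in S) && [forall q in remaining S gl, ~~ connect (glued_edge S f gl) p q]].

Lemma remaining_sub S gl : remaining S gl \subset S.
Proof.
elim: gl S => [|[l r] gl IHgl] S //=.
by apply: subset_trans (IHgl _) _; apply: subset_trans (subD1set _ _) (subD1set _ _).
Qed.

Lemma nested_in S gl p q : nested S gl -> (p, q) \in gl -> (p \in S) && (q \in S).
Proof.
elim: gl S => [|[l r] gl IHgl] S //= /andP[/and4P[lS rS _ _] nest].
rewrite inE => /orP[/eqP[-> ->]|/(IHgl _ nest)]; first by rewrite lS rS.
by rewrite !inE => /andP[/and3P[_ _ ->] /and3P[_ _ ->]].
Qed.

Section Step.
Variables (S : {set T}) (f : T -> T) (l r : T) (gl : seq (T * T)).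
Hypotheses (planar_f : planar ht S f) (lr : consecutive ht S l r).
Let S1 := S :\ l :\ r.
Let f1 := splice l r f.
Hypothesis nest : nested S1 gl.
Let G := glued_edge S f ((l, r) :: gl).
Let G1 := glued_edge S1 f1 gl.

Let lS : l \in S. Proof. by case/and4P: lr. Qed.
Let rS : r \in S. Proof. by case/and4P: lr. Qed.
Let neq_lr : l != r.
Proof. by case/and4P: lr => _ _ lt_lr _; apply: contraTneq lt_lr => ->; rewrite ltnn. Qed.
Let fS p : p \in S -> f p \in S. Proof. by case/planar_f. Qed.
Let fK p : p \in S -> f (f p) = p. Proof. by case/planar_f. Qed.
Let f_neq p : p \in S -> f p != p. Proof. by case/planar_f. Qed.
Let f_eq p q : p \in S -> q \in S -> (f p == q) = (p == f q).
Proof. exact: planar_eq planar_f _ _. Qed.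
Let S1P p : (p \in S1) = [&& p != r, p != l & p \in S]. Proof. by rewrite !inE. Qed.
Let glS1 p q : (p, q) \in gl -> (p \in S1) && (q \in S1). Proof. exact: nested_in. Qed.

Lemma glued_edge_sym S' f' gl' : planar ht S' f' -> connect_sym (glued_edge S' f' gl').
Proof.
move=> planar_f'; apply: sym_connect_sym => p q.
rewrite /glued_edge [((p, q) \in gl') || _]orbC; congr (_ || _).
apply/andP/andP => -[pS /eqP->]; have [] := planar_f' _ pS => fpS _ -> _; by rewrite fpS.
Qed.

Lemma glued_edge_in p q : p \in S -> G p q -> q \in S.
Proof.
move=> pS /or3P[/andP[_ /eqP->]||]; first exact: fS.
- by rewrite inE => /orP[/eqP[_ ->] //|/glS1/andP[_]]; rewrite S1P => /and3P[].
- by rewrite inE => /orP[/eqP[-> _] //|/glS1/andP[]]; rewrite S1P => /and3P[].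
Qed.

Let edge_lr : G l r. Proof. by rewrite /G /glued_edge mem_head orbT. Qed.
Let edge_f p : p \in S -> G p (f p). Proof. by move=> pS; rewrite /G /glued_edge pS eqxx. Qed.

(** The new edge from [f l] to [f r] unfolds into the path [f l], [l], [r], [f r] of the original
    graph. *)
Lemma connect_unsplice p q : p \in S1 -> connect G1 p q -> q \in S1 /\ connect G p q.
Proof.
apply: (connect_hom (h := id)) => {q}{}p q pS1 edge.
have [pr pl pS] : [/\ p != r, p != l & p \in S] by apply/and3P; rewrite -S1P.
have fp : connect G p (f p) by rewrite connect1 ?edge_f.
case/or3P: edge => [/andP[_ /eqP->]|pq|qp].
- split; first exact: (splice_in planar_f lr).
  rewrite /f1 /splice; case: eqVneq => [fpl|_].
    apply: connect_trans (connect_trans fp _) (connect1 (edge_f rS)).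
    by rewrite fpl connect1.
  case: eqVneq => [fpr|_] //.
  apply: connect_trans (connect_trans fp _) (connect1 (edge_f lS)).
  by rewrite fpr glued_edge_sym // connect1.
- split; first by case/andP: (glS1 pq).
  by rewrite connect1 // /G /glued_edge !inE pq !orbT.
- split; first by case/andP: (glS1 qp).
  by rewrite connect1 // /G /glued_edge !inE qp !orbT.
Qed.

Section NoLoop.
Hypothesis flr : f l != r.
(* [rho] retracts the graph onto the one where [l] and [r] have been removed. *)
Let rho p := if p == l then f l else if p == r then f r else p.

Let frl : f r != l. Proof. by rewrite f_eq // eq_sym. Qed.
Let rho_id p : p \in S1 -> rho p = p.
Proof. by rewrite S1P /rho => /and3P[/negPf-> /negPf->]. Qed.
Let rhoS p : (rho p \in S1) = (p \in S).
Proof.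
rewrite /rho S1P; case: (eqVneq p l) => [->|pl]; first by rewrite flr f_neq ?fS ?lS.
by case: (eqVneq p r) => [->|pr]; rewrite ?frl ?f_neq ?fS ?rS ?pl ?pr.
Qed.

Let rho_edge p q : p \in S -> G p q -> q \in S /\ connect G1 (rho p) (rho q).
Proof.
move=> pS edge; split; first exact: glued_edge_in edge.
have sym1 : connect_sym G1 by apply/glued_edge_sym/splice_planar.
have edge1 x : x \in S1 -> connect G1 x (f1 x).
  by move=> xS1; rewrite connect1 // /G1 /glued_edge xS1 eqxx.
have lr1 : connect G1 (f l) (f r).
  have := edge1 (f l); rewrite S1P flr f_neq ?fS // => /(_ isT).
  by rewrite /f1 /splice fK // eqxx.
have rho_lr : rho l = f l /\ rho r = f r.
  by rewrite /rho !eqxx eq_sym (negPf neq_lr).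
have gl1 x y : (x, y) \in gl -> connect G1 (rho x) (rho y).
  move=> xy; have /andP[xS1 yS1] := glS1 xy.
  by rewrite !rho_id // connect1 // /G1 /glued_edge xy orbT.
case/or3P: edge => [/andP[_ /eqP->]||].
- rewrite /rho f_eq //; case: (eqVneq p l) => [->|pl].
    rewrite -f_eq // (negPf (f_neq lS)) (negPf flr).
    by [].
  rewrite (f_eq pS rS); case: (eqVneq p r) => [->|pr].
    rewrite -!f_eq // (negPf frl) (negPf (f_neq rS)).
    by [].
  case: (eqVneq p (f l)) => [-> //|pfl].
  case: (eqVneq p (f r)) => [-> //|pfr].
  have pS1 : p \in S1 by rewrite S1P pr pl.
  by have := edge1 p pS1; rewrite /f1 /splice !f_eq // (negPf pfl) (negPf pfr).
- rewrite inE => /orP[/eqP[-> ->]|/gl1 //].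
  by case: rho_lr => -> ->.
- rewrite inE => /orP[/eqP[-> ->]|/gl1]; last by rewrite sym1.
  by case: rho_lr => -> ->; rewrite sym1.
Qed.

Lemma connect_splice p q : p \in S -> connect G p q = connect G1 (rho p) (rho q).
Proof.
move=> pS; apply/idP/idP.
  by move=> pq; have [] := connect_hom (P := mem S) rho_edge pS pq.
have toS1 x : x \in S -> connect G x (rho x).
  by rewrite /rho; case: eqVneq => [-> _|_]; last case: eqVneq => [-> _|//];
    rewrite connect1 ?edge_f.
move=> pq; have := pS; rewrite -rhoS => /connect_unsplice/(_ pq)[].
rewrite rhoS => qS pq'; apply: connect_trans (toS1 p pS) _.
by apply: connect_trans pq' _; rewrite glued_edge_sym // toS1.
Qed.

Lemma connect_splice_outer p q : p \in S1 -> q \in S1 -> connect G p q = connect G1 p q.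
Proof.
move=> pS1 qS1; rewrite connect_splice ?rho_id //.
by move: pS1; rewrite S1P => /and3P[].
Qed.

(** Connectivity in [G] is pulled back from [G1] along the retraction [rho], so the components that
    avoid the remaining points correspond. *)
Lemma loops_splice : loops S f ((l, r) :: gl) = loops S1 f1 gl.
Proof.
have sym1 : connect_sym G1 by apply: glued_edge_sym; apply: splice_planar.
have sym : connect_sym G by apply: glued_edge_sym.
rewrite /loops -/G -/G1 /= -/S1.
set a := [pred p | (p \in S) && _]; set a1 := [pred p | (p \in S1) && _].
have aP p : (p \in a) = (p \in S) && [forall q in remaining S1 gl, ~~ connect G p q] by [].
have a1P p : (p \in a1) = (p \in S1) && [forall q in remaining S1 gl, ~~ connect G1 p q] by [].
have remS q : q \in remaining S1 gl -> q \in S1 by apply: subsetP (remaining_sub _ _) _.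
rewrite (@adjunction_n_comp _ _ rho G1 G sym1 sym a1).
- apply: eq_n_comp_r => p; rewrite aP [RHS]a1P rhoS.
  have [pS|//] := boolP (p \in S) => /=.
  apply: eq_forallb_in => q qrem.
  by rewrite connect_splice // [rho q]rho_id // remS.
- apply: (intro_closed sym1) => p q edge; rewrite !a1P => /andP[pS1 /forall_inP no_out].
  have qS1 : q \in S1.
    case/or3P: edge => [/andP[_ /eqP->]|/glS1/andP[]|/glS1/andP[]] //.
    exact: (splice_in planar_f lr).
  rewrite qS1; apply/forall_inP => q' /no_out; apply: contra.
  by apply: connect_trans; apply: connect1.
split=> [p|p q].
  by rewrite a1P => /andP[pS1 _]; exists p; rewrite rho_id.
by rewrite a1P rhoS => /andP[pS _]; rewrite connect_splice.
Qed.

End NoLoop.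

Section Loop.
Hypothesis flr : f l = r.

Let frl : f r = l. Proof. by rewrite -flr fK. Qed.

Let lr_closed p q : (p == l) || (p == r) -> G p q -> (q == l) || (q == r).
Proof.
move=> p_lr /or3P[/andP[_ /eqP->]||].
- by case/orP: p_lr => /eqP->; rewrite ?flr ?frl eqxx ?orbT.
- rewrite inE => /orP[/eqP[_ ->]|/glS1/andP[]]; first by rewrite eqxx orbT.
  by rewrite S1P; case/orP: p_lr => /eqP->; rewrite eqxx ?andbF.
- rewrite inE => /orP[/eqP[-> _]|/glS1/andP[_]]; first by rewrite eqxx.
  by rewrite S1P; case/orP: p_lr => /eqP->; rewrite eqxx ?andbF.
Qed.

Lemma connect_loop p : connect G l p = (p == l) || (p == r).
Proof.
apply/idP/idP => [lp|/orP[] /eqP->]; last 1 first.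
- exact: connect1.
- have [] := @connect_hom _ _ G G [pred q | (q == l) || (q == r)] id _ l p _ lp => //=.
    by move=> x y x_lr edge; rewrite connect1 // (lr_closed x_lr).
  by rewrite eqxx.
- exact: connect0.
Qed.

Let loop_edge p q : p \in S1 -> G p q -> q \in S1 /\ connect G1 p q.
Proof.
move=> pS1 edge.
have [pr pl pS] : [/\ p != r, p != l & p \in S] by apply/and3P; rewrite -S1P.
case/or3P: edge => [/andP[_ /eqP->]||].
- have fpS1 : f p \in S1 by rewrite S1P !f_eq ?fS // frl flr pl pr.
  split=> //; rewrite connect1 // /G1 /glued_edge /f1 /splice pS1 /=.
  have fpl : f p != l by rewrite f_eq // flr.
  have fpr : f p != r by rewrite f_eq // frl.
  by rewrite (negPf fpl) (negPf fpr) eqxx.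
- rewrite inE => /orP[/eqP[eq_pl _]|pq]; first by rewrite eq_pl eqxx in pl.
  by case/andP: (glS1 pq) => _ ->; rewrite connect1 // /G1 /glued_edge pq orbT.
- rewrite inE => /orP[/eqP[_ eq_pr]|pq]; first by rewrite eq_pr eqxx in pr.
  by case/andP: (glS1 pq) => -> _; rewrite connect1 // /G1 /glued_edge pq !orbT.
Qed.

Lemma connect_splice_loop p q : p \in S1 -> connect G p q = connect G1 p q.
Proof.
move=> pS1; apply/idP/idP => [pq|].
  by have [] := connect_hom (P := mem S1) (h := id) loop_edge pS1 pq.
by case/(connect_unsplice pS1).
Qed.

(** The points [l] and [r] form a whole component that avoids the remaining points; deleting it
    leaves all the others unchanged. *)
Lemma loops_splice_loop : loops S f ((l, r) :: gl) = (loops S1 f1 gl).+1.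
Proof.
have sym1 : connect_sym G1 by apply: glued_edge_sym; apply: splice_planar.
have sym : connect_sym G by apply: glued_edge_sym.
rewrite /loops -/G -/G1 /= -/S1.
set a := [pred p | (p \in S) && _]; set a1 := [pred p | (p \in S1) && _].
have aP p : (p \in a) = (p \in S) && [forall q in remaining S1 gl, ~~ connect G p q] by [].
have a1P p : (p \in a1) = (p \in S1) && [forall q in remaining S1 gl, ~~ connect G1 p q] by [].
have remS q : q \in remaining S1 gl -> q \in S1 by apply: subsetP (remaining_sub _ _) _.
have -> : n_comp G1 a1 = n_comp G a1.
  rewrite (@adjunction_n_comp _ _ id G1 G sym1 sym a1) //.
    apply: (intro_closed sym1) => p q edge; rewrite !a1P => /andP[pS1 /forall_inP no_out].
    have qS1 : q \in S1.
      case/or3P: edge => [/andP[_ /eqP->]|/glS1/andP[]|/glS1/andP[]] //.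
      exact: (splice_in planar_f lr).
    rewrite qS1; apply/forall_inP => q' /no_out; apply: contra.
    by apply: connect_trans; apply: connect1.
  split=> [p pa|p q]; first by exists p.
  by rewrite a1P => /andP[pS1 _]; rewrite connect_splice_loop.
(* The 1 is counted as the number of roots in the component of [l], and the roots of [a] are split
   according to membership in that component. *)
rewrite -add1n -(n_comp_connect sym l) /n_comp_mem.
rewrite -(cardID (connect G l) (predI (roots G) a)); congr (_ + _)%N.
  apply: eq_card => p.
  change ((roots G p && (p \in a)) && connect G l p = roots G p && connect G l p).
  rewrite connect_loop aP -andbA; congr (_ && _); rewrite andbC.
  case: eqVneq => [->|pl]; last case: eqVneq => [->|//].
    rewrite lS /=; apply/forall_inP => q /remS; rewrite S1P connect_loop.
    by case/and3P=> /negPf-> /negPf->.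
  rewrite rS /=; apply/forall_inP => q /remS; rewrite S1P sym.
  move=> /and3P[qr ql _]; apply/negP => qr'; have : connect G l q.
    by rewrite sym (connect_trans qr') // sym connect_loop eqxx orbT.
  by rewrite connect_loop (negPf qr) (negPf ql).
apply: eq_card => p.
change (~~ connect G l p && (roots G p && (p \in a)) = roots G p && (p \in a1)).
rewrite connect_loop aP a1P negb_or S1P.
have [|pr] := eqVneq p r; first by rewrite !andbF.
have [|pl] := eqVneq p l; first by rewrite !andbF.
rewrite /=; congr (_ && _); have [pS|//] := boolP (p \in S) => /=.
by apply: eq_forallb_in => q _; rewrite connect_splice_loop // S1P pr pl.
Qed.

End Loop.
End Step.

Fixpoint assign (s : T -> bool) (gl : seq (T * T)) (t : seq bool) : T -> bool :=
  if gl is (l, r) :: gl' then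
    update (assign s gl' (behead t)) l r (head true t)
  else s.

(** Connectivity and weights are carried through one induction because they must describe the same
    matching [f']: stacking is defined by the former, the matrix product by the latter. *)
Lemma contract (R : fieldType) (gamma : R) gl S f :
  gamma != 0 -> planar ht S f -> nested S gl ->
  exists f',
    [/\ planar ht (remaining S gl) f',
        {in remaining S gl &, forall p q,
           connect (glued_edge S f gl) p q = (p == q) || (f' p == q)}
      & forall s,
          \sum_(t <- states (size gl)) glue_seq gamma t * weight ht gamma S f (assign s gl t) =
          (gamma + gamma^-1) ^+ loops S f gl * weight ht gamma (remaining S gl) f' s].
Proof.
move=> gamma_neq0; elim: gl S f => [|[l r] gl IHgl] S f planar_f.
  move=> _; have conn p q : p \in S -> connect (glued_edge S f [::]) p q = (p == q) || (f p == q).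
    move=> pS; apply/idP/idP => [pq|/orP[] /eqP<-]; last 2 first.
    - exact: connect0.
    - by rewrite connect1 // /glued_edge pS eqxx.
    have [] := @connect_hom _ _ (glued_edge S f [::]) (glued_edge S f [::])
      [pred x | (p == x) || (f p == x)] id _ p q _ pq => //=; last by rewrite eqxx.
    move=> x y px xy; rewrite connect1 //; split=> //.
    move: xy; rewrite /glued_edge !in_nil !orbF => /andP[_ /eqP->].
    have [_ _ fK _] := planar_f p pS.
    by case/orP: px => /eqP<-; rewrite /= ?fK eqxx ?orbT.
  exists f; split=> // [p q pS _|s]; first exact: conn.
  rewrite big_seq1 /glue_seq big_nil mul1r /loops.
  rewrite (_ : n_comp _ _ = 0%N) ?expr0 ?mul1r //.
  apply: eq_card0 => p; rewrite inE; apply/negP => /andP[_].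
  by rewrite inE => /andP[pS /forall_inP/(_ p pS)]; rewrite connect0.
case/andP=> lr nest; have planar_f1 := splice_planar ht_inj planar_f lr.
have [f' [planar_f' conn' weight']] := IHgl _ _ planar_f1 nest.
have remS q : q \in remaining (S :\ l :\ r) gl -> q \in S :\ l :\ r.
  exact: subsetP (remaining_sub _ _) _.
exists f'; split=> // [p q prem qrem|s].
  rewrite -conn' //; case: (eqVneq (f l) r) => flr.
    by apply: connect_splice_loop => //; apply: remS.
  by apply: connect_splice_outer => //; apply: remS.
rewrite [size _]/= big_statesS.
transitivity (\sum_(t <- states (size gl)) glue_seq gamma t *
    ((if f l == r then gamma + gamma^-1 else 1) *
     weight ht gamma (S :\ l :\ r) (splice l r f) (assign s gl t))).
  apply: eq_bigr => t _; rewrite -weight_splice // big_bool.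
  by rewrite !glue_seq_cons mulrDr !mulrA ![glue_seq _ t * _]mulrC.
under eq_bigr do rewrite mulrCA.
rewrite -mulr_sumr weight' mulrA; congr (_ * _).
case: (eqVneq (f l) r) => flr; last by rewrite mul1r loops_splice.
by rewrite loops_splice_loop // exprS.
Qed.

End Graphs.

(** * Diagrams as matrices *)

Section Transfer.
Variables (T T' : finType) (ht : T -> nat) (ht' : T' -> nat) (h : T' -> T).
Variables (f : T -> T) (f' : T' -> T').
Hypothesis h_mono : forall p q, (ht' p < ht' q)%N = (ht (h p) < ht (h q))%N.
Hypothesis h_inj : injective h.
Hypothesis h_comm : forall p, h (f' p) = f (h p).

Lemma planar_transfer : planar ht (h @: [set: T']) f -> planar ht' setT f'.
Proof.
have hS q : h q \in h @: [set: T'] by rewrite imset_f ?inE.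
have ins p q : inside ht' f' p q = inside ht f (h p) (h q).
  by rewrite /inside !gtn_min !leq_max -h_comm !h_mono.
move=> planar_f p _; have [_ neq fK nc] := planar_f _ (hS p); split=> //.
- by apply: contra_neq neq; rewrite -h_comm => ->.
- by apply: h_inj; rewrite !h_comm.
- by move=> q _; rewrite !ins h_comm nc.
Qed.

Lemma weight_transfer (R : fieldType) (gamma : R) s :
  weight ht' gamma setT f' (fun p => s (h p)) = weight ht gamma (h @: [set: T']) f s.
Proof.
rewrite /weight big_imset; last by move=> p q _ _; apply: h_inj.
by apply: eq_bigr => p _; rewrite /arcw h_mono -h_comm.
Qed.

End Transfer.

Lemma eq_weight (T : finType) (ht : T -> nat) (R : fieldType) (gamma : R) S f f' s s' :
  f =1 f' -> s =1 s' -> weight ht gamma S f s = weight ht gamma S f' s'.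
Proof.
by move=> eq_f eq_s; apply: eq_bigr => p _; rewrite /arcw !eq_s eq_f.
Qed.

(** The definition of a diagram forbids a single order of the four ends. The eight hypotheses are
    its instances for each choice of an end of either arc and of the arc that comes first. *)
Lemma noncrossing_between a b c e : c != a -> c != b -> e != a -> e != b ->
  ~~ [&& a < c, c < b & b < e]%N -> ~~ [&& a < e, e < b & b < c]%N ->
  ~~ [&& b < c, c < a & a < e]%N -> ~~ [&& b < e, e < a & a < c]%N ->
  ~~ [&& c < a, a < e & e < b]%N -> ~~ [&& c < b, b < e & e < a]%N ->
  ~~ [&& e < a, a < c & c < b]%N -> ~~ [&& e < b, b < c & c < a]%N ->
  (minn a b < c < maxn a b)%N = (minn a b < e < maxn a b)%N.
Proof.
case: (ltngtP a c) => //; case: (ltngtP b c) => //; case: (ltngtP a e) => //;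
case: (ltngtP b e) => //; case: (leqP a b) => //= *; lia.
Qed.

Section Diagrams.
Variables m n : nat.

Lemma pos_lt (p : point m n) : (pos p < m + n)%N.
Proof. by case: p => [u|w] /=; [have := ltn_ord u | have := ltn_ord w]; lia. Qed.

Lemma pos_inj : injective (@pos m n).
Proof.
move=> [u|w] [u'|w'] /=.
- by move/ord_inj->.
- by have := ltn_ord u; lia.
- by have := ltn_ord u'; lia.
- by move=> eq_w; congr inr; apply: ord_inj; have := ltn_ord w; have := ltn_ord w'; lia.
Qed.

Lemma crossingless_planar (d : {ffun point m n -> point m n}) :
  reflect (planar (@pos m n) setT d) (crossingless d).
Proof.
apply: (iffP and3P) => [[/forallP neq /forallP dK /forallP nc] p _|planar_d].
  have {}dK q : d (d q) = q by apply/eqP.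
  split=> // q _; rewrite /inside.
  have [->|qp] := eqVneq q p; first by clear; lia.
  have [->|qdp] := eqVneq q (d p); first by rewrite dK; clear; lia.
  have pdq : d q != p by apply: contra_neq qdp => <-; rewrite dK.
  have dpdq : d q != d p by apply: contra_neq qp => eq_d; rewrite -(dK q) eq_d dK.
  have nc' x y := forallP (nc x) y.
  apply: noncrossing_between; rewrite ?(inj_eq pos_inj) //.
  - by have := nc' p (d q); rewrite dK.
  - by have := nc' (d p) q; rewrite dK.
  - by have := nc' (d p) (d q); rewrite !dK.
  - by have := nc' q (d p); rewrite dK.
  - by have := nc' (d q) p; rewrite dK.
  - by have := nc' (d q) (d p); rewrite !dK.
split; apply/forallP => p; have [_ neq dK nc] := planar_d p (in_setT p).
- exact: neq.
- exact/eqP.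
apply/forallP => q; have := nc q (in_setT q); rewrite /inside; lia.
Qed.

Lemma diagram_planar (d : diagram m n) : planar (@pos m n) setT d.
Proof. by apply/crossingless_planar; case: d. Qed.

Lemma diag_of_planar (f : point m n -> point m n) (r : rel (point m n)) :
  planar (@pos m n) setT f -> (forall p q, r p q = (f p == q)) ->
  exists2 d : diagram m n, d =1 f & forall d', diag_of r d' = (d' == d)%:R.
Proof.
move=> planar_f r_f; have cr : crossingless [ffun p => f p].
  apply/crossingless_planar; apply: (planar_transfer (h := id) (f := f)) => // [p|].
    by rewrite ffunE.
  by rewrite imset_id.
exists (Diagram cr) => [p|d']; first by rewrite ffunE.
rewrite ffunE; congr (nat_of_bool _)%:R; apply/idP/eqP => [/forallP dr|->].
  apply/val_inj/ffunP => p /=; rewrite ffunE; have /forallP/(_ (f p)) := dr p.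
  by rewrite r_f eqxx => /eqP/eqP.
by apply/forallP => p; apply/forallP => q; rewrite r_f /= ffunE.
Qed.

(* Read along the boundary of the rectangle, the top side is traversed with the
   opposite orientation, hence the negation. *)
Definition bent (u s : seq bool) : point m n -> bool := fun p =>
  match p with inl i => nth false s i | inr w => ~~ nth false u w end.

(** The factor [glue_seq gamma u] is attached to the top side only. In a product of two matrices
    each glued point thus receives exactly one [glue], from the lower factor. *)
Definition dmat (R : fieldType) (gamma : R) (d : point m n -> point m n) : mat R :=
  fun u s => if (size u == n) && (size s == m) then
    glue_seq gamma u * weight (@pos m n) gamma setT d (bent u s) else 0.

Lemma supported_dmat (R : fieldType) (gamma : R) d : supported n m (dmat gamma d).
Proof.
by move=> u s; rewrite /dmat; case: ifP => [/andP[/eqP-> /eqP->] //|_]; rewrite eqxx.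
Qed.

Lemma eq_dmat (R : fieldType) (gamma : R) d d' : d =1 d' -> dmat gamma d = dmat gamma d'.
Proof.
by move=> eq_d; apply: matP => u s; rewrite /dmat (eq_weight _ _ _ eq_d (frefl _)).
Qed.

End Diagrams.

(** * Stacking of diagrams *)

Section Composition.
Variables (a b c : nat) (x : diagram b c) (y : diagram a b).

Let T : finType := (point a b + point b c)%type.
(** The boundary of [y] is read before that of [x]. The top of [y] is traversed from right to left
    and the bottom of [x] from left to right, so glued points lie symmetrically about the junction:
    the pairs are nested, the leftmost one innermost. *)
Let ht (p : T) : nat :=
  match p with inl p' => pos p' | inr p' => (a + b + pos p')%N end.
Let f (p : T) : T := match p with inl p' => inl (y p') | inr p' => inr (x p') end.
Let gl_of (i : 'I_b) : T * T := (inl (inr i), inr (inl i)).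
Let out (p : point a c) : T :=
  match p with inl u => inl (inl u) | inr w => inr (inr w) end.

Let ht_inj : injective ht.
Proof.
case=> p [] q //=.
- by move/pos_inj->.
- by have := pos_lt p; lia.
- by have := pos_lt q; lia.
- by move/addnI/pos_inj->.
Qed.

Let planar_f : planar ht setT f.
Proof.
have y_pl := @diagram_planar _ _ y; have x_pl := @diagram_planar _ _ x.
have lt_y (p : point a b) := pos_lt p.
case=> p _ /=; [have [_ neq pK nc] := y_pl p (in_setT p)
               | have [_ neq pK nc] := x_pl p (in_setT p)].
  split=> [|||[q|q] _]; rewrite ?inE ?pK ?(inj_eq (@inl_inj _ _)) //.
    exact: nc.
  rewrite /inside /=; move: (lt_y p) (lt_y (y p)).
  by move: (pos p) (pos (y p)) (pos q) (pos (x q)) => k k' j j'; clear; lia.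
split=> [|||[q|q] _]; rewrite ?inE ?pK ?(inj_eq (@inr_inj _ _)) //.
  rewrite /inside /=; move: (lt_y q) (lt_y (y q)).
  by move: (pos p) (pos (x p)) (pos q) (pos (y q)) => k k' j j'; clear; lia.
have := nc q (in_setT q).
by rewrite /inside /= -!addn_minr -!addn_maxr !ltn_add2l.
Qed.

Let is_live (k : nat) (p : 'I_a + 'I_b + ('I_b + 'I_c)) : bool :=
  match p with
  | inl (inr i) => (k <= i)%N
  | inr (inl i) => (k <= i)%N
  | _ => true
  end.
Let live (k : nat) : {set T} := [set p | is_live k p].

Let liveS k (lt_kb : (k < b)%N) :
  live k :\ (gl_of (Ordinal lt_kb)).1 :\ (gl_of (Ordinal lt_kb)).2 = live k.+1.
Proof.
apply/setP => -[[u|i]|[i|w]]; rewrite !inE //=.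
- by rewrite (inj_eq (@inl_inj _ _)) (inj_eq (@inr_inj _ _)) -val_eqE /=; lia.
- by rewrite (inj_eq (@inr_inj _ _)) (inj_eq (@inl_inj _ _)) -val_eqE /=; lia.
Qed.

Let drop_enum k (lt_kb : (k < b)%N) :
  drop k (enum 'I_b) = Ordinal lt_kb :: drop k.+1 (enum 'I_b).
Proof.
rewrite (drop_nth (Ordinal lt_kb)) ?size_enum_ord //; congr (_ :: _).
by apply: val_inj; rewrite /= nth_enum_ord.
Qed.

Let nested_live k : (k <= b)%N ->
  nested ht (live k) [seq gl_of i | i <- drop k (enum 'I_b)] /\
  remaining (live k) [seq gl_of i | i <- drop k (enum 'I_b)] = live b.
Proof.
move=> le_kb; rewrite -(subKn le_kb); elim: (b - k)%N (leq_subr k b) => [|j IHj] le_jb.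
  by rewrite subn0 drop_oversize ?size_enum_ord.
have lt_b : (b - j.+1 < b)%N by lia.
rewrite (drop_enum lt_b) /=; rewrite liveS.
have -> : (b - j.+1).+1 = (b - j)%N by lia.
have [nest ->] := IHj (ltnW le_jb); rewrite nest andbT; split=> //.
apply/and4P; split; rewrite ?inE //=; first by lia.
apply/forall_inP => -[[u|i]|[i|w]]; rewrite inE /=.
- by move=> _; have := ltn_ord u; lia.
- by have := ltn_ord i; lia.
- by have := ltn_ord i; lia.
- by move=> _; have := ltn_ord w; lia.
Qed.

Let gl := [seq gl_of i | i <- enum 'I_b].

Let live0 : live 0 = setT.
Proof. by apply/setP => -[[u|i]|[i|w]]; rewrite !inE. Qed.

Let liveb : live b = out @: [set: point a c].
Proof.
apply/setP => p; rewrite inE; apply/idP/imsetP => [|[[u|w] _ ->]] //.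
case: p => -[u|i] /=.
- by exists (inl u); rewrite ?inE.
- by rewrite leqNgt ltn_ord.
- by rewrite leqNgt ltn_ord.
- by exists (inr i); rewrite ?inE.
Qed.

Let glue_gl : nested ht setT gl /\ remaining setT gl = out @: [set: point a c].
Proof. by rewrite -live0 -liveb /gl -(drop0 (enum 'I_b)); apply: nested_live. Qed.

Let assignE s (t : seq bool) js p : uniq js ->
  assign s [seq gl_of i | i <- js] t p =
  match p with
  | inl (inr i) => if i \in js then ~~ nth true t (index i js) else s p
  | inr (inl i) => if i \in js then nth true t (index i js) else s p
  | _ => s p
  end.
Proof.
elim: js t => [|j js IHjs] t /=; first by case: p => -[].
case/andP=> j_js uniq_js; rewrite /update {}IHjs //.
case: p => [[u|i]|[i|w]] //=.
- rewrite (inj_eq (@inl_inj _ _)) (inj_eq (@inr_inj _ _)) inE [j == i]eq_sym.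
  by case: eqVneq => //= _; case: t => //=; rewrite nth_nil.
- rewrite (inj_eq (@inr_inj _ _)) (inj_eq (@inl_inj _ _)) inE [j == i]eq_sym.
  by case: eqVneq => //= _; case: t => //=; rewrite nth_nil.
Qed.

Let weight_f (R : fieldType) (gamma : R) s :
  weight ht gamma setT f s =
  weight (@pos b c) gamma setT x (fun p => s (inr p)) *
  weight (@pos a b) gamma setT y (fun p => s (inl p)).
Proof.
rewrite /weight big_sumType [RHS]mulrC; congr (_ * _).
  by apply: eq_big => [p|p _]; rewrite ?inE.
apply: eq_big => [p|p _]; first by rewrite !inE.
by rewrite /arcw /= ltn_add2l.
Qed.

Let G := glued_edge setT f gl.
Let E := stack_edge x y.
Let to_stack (p : T) : stack_point a b c :=
  match p with inl p' => of_lower c p' | inr p' => of_upper a p' end.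

Let mem_gl p q : (p, q) \in gl = [exists i, (p, q) == gl_of i].
Proof.
apply/mapP/existsP => [[i _ ->]|[i /eqP->]]; first by exists i.
by exists i; rewrite ?mem_enum.
Qed.

Let G_sym : connect_sym G. Proof. exact: glued_edge_sym planar_f. Qed.

Let to_stack_eq p q : to_stack p = to_stack q -> connect G p q.
Proof.
case: p q => -[u|i] [] [v|j] //= [] => [->|->|eq_ij|eq_ij|->|->]; try exact: connect0.
- rewrite eq_ij connect1 // /G /glued_edge mem_gl.
  by apply/or3P/Or32/existsP; exists v.
- rewrite eq_ij connect1 // /G /glued_edge [X in [|| _, _ | X]]mem_gl.
  by apply/or3P/Or33/existsP; exists j.
Qed.

Let connect_to_stack p q : connect E (to_stack p) (to_stack q) = connect G p q.
Proof.
apply/idP/idP => [|pq].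
  move/connectP => [s]; elim: s p => [|v s IHs] p /=.
    by move=> _ /esym/to_stack_eq.
  case/andP=> /orP[] /existsP[p' /andP[/eqP def_p /eqP def_v]].
  - have -> : v = to_stack (inr (x p')) by [].
    move=> path_s last_s; apply: connect_trans (IHs _ path_s last_s).
    apply: connect_trans (to_stack_eq (q := inr p') def_p) _.
    by rewrite connect1 // /G /glued_edge inE /= eqxx.
  - have -> : v = to_stack (inl (y p')) by [].
    move=> path_s last_s; apply: connect_trans (IHs _ path_s last_s).
    apply: connect_trans (to_stack_eq (q := inl p') def_p) _.
    by rewrite connect1 // /G /glued_edge inE /= eqxx.
have [] // := @connect_hom _ _ G E predT to_stack _ p q isT pq.
move=> {pq}{}p {}q _; rewrite /G /glued_edge !mem_gl inE /= => edge; split=> //.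
case/or3P: edge => [/eqP->|/existsP[i /eqP[-> ->]]|/existsP[i /eqP[-> ->]]]; try exact: connect0.
apply: connect1; rewrite /E /stack_edge; case: p => p /=.
  by apply/orP; right; apply/existsP; exists p; rewrite !eqxx.
by apply/orP; left; apply/existsP; exists p; rewrite !eqxx.
Qed.

Let of_outerE (p : point a c) : of_outer b p = to_stack (out p).
Proof. by case: p. Qed.

Let to_stack_surj v : {p | v = to_stack p}.
Proof.
case: v => [[u|i]|w]; [exists (inl (inl u)) | exists (inl (inr i)) | exists (inr (inr w))];
by [].
Qed.

Let E_sym : connect_sym E.
Proof.
move=> v w; have [p ->] := to_stack_surj v; have [q ->] := to_stack_surj w.
by rewrite !connect_to_stack G_sym.
Qed.

Let loopsE : stack_loops x y = loops setT f gl.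
Proof.
rewrite /stack_loops /loops -/E -/G.
set A1 := [pred v | _]; set A2 := [pred p | _].
rewrite (@adjunction_n_comp _ _ to_stack E G E_sym G_sym A1).
- apply: eq_n_comp_r => p; rewrite !inE /= (glue_gl.2).
  apply/forallP/forall_inP => [no q /imsetP[q' _ ->]|no q].
    by have := no q'; rewrite of_outerE connect_to_stack.
  by rewrite of_outerE connect_to_stack no // imset_f.
- apply: (intro_closed E_sym) => v w edge; rewrite !inE => /forallP no; apply/forallP => p.
  by apply: contra (no p); apply: connect_trans; apply: connect1.
split=> [v _|p q _]; last by rewrite connect_to_stack.
by have [p ->] := to_stack_surj v; exists p; apply: connect0.
Qed.

Let out_mono (p q : point a c) : (pos p < pos q)%N = (ht (out p) < ht (out q))%N.
Proof.
case: p q => [u|w] [u'|w'] //=.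
- by have := ltn_ord u; lia.
- by have := ltn_ord u'; lia.
- by lia.
Qed.

Let out_inj : injective out.
Proof. by move=> [u|w] [u'|w'] //= [->]. Qed.

(** The sum over the inner words of the matrix product is the sum over signs at the glued points,
    which [contract] evaluates. *)
Lemma mulm_dmat (R : fieldType) (gamma : R) : gamma != 0 ->
  exists z : point a c -> point a c,
  [/\ planar (@pos a c) setT z,
      forall p q, stack_strand x y p q = (z p == q)
    & mulm b (dmat gamma x) (dmat gamma y) =
      scalem ((gamma + gamma^-1) ^+ stack_loops x y) (dmat gamma z)].
Proof.
move=> gamma_neq0; have [nest rem] := glue_gl.
have [f' []] := contract ht_inj gamma_neq0 planar_f nest.
rewrite rem -/G => planar_f' conn wt.
(* By [outz] below a suitable point always exists, so the default [p] is never taken. *)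
pose z p := odflt p [pick q | out q == f' (out p)].
have outz p : out (z p) = f' (out p).
  have outp : out p \in out @: [set: point a c] by rewrite imset_f ?inE.
  have [/imsetP[q _ def_q] _ _ _] := planar_f' _ outp.
  by rewrite /z; case: pickP => [q' /eqP //|/(_ q)]; rewrite def_q eqxx.
have planar_z := planar_transfer out_mono out_inj outz planar_f'.
exists z; split=> // [p q|].
  have [_ neq _ _] := planar_z p (in_setT p).
  rewrite /stack_strand !of_outerE connect_to_stack conn ?imset_f ?inE //.
  rewrite -outz !(inj_eq out_inj); case: eqVneq => [<-|] //=.
  by rewrite (negPf neq).
apply: matP => u s; rewrite /mulm /scalem /dmat.
have [size_us|] := boolP ((size u == c) && (size s == a)); last first.
  rewrite mulr0 negb_and => /orP[/negPf-> | /negPf->]; rewrite big1 // => t _.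
    by rewrite mul0r.
  by rewrite andbF mulr0.
have [/eqP size_u /eqP size_s] := andP size_us.
pose sg (p : T) := match p with inl p' => bent [::] s p' | inr p' => bent u [::] p' end.
have -> : weight (@pos a c) gamma setT z (bent u s) =
          weight ht gamma (out @: [set: point a c]) f' sg.
  rewrite -(weight_transfer out_mono out_inj outz).
  by apply: eq_weight => // -[i|w].
rewrite mulrCA loopsE -wt size_map size_enum_ord mulr_sumr.
rewrite big_seq [RHS]big_seq; apply: eq_bigr => t; rewrite mem_states => /eqP size_t.
rewrite size_u size_s size_t !eqxx /= weight_f.
(* A glued point carries its letter of [t] when seen from [x] and the negation when seen from [y];
   this is how [update] treats [r] and [l], and how [bent] treats bottom and top. *)
have -> : weight (@pos b c) gamma setT x (fun p => assign sg gl t (inr p)) =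
          weight (@pos b c) gamma setT x (bent u t).
  apply: eq_weight => // -[i|w]; rewrite assignE ?enum_uniq ?mem_enum //=.
  by rewrite index_enum_ord; apply: set_nth_default; rewrite size_t.
have -> : weight (@pos a b) gamma setT y (fun p => assign sg gl t (inl p)) =
          weight (@pos a b) gamma setT y (bent t s).
  apply: eq_weight => // -[i|w]; rewrite assignE ?enum_uniq ?mem_enum //=.
  by rewrite index_enum_ord; congr (~~ _); apply: set_nth_default; rewrite size_t.
by rewrite -!mulrA; congr (_ * _); rewrite mulrCA.
Qed.

End Composition.

(** * Juxtaposition of diagrams *)

Section Juxtaposition.
Variables (m1 n1 m2 n2 : nat) (x : diagram m1 n1) (y : diagram m2 n2).

Let T : finType := (point m1 n1 + point m2 n2)%type.
(** Along the boundary of the juxtaposition the points of [y] form one block, between the bottom and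
    the top of [x]. Hence no arc of [x] separates two points of [y]. *)
Let ht (p : T) : nat :=
  match p with
  | inl (inl u) => u
  | inl p' => (pos p' + (m2 + n2))%N
  | inr p' => (m1 + pos p')%N
  end.
Let f (p : T) : T := match p with inl p' => inl (x p') | inr p' => inr (y p') end.

Let join (p : T) : point (m1 + m2) (n1 + n2) :=
  match p with
  | inl (inl u) => inl (lshift m2 u)
  | inl (inr w) => inr (lshift n2 w)
  | inr (inl u) => inl (rshift m1 u)
  | inr (inr w) => inr (rshift n1 w)
  end.

Let splitK : cancel (@point_split m1 m2 n1 n2) join.
Proof.
by case=> u; rewrite /point_split; case: splitP => v eq_uv /=;
  [congr inl|congr inl|congr inr|congr inr]; apply: val_inj; rewrite /= -eq_uv.
Qed.

Let joinK : cancel join (@point_split m1 m2 n1 n2).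
Proof.
by case=> -[u|w]; rewrite /point_split /=; case: splitP => v /= eq_v;
  first [by have := ltn_ord u; lia | by have := ltn_ord w; lia
        | by have := ltn_ord v; lia | congr (inl _) | congr (inr _)];
  first [congr (inl _) | congr (inr _)]; apply: val_inj => /=; lia.
Qed.

Let ht_inl p q : (ht (inl p) < ht (inl q))%N = (pos p < pos q)%N.
Proof.
case: p q => [u|w] [u'|w'] //=; last by rewrite ltn_add2r.
- by have := ltn_ord u; lia.
- by have := ltn_ord u'; lia.
Qed.

Let ht_block p q : (ht (inl p) < ht (inr q))%N = (pos p < m1)%N /\
                   (ht (inr q) < ht (inl p))%N = (m1 <= pos p)%N.
Proof. by case: p => [u|w] /=; have := pos_lt q; [have := ltn_ord u | ]; lia. Qed.

Let planar_f : planar ht setT f.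
Proof.
have x_pl := @diagram_planar _ _ x; have y_pl := @diagram_planar _ _ y.
case=> p _ /=; [have [_ neq pK nc] := x_pl p (in_setT p)
               | have [_ neq pK nc] := y_pl p (in_setT p)].
  split=> [|||[q|q] _]; rewrite ?inE ?pK ?(inj_eq (@inl_inj _ _)) //.
    have := nc q (in_setT q).
    by rewrite /inside !gtn_min !leq_max -/(f (inl p)) /= !ht_inl.
  rewrite /inside !gtn_min !leq_max /f.
  by rewrite !(ht_block p _).1 !(ht_block p _).2 !(ht_block (x p) _).1 !(ht_block (x p) _).2.
split=> [|||[q|q] _]; rewrite ?inE ?pK ?(inj_eq (@inr_inj _ _)) //.
  rewrite /inside !gtn_min !leq_max /f !(ht_block _ _).1 !(ht_block _ _).2; lia.
have := nc q (in_setT q).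
by rewrite /inside /= -!addn_minr -!addn_maxr !ltn_add2l.
Qed.

Let weight_f (R : fieldType) (gamma : R) s :
  weight ht gamma setT f s =
  weight (@pos m1 n1) gamma setT x (fun p => s (inl p)) *
  weight (@pos m2 n2) gamma setT y (fun p => s (inr p)).
Proof.
rewrite /weight big_sumType; congr (_ * _).
  by apply: eq_big => [p|p _]; rewrite ?inE // /arcw ht_inl.
by apply: eq_big => [p|p _]; rewrite ?inE // /arcw /= ltn_add2l.
Qed.

Let split_mono p q :
  (pos p < pos q)%N = (ht (@point_split m1 m2 n1 n2 p) < ht (@point_split m1 m2 n1 n2 q))%N.
Proof.
rewrite -[p]splitK -[q]splitK !joinK.
by case: (point_split p) => -[u|w]; case: (point_split q) => -[u'|w'] /=;
  move: (ltn_ord u) || move: (ltn_ord w); move: (ltn_ord u') || move: (ltn_ord w');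
  lia.
Qed.

Lemma dmat_juxt :
  exists z : point (m1 + m2) (n1 + n2) -> point (m1 + m2) (n1 + n2),
  [/\ planar (@pos (m1 + m2) (n1 + n2)) setT z,
      forall p q, juxt_strand x y p q = (z p == q)
    & forall (R : fieldType) (gamma : R),
        dmat gamma z = tensm n1 m1 (dmat gamma x) (dmat gamma y)].
Proof.
pose z p := join (f (point_split p)).
have split_inj := can_inj splitK.
have split_z p : point_split (z p) = f (point_split p) by exact: joinK.
have split_onto : @point_split m1 m2 n1 n2 @: setT = setT.
  apply/setP => p; rewrite inE; apply/imsetP; exists (join p); first by rewrite inE.
  exact/esym/joinK.
exists z; split=> [|p q|R gamma].
- by apply: planar_transfer split_mono split_inj split_z _; rewrite split_onto.
- rewrite -(inj_eq split_inj) split_z /juxt_strand.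
  by case: (point_split p) (point_split q) => p' [] q' //=.
apply: matP => u s; rewrite /dmat /tensm.
have -> : (size u == (n1 + n2)%N) && (size s == (m1 + m2)%N) =
    ((size (take n1 u) == n1) && (size (take m1 s) == m1)) &&
    ((size (drop n1 u) == n2) && (size (drop m1 s) == m2)).
  by rewrite !size_take_min !size_drop; lia.
case: ifP => [/andP[-> ->]|/negbT]; last first.
  by rewrite negb_and => /orP[] /negPf->; rewrite ?mul0r ?mulr0.
rewrite mulrACA; congr (_ * _).
  by rewrite /glue_seq -big_cat cat_take_drop.
rewrite -(weight_f gamma (fun p => match p with
  | inl p' => bent (take n1 u) (take m1 s) p'
  | inr p' => bent (drop n1 u) (drop m1 s) p' end)).
rewrite -split_onto -(weight_transfer split_mono split_inj split_z).
apply: eq_weight => // p; rewrite -{1}[p]splitK.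
case: (point_split p) => -[i|i] /=; rewrite ?nth_take ?nth_drop ?ltn_ord //.
Qed.

End Juxtaposition.

(** * Reflection of diagrams *)

Lemma point_flipK m n : cancel (@point_flip m n) (@point_flip n m).
Proof. by case. Qed.

Lemma pos_flip m n (p : point m n) : (pos (point_flip p) + pos p).+1 = (m + n)%N.
Proof. by case: p => [u|w] /=; [have := ltn_ord u | have := ltn_ord w]; lia. Qed.

Section Flip.
Variables (m n : nat) (x : diagram m n).

Definition flip_fun (p : point n m) : point n m := point_flip (x (point_flip p)).

Lemma flip_planar : planar (@pos n m) setT flip_fun.
Proof.
have x_pl := @diagram_planar _ _ x.
have ins (p q : point n m) :
    inside (@pos n m) flip_fun p q = inside (@pos m n) x (point_flip p) (point_flip q).
  have lt (r t : point n m) : (pos r < pos t)%N = (pos (point_flip t) < pos (point_flip r))%N.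
    by have := pos_flip r; have := pos_flip t; lia.
  by rewrite /inside !gtn_min !leq_max !lt /flip_fun !point_flipK andbC;
    congr (_ && _); rewrite orbC.
move=> p _; have [_ neq xK nc] := x_pl (point_flip p) (in_setT _).
split=> // [||q _].
- by apply: contra_neq neq; rewrite /flip_fun => {2}<-; rewrite point_flipK.
- by rewrite /flip_fun point_flipK xK point_flipK.
- by rewrite !ins nc // /flip_fun point_flipK.
Qed.

Lemma capw_flip (R : fieldType) (gamma : R) a b :
  capw gamma (~~ b) (~~ a) = capw gamma a b.
Proof. by case: a; case: b. Qed.

(** Reflection reverses the boundary order, which exchanges the two ends of each arc, and negates
    the bent signs; [capw] is invariant under both operations together. The reindexing therefore
    sends the first end of an arc to the reflection of the second. *)
Lemma weight_flip (R : fieldType) (gamma : R) u s :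
  weight (@pos n m) gamma setT flip_fun (bent s u) =
  weight (@pos m n) gamma setT x (bent u s).
Proof.
have xK p : x (x p) = p by have [] := @diagram_planar _ _ x p (in_setT p).
have bent_flip (p : point m n) : bent s u (point_flip p) = ~~ bent u s p.
  by case: p => i //=; rewrite negbK.
rewrite /weight (reindex (fun p => point_flip (x p))) /=; last first.
  apply: onW_bij; exists (fun p => x (point_flip p)) => p.
    by rewrite point_flipK xK.
  by rewrite xK point_flipK.
apply: eq_big => [p|p _]; first by rewrite !inE.
rewrite /arcw /flip_fun point_flipK xK.
have -> : (pos (point_flip (x p)) < pos (point_flip p))%N = (pos p < pos (x p))%N.
  by have := pos_flip p; have := pos_flip (x p); lia.
by rewrite !bent_flip capw_flip.
Qed.

End Flip.

Lemma glue_seqE (R : fieldType) (gamma : R) t : glue_seq gamma t = gamma ^+ count negb t.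
Proof.
elim: t => [|e t IHt]; first by rewrite /glue_seq big_nil.
by rewrite glue_seq_cons IHt; case: e; rewrite /= ?mul1r // add1n exprS.
Qed.

Lemma sum_nth_count (a : pred bool) s n : size s = n ->
  (\sum_(i < n) a (nth false s i))%N = count a s.
Proof.
move=> <-; rewrite -sum1_count [RHS]big_mkcond [RHS](big_nth false) big_mkord.
by apply: eq_bigr => i _; case: (a _).
Qed.

Section Weights.
Variables (m n : nat) (x : diagram m n).

Let xK p : x (x p) = p. Proof. by have [] := @diagram_planar _ _ x p (in_setT p). Qed.
Let x_neq p : x p != p. Proof. by have [] := @diagram_planar _ _ x p (in_setT p). Qed.

Lemma weight_neq0 (R : fieldType) (gamma : R) s : gamma != 0 ->
  (weight (@pos m n) gamma setT x s != 0) = [forall p, s (x p) == ~~ s p].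
Proof.
move=> gamma_neq0; have capw_neq0 a b : (capw gamma a b != 0) = (b == ~~ a).
  by case: a; case: b; rewrite /= ?eqxx ?oner_neq0 ?invr_neq0.
rewrite /weight prodf_seq_neq0; apply/allP/forallP => [neq0 p|opp p _].
  have arcP q : (pos q < pos (x q))%N -> s (x q) == ~~ s q.
    move=> lt_q; have := neq0 q (mem_index_enum q).
    by rewrite inE /= /arcw lt_q capw_neq0.
  case: (ltngtP (pos p) (pos (x p))) => [/arcP //|lt_p|/pos_inj eq_p].
    by have := arcP (x p); rewrite xK => /(_ lt_p)/eqP->; rewrite negbK.
  by have := x_neq p; rewrite -eq_p eqxx.
by rewrite inE /= /arcw; case: ifP; rewrite ?oner_neq0 // capw_neq0 opp.
Qed.

Lemma dmat_neq0 (R : fieldType) (gamma : R) u s : gamma != 0 ->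
  (dmat gamma x u s != 0) =
  [&& size u == n, size s == m & [forall p, bent u s (x p) == ~~ bent u s p]].
Proof.
move=> gamma_neq0; rewrite /dmat andbA; case: ifP => _; last by rewrite eqxx.
by rewrite mulf_eq0 negb_or glue_seq_neq0 // weight_neq0.
Qed.

(** In a non-zero entry every strand joins opposite bent signs, so exactly half of the points are
    positive. Counted in minus signs, this is a conservation law between bottom and top. *)
Lemma dmat_charge (R : fieldType) (gamma : R) u s : gamma != 0 ->
  dmat gamma x u s != 0 ->
  [/\ size u = n, size s = m & (2 * count negb s + n = 2 * count negb u + m)%N].
Proof.
move=> gamma_neq0; rewrite /dmat; case: ifP => [/andP[/eqP size_u /eqP size_s]|_]; last first.
  by rewrite eqxx.
rewrite mulf_eq0 negb_or => /andP[_]; rewrite weight_neq0 // => /forallP opp.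
split=> //.
have eq_sum : (\sum_(p : point m n) bent u s p = \sum_(p : point m n) ~~ bent u s p)%N.
  rewrite (reindex x) /=; last by apply: onW_bij; exists x.
  by apply: eq_bigr => p _; rewrite (eqP (opp p)).
move: eq_sum; rewrite !big_sumType /=.
rewrite (sum_nth_count id size_s) (sum_nth_count negb size_s).
rewrite (sum_nth_count negb size_u) (sum_nth_count (fun e => ~~ ~~ e) size_u).
have -> : count (fun e => ~~ ~~ e) u = count id u by apply: eq_count => -[].
have := count_predC negb s; have := count_predC negb u.
have -> : count (predC negb) u = count id u by apply: eq_count => -[].
have -> : count (predC negb) s = count id s by apply: eq_count => -[].
by rewrite size_u size_s; lia.
Qed.

(* [gamma] to the power [(m - n) / 2]. *)
Definition flip_scale (R : fieldType) (gamma : R) : R :=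
  gamma ^+ (m - n)./2 / gamma ^+ (n - m)./2.

(** The arc weights agree by [weight_flip], so the matrices differ by the ratio of [glue_seq] at the
    top and at the bottom. On non-zero entries [dmat_charge] makes this ratio a constant. *)
Lemma dmat_flip (R : fieldType) (gamma : R) : gamma != 0 ->
  dmat gamma (flip_fun x) = scalem (flip_scale gamma) (trm (dmat gamma x)).
Proof.
move=> gamma_neq0; apply: matP => s u; rewrite /scalem /trm.
have flipE : glue_seq gamma u * dmat gamma (flip_fun x) s u =
    glue_seq gamma s * dmat gamma x u s.
  rewrite /dmat andbC; case: ifP => _; last by rewrite !mulr0.
  by rewrite weight_flip mulrCA.
have [dx0|dx_neq0] := eqVneq (dmat gamma x u s) 0.
  move: flipE; rewrite dx0 !mulr0 => /eqP; rewrite mulf_eq0.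
  by rewrite (negPf (glue_seq_neq0 gamma_neq0 u)) => /eqP.
have [size_u size_s charge] := dmat_charge gamma_neq0 dx_neq0.
apply: (mulfI (glue_seq_neq0 gamma_neq0 u)); rewrite flipE mulrA; congr (_ * _).
have expn_neq0 k : gamma ^+ k != 0 by rewrite expf_neq0.
rewrite !glue_seqE /flip_scale mulrA; apply: (mulIf (expn_neq0 (n - m)./2)).
rewrite mulfVK // -!exprD; congr (_ ^+ _); lia.
Qed.

End Weights.

(** Lets the diagrams specified through [strands] be verified by arithmetic on indices, without an
    explicit partner function. *)
Lemma planar_of_rel m n (r : rel (point m n)) :
  (forall p, exists q, r p q) ->
  (forall p q q', r p q -> r p q' -> q = q') ->
  (forall p q, r p q -> r q p) ->
  (forall p, ~~ r p p) ->
  (forall p q p' q', r p p' -> r q q' ->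
     ~~ [&& pos p < pos q, pos q < pos p' & pos p' < pos q']%N) ->
  exists2 f : point m n -> point m n, planar (@pos m n) setT f &
    forall p q, r p q = (f p == q).
Proof.
move=> total functional sym irr nc.
pose f p := odflt p [pick q | r p q].
have rf p : r p (f p).
  by rewrite /f; case: pickP => // none; have [q] := total p; rewrite none.
have rE p q : r p q = (f p == q).
  by apply/idP/eqP => [rpq|<-//]; apply: functional rpq.
exists f => //.
have cr : crossingless [ffun p => f p].
  apply/and3P; split; apply/forallP => p; rewrite ?ffunE ?ffunE.
  - by apply: contra (irr p) => /eqP {2}<-.
  - by rewrite -rE sym.
  - by apply/forallP => q; rewrite !ffunE nc.
apply: (planar_transfer (h := id) (f := [ffun p => f p])) => // [p|].
  by rewrite ffunE.
by rewrite imset_id; apply/crossingless_planar.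
Qed.

Lemma id_planar n : exists2 f : point n n -> point n n, planar (@pos n n) setT f &
  forall p q, @strands no_strand eq_op no_strand n n p q = (f p == q).
Proof.
apply: planar_of_rel.
- case=> u; [exists (inr u) | exists (inl u)]; exact: eqxx.
- by case=> u [v|v] [w|w] //= /eqP eq1 /eqP eq2; congr (_ _); apply: val_inj => /=; congruence.
- by case=> u [v|v].
- by case.
- case=> u [v|v] [w|w] [t|t] //= /eqP eq1 /eqP eq2;
   by have := ltn_ord u; have := ltn_ord v; have := ltn_ord w; have := ltn_ord t; lia.
Qed.

Lemma cupcap_planar n j : (j.+1 < n)%N ->
  exists2 f : point n n -> point n n, planar (@pos n n) setT f &
  forall p q, strands (hook j) (fun u w => [&& u == w, u != j & u != j.+1]) (hook j) p q
    = (f p == q).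
Proof.
move=> lt_jn; have lt_j : (j < n)%N by lia.
apply: planar_of_rel.
- have ex (u : 'I_n) :
      (exists v : 'I_n, hook j u v) \/ [&& u == u, u != j :> nat & u != j.+1 :> nat].
    have [u_j|u_j] := eqVneq (u : nat) j.
      by left; exists (Ordinal lt_jn); rewrite /hook u_j !eqxx.
    have [u_j1|u_j1] := eqVneq (u : nat) j.+1.
      by left; exists (Ordinal lt_j); rewrite /hook u_j1 !eqxx orbT.
    by right; rewrite eqxx.
  case=> u; have [[v uv]|uu] := ex u;
    [exists (inl v)|exists (inr u)|exists (inr v)|exists (inl u)] => //=.
- by case=> u [v|v] [w|w] //=; rewrite /hook => r1 r2; try (exfalso; lia);
    congr (_ _); apply: val_inj => /=; lia.
- by case=> u [v|v] //=; rewrite /hook; lia.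
- by case=> u /=; rewrite /hook; lia.
- case=> u [v|v] [w|w] [t|t] //=; rewrite /hook => r1 r2;
   have := ltn_ord u; have := ltn_ord v; have := ltn_ord w; have := ltn_ord t; lia.
Qed.

Lemma vertex_planar x y z : admissible x y z ->
  let p := ((x + y - z)./2)%N in
  exists2 f : point (x + y) z -> point (x + y) z, planar (@pos (x + y) z) setT f &
  forall u w, strands
    (fun u v => (x - p <= minn u v) && ((u + v).+1 == 2 * x))%N
    (fun u w => ((u < x - p) && (w == u)) || ((x + p <= u) && (w + 2 * p == u)))%N
    no_strand u w = (f u == w).
Proof.
case/and4P=> even_xyz le_x le_y le_z p.
(* Parity makes the halving in [p] exact. The triangle inequalities then amount to p <= x, p <= y
   and to the subtraction not being truncated. *)
have eq_p : (2 * p + z = x + y)%N.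
  have := odd_double_half (x + y - z); rewrite -/p.
  have -> : odd (x + y - z) = false by rewrite oddB //; move: even_xyz; rewrite !oddD; lia.
  by rewrite -mul2n; lia.
have le_px : (p <= x)%N by lia.
have le_py : (p <= y)%N by lia.
move: p eq_p le_px le_py => p eq_p le_px le_py {even_xyz le_x le_y le_z}.
apply: planar_of_rel.
- case=> u; have lt_u := ltn_ord u.
    have [lt_xp|le_xp] := ltnP u (x - p).
      have lt_uz : (u < z)%N by lia.
      by exists (inr (Ordinal lt_uz)); rewrite /= lt_xp eqxx.
    have [le_u|gt_u] := leqP (x + p) u.
      have lt_uz : (u - 2 * p < z)%N by lia.
      by exists (inr (Ordinal lt_uz)) => /=; lia.
    have lt_v : (2 * x - u.+1 < x + y)%N by lia.
    by exists (inl (Ordinal lt_v)) => /=; lia.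
  have [lt_xp|le_xp] := ltnP u (x - p).
    have lt_v : (u < x + y)%N by lia.
    by exists (inl (Ordinal lt_v)) => /=; lia.
  have lt_v : (u + 2 * p < x + y)%N by lia.
  by exists (inl (Ordinal lt_v)) => /=; lia.
- by case=> u [v|v] [w|w] //= r1 r2; try (exfalso; lia);
    congr (_ _); apply: val_inj => /=; lia.
- by case=> u [v|v] //=; lia.
- by case=> u //=; lia.
- case=> u [v|v] [w|w] [t|t] //= r1 r2;
   have := ltn_ord u; have := ltn_ord v; have := ltn_ord w; have := ltn_ord t; lia.
Qed.

(** At each index [glue] times the arc weight is 1 if the two signs agree and 0 otherwise. *)
Lemma dmat_id (R : fieldType) (gamma : R) n (f : point n n -> point n n) :
  gamma != 0 ->
  (forall u, f (inl u) = inr u) -> (forall u, f (inr u) = inl u) ->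
  dmat gamma f = idm n.
Proof.
move=> gamma_neq0 fl fr; apply: matP => u s; rewrite /dmat /idm.
have [size_s|size_s] := eqVneq (size s) n; last by rewrite andbF andbF.
have [size_u|size_u] := eqVneq (size u) n; last first.
  by rewrite andbT; case: eqP => // eq_us; rewrite eq_us size_s eqxx in size_u.
rewrite /= andbT /weight big_sumType /= [X in _ * (_ * X)]big1 ?mulr1; last first.
  by move=> w _; rewrite /arcw fr /=; case: ifP => //; have := ltn_ord w; lia.
have -> : \prod_(i < n | inl i \in [set: point n n]) arcw (@pos n n) gamma f (bent u s) (inl i) =
    \prod_(i < n) capw gamma (nth false s i) (~~ nth false u i).
  apply: eq_big => [i|i _]; first by rewrite inE.
  by rewrite /arcw fl /=; case: ifP => //; have := ltn_ord i; lia.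
have -> : glue_seq gamma u = \prod_(i < n) glue gamma (nth false u i).
  by rewrite /glue_seq (big_nth false) big_mkord size_u.
rewrite -big_split /=; have [<-|neq_us] := eqVneq u s.
  rewrite big1 // => i _; case: (nth false u i) => /=; first by rewrite mulr1.
  by rewrite divff.
have [i neq_i] : exists i : 'I_n, nth false u i != nth false s i.
  apply/existsP; apply: contraR neq_us => /existsPn eq_us; apply/eqP.
  apply: (@eq_from_nth _ false); first by rewrite size_u.
  move=> k; rewrite size_u => lt_k.
  by have := eq_us (Ordinal lt_k); rewrite negbK => /eqP.
rewrite (bigD1 i) //=; move: neq_i.
by case: (nth false u i); case: (nth false s i); rewrite /= ?mulr0 ?mul0r.
Qed.

(** * Caps joining neighbours *)

Section CapSwap.
Variables (m n : nat) (x : diagram m n) (u0 v0 : 'I_m).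
Hypotheses (v0E : v0 = u0.+1 :> nat) (x_u0 : x (inl u0) = inl v0).
Variables (R : fieldType) (gamma : R).
Hypothesis gamma_neq0 : gamma != 0.

Let x_v0 : x (inl v0) = inl u0.
Proof. by rewrite -x_u0; have [] := @diagram_planar _ _ x (inl u0) (in_setT _). Qed.

Lemma weight_cap s : weight (@pos m n) gamma setT x s =
  capw gamma (s (inl u0)) (s (inl v0)) *
  \prod_(p in setT :\ inl u0 :\ inl v0) arcw (@pos m n) gamma x s p.
Proof.
rewrite /weight (big_setD1 (inl u0)) ?inE //= (big_setD1 (inl v0)) /=; last first.
  by rewrite !inE andbT (inj_eq (@inl_inj _ _)) -val_eqE /= v0E; lia.
rewrite {1}/arcw x_u0 /= v0E ltnSn; congr (_ * _).
by rewrite {1}/arcw x_v0 /= v0E ltnNge leqnSn mul1r.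
Qed.

(** The two signs under the cap enter only the factor of the cap, and [capw] is 1 on the reference
    pair [true], [false]. *)
Lemma dmat_cap u w a b w' : size w = u0 ->
  dmat gamma x u (w ++ a :: b :: w') =
  capw gamma a b * dmat gamma x u (w ++ true :: false :: w').
Proof.
move=> size_w; rewrite /dmat !size_cat /=; case: ifP => _; last by rewrite mulr0.
rewrite mulrCA; congr (_ * _); rewrite !weight_cap.
have nth0 c e : nth false (w ++ c :: e :: w') u0 = c.
  by rewrite nth_cat size_w ltnn subnn.
have nth1 c e : nth false (w ++ c :: e :: w') v0 = e.
  by rewrite nth_cat size_w v0E ltnNge leqnSn /= subSnn.
rewrite /= !nth0 !nth1 mul1r; congr (_ * _).
apply: eq_bigr => p; rewrite !inE andbT => /andP[pv pu].
have bentE q : q != inl v0 -> q != inl u0 ->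
    bent u (w ++ a :: b :: w') q = bent u (w ++ true :: false :: w') q :> bool.
  case: q => [i|//]; rewrite /= !(inj_eq (@inl_inj _ _)) -!val_eqE /= v0E => iv iu.
  rewrite !nth_cat size_w; case: ltnP => // le_i.
  by have -> : (i - u0 = (i - u0.+2).+2)%N by lia.
rewrite /arcw !bentE //.
- have [_ _ xK _] := @diagram_planar _ _ x p (in_setT p).
  by apply: contra_neq pu => eq_xp; rewrite -xK eq_xp.
- have [_ _ xK _] := @diagram_planar _ _ x p (in_setT p).
  by apply: contra_neq pv => eq_xp; rewrite -xK eq_xp.
Qed.

End CapSwap.

Section Trichotomy.
Variables m n : nat.

Definition has_cap (x : diagram m n) : bool :=
  [exists u : 'I_m, exists v : 'I_m, (v == u.+1 :> nat) && (x (inl u) == inl v)].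

(** If an arc does not join neighbours, planarity traps the arc starting at [u.+1] strictly inside
    it; descent on the width, bounded by [k], reaches a cap. *)
Lemma bottom_arc_cap (x : diagram m n) (u v : 'I_m) : x (inl u) = inl v -> has_cap x.
Proof.
have x_pl := @diagram_planar _ _ x.
have [xK x_neq] : (forall p, x (x p) = p) /\ (forall p, x p != p).
  by split=> p; have [] := x_pl p (in_setT p).
wlog lt_uv : u v / (u < v)%N => [th xu|].
  case: (ltngtP u v) => [/th/(_ xu) //|lt_vu|/val_inj eq_uv].
    by apply: th lt_vu _; rewrite -xu xK.
  by have := x_neq (inl u); rewrite xu eq_uv eqxx.
have [k le_k] : exists k, (v - u <= k)%N by exists (v - u)%N.
elim: k u v le_k lt_uv => [|k IHk] u v le_k lt_uv xu; first by lia.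
have [eq_v|neq_v] := eqVneq (v : nat) u.+1.
  by apply/existsP; exists u; apply/existsP; exists v; rewrite xu eqxx andbT; apply/eqP.
have lt_wm : (u.+1 < m)%N by have := ltn_ord v; lia.
pose w := Ordinal lt_wm.
have [_ _ _ /(_ (inl w) (in_setT _))] := x_pl (inl u) (in_setT _).
rewrite /inside xu /= => ins.
have {ins} : (minn u v < pos (x (inl w)) < maxn u v)%N by rewrite -ins; lia.
have := x_neq (inl w); case xw: (x (inl w)) => [t|t] neq_tw /= ins; last first.
  by have := ltn_ord v; lia.
have neq_tw' : t != u.+1 :> nat.
  by move: neq_tw; rewrite (inj_eq (@inl_inj _ _)) -val_eqE.
by apply: (IHk w t _ _ xw) => /=; lia.
Qed.

End Trichotomy.

Lemma flip_diagram m n (x : diagram m n) :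
  exists x' : diagram n m, x' =1 flip_fun x.
Proof.
have [d def_d _] := diag_of_planar (@flip_planar _ _ x)
  (fun p q => erefl : (flip_fun x p == q) = _).
by exists d.
Qed.

(** Without caps and cups the strands form a bijection from bottom to top, increasing by planarity.
    An increasing map satisfies i <= e i, and applying this to the bijection and to its inverse
    gives the identity. The third case speaks of indices in [nat] because m = n is only part of its
    conclusion. *)
Lemma trichotomy m n (x : diagram m n) :
  [\/ has_cap x,
      exists2 x' : diagram n m, x' =1 flip_fun x & has_cap x'
    | [/\ m = n, forall u w : nat, u = w -> forall (hu : (u < m)%N) (hw : (w < n)%N),
          x (inl (Ordinal hu)) = inr (Ordinal hw)
        & forall u w : nat, u = w -> forall (hu : (u < m)%N) (hw : (w < n)%N),
          x (inr (Ordinal hw)) = inl (Ordinal hu)]].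
Proof.
have x_pl := @diagram_planar _ _ x.
have [xK x_neq] : (forall p, x (x p) = p) /\ (forall p, x p != p).
  by split=> p; have [] := x_pl p (in_setT p).
have [cap|no_cap] := boolP (has_cap x); first by apply: Or31.
have [x' def_x'] := flip_diagram x.
have [cup|no_cup] := boolP (has_cap x'); first by apply: Or32; exists x'.
apply: Or33.
have up u : {w | x (inl u) = inr w}.
  case xu: (x (inl u)) => [v|w]; last by exists w.
  by rewrite (bottom_arc_cap xu) in no_cap.
have down w : {u | x (inr w) = inl u}.
  case xw: (x (inr w)) => [u|v]; first by exists u.
  have /bottom_arc_cap : x' (inl w) = inl v by rewrite def_x' /flip_fun /= xw.
  by rewrite (negPf no_cup).
pose g u := sval (up u); have gE u : x (inl u) = inr (g u) := svalP (up u).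
pose h w := sval (down w); have hE w : x (inr w) = inl (h w) := svalP (down w).
have gK : cancel g h.
  by move=> u; apply: (@inl_inj _ 'I_n); rewrite -hE -gE xK.
have hK : cancel h g.
  by move=> w; apply: (@inr_inj 'I_m); rewrite -gE -hE xK.
have g_mono (u u' : 'I_m) : (u < u')%N -> (g u < g u')%N.
  move=> lt_u; have [_ _ _ /(_ (inl u') (in_setT _))] := x_pl (inl u) (in_setT _).
  rewrite /inside !gE /=; have := ltn_ord u'; have := ltn_ord (g u); have := ltn_ord (g u').
  lia.
have h_mono (w w' : 'I_n) : (w < w')%N -> (h w < h w')%N.
  move=> lt_w; rewrite ltnNge leq_eqVlt; apply/negP => /orP[/eqP/val_inj eq_h|/g_mono].
    by have := lt_w; rewrite -[w]hK -[w']hK eq_h ltnn.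
  by rewrite !hK ltnNge ltnW.
have mono_ge k l (e : 'I_k -> 'I_l) : (forall i j : 'I_k, (i < j)%N -> (e i < e j)%N) ->
    forall i : 'I_k, (i <= e i)%N.
  move=> e_mono [i lt_i]; elim: i lt_i => [//|i IHi] lt_i /=.
  have lt_i' : (i < k)%N by lia.
  by apply: leq_ltn_trans (IHi lt_i') _; apply: e_mono => /=.
have gE_nat (u : 'I_m) : g u = u :> nat.
  apply/eqP; rewrite eqn_leq (mono_ge _ _ g g_mono) andbT.
  by have := mono_ge _ _ h h_mono (g u); rewrite gK.
have eq_mn : m = n.
  have := leq_card g (can_inj gK); have := leq_card h (can_inj hK).
  by rewrite !card_ord => ? ?; apply/eqP; rewrite eqn_leq; apply/andP.
split=> // u w eq_uw hu hw.
  by rewrite gE; congr inr; apply: val_inj; rewrite /= gE_nat.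
have -> : Ordinal hw = g (Ordinal hu) by apply: val_inj; rewrite /= gE_nat.
by rewrite hE gK.
Qed.

(** * Triangularity of the diagram matrices *)

Section Triangular.
Variables m n : nat.

(* [opener x p] holds if [p] comes first on its strand.  The matrix entry of [x]
   at the opener word of [y] vanishes unless [opener_sum x < opener_sum y] or
   [x = y]; this is the triangularity behind [Phi_eq0]. *)
Definition opener (x : diagram m n) (p : point m n) : bool := (pos p < pos (x p))%N.

Definition opener_sum (x : diagram m n) : nat := \sum_(p | opener x p) pos p.

Definition bottom_openers (x : diagram m n) : seq bool := [seq opener x (inl i) | i <- enum 'I_m].
Definition top_openers (x : diagram m n) : seq bool := [seq ~~ opener x (inr i) | i <- enum 'I_n].

Lemma size_bottom_openers x : size (bottom_openers x) = m.
Proof. by rewrite size_map size_enum_ord. Qed.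

Lemma size_top_openers x : size (top_openers x) = n.
Proof. by rewrite size_map size_enum_ord. Qed.

Lemma bent_openers x : bent (top_openers x) (bottom_openers x) =1 opener x.
Proof.
case=> i /=.
  by rewrite (nth_map i) ?size_enum_ord // nth_ord_enum.
by rewrite (nth_map i) ?size_enum_ord // nth_ord_enum negbK.
Qed.

(** As for bracket words, a closing point is matched with the last point still open. In [key], if
    [x'] closes at [p] an arc reaching further back than that of [y'], then the partner of [p] in
    [y'] is an opener which [x'] must close before [p], where the two diagrams already agree. *)
Lemma opener_inj (x y : diagram m n) : opener x =1 opener y -> x =1 y.
Proof.
have key (x' y' : diagram m n) p : opener x' =1 opener y' ->
    (forall q, (pos q < pos p)%N -> opener x' q = false -> x' q = y' q) ->
    opener x' p = false -> (pos (x' p) < pos (y' p))%N -> False.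
  move=> eq_op IH op lt_xy.
  have [_ xneq xK xnc] := @diagram_planar _ _ x' p (in_setT p).
  have [_ yneq yK ync] := @diagram_planar _ _ y' p (in_setT p).
  have yop : (pos (y' p) < pos p)%N.
    have := op; rewrite eq_op /opener; case: ltngtP => // /pos_inj eq_p.
    by rewrite -eq_p eqxx in yneq.
  have lt_xp : (pos (x' p) < pos p)%N by apply: ltn_trans yop.
  have [_ _ xK' _] := @diagram_planar _ _ x' (y' p) (in_setT _).
  have opq : opener x' (y' p) by rewrite eq_op /opener yK.
  have ins := xnc (y' p) (in_setT _); rewrite /inside in ins.
  have {ins} ins : (pos (x' (y' p)) < pos p)%N by move: ins; lia.
  have := IH (x' (y' p)) ins; rewrite {1}/opener xK'.
  have -> : (pos (x' (y' p)) < pos (y' p))%N = false.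
    by move: opq; rewrite /opener; lia.
  move=> /(_ erefl) eq_y; have [_ _ yK' _] := @diagram_planar _ _ y' (x' (y' p)) (in_setT _).
  have : p = x' (y' p) by rewrite -[RHS]yK' -eq_y yK.
  by move=> eq_p; rewrite -eq_p ltnn in ins.
move=> eq_op; have closer k p : (pos p < k)%N -> opener x p = false -> x p = y p.
  elim: k p => // k IHk p lt_pk op.
  have IH q : (pos q < pos p)%N -> opener x q = false -> x q = y q.
    by move=> lt_qp; apply: IHk; apply: leq_trans lt_qp _.
  case: (ltngtP (pos (x p)) (pos (y p))) => [lt|lt|/pos_inj //].
    by case: (key x y p).
  case: (key y x p) => // [q lt_q opq|]; last by rewrite -eq_op.
  by rewrite IH ?eq_op.
move=> p; have [_ _ xK _] := @diagram_planar _ _ x p (in_setT p).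
have [op|op] := boolP (opener x p); last by apply: (closer (pos p).+1) => //; apply: negbTE.
have eq_p : x (x p) = y (x p).
  by apply: (closer (pos (x p)).+1) => //; move: op; rewrite /opener xK; lia.
have [_ _ yK _] := @diagram_planar _ _ y (x p) (in_setT _).
by rewrite -[LHS]yK -eq_p xK.
Qed.

(** Such an [s] selects one end of every arc. Choosing the first end everywhere minimises the sum of
    positions, and any other choice strictly increases it. *)
Lemma opener_sum_le (x : diagram m n) (s : point m n -> bool) :
  (forall p, s (x p) = ~~ s p) ->
  (opener_sum x <= \sum_(p | s p) pos p)%N /\
  ((\sum_(p | s p) pos p <= opener_sum x)%N -> s =1 opener x).
Proof.
move=> s_x; have x_pl := @diagram_planar _ _ x.
have [xK x_neq] : (forall p, x (x p) = p) /\ (forall p, x p != p).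
  by split=> p; have [] := x_pl p (in_setT p).
have op_x p : opener x (x p) = ~~ opener x p.
  by rewrite /opener xK; case: ltngtP => // /pos_inj eq_p; have := x_neq p; rewrite eq_p eqxx.
have sumE : (\sum_(p | s p) pos p = \sum_(p | opener x p) if s p then pos p else pos (x p))%N.
  rewrite (bigID (opener x)) /= [X in (_ + X)%N](reindex x) /=; last first.
    by apply: onW_bij; exists x.
  rewrite [RHS](bigID s) /=; congr (_ + _)%N.
    by apply: eq_big => [p|p /andP[]]; [rewrite andbC | move=> ->].
  apply: eq_big => [p|p]; first by rewrite s_x op_x negbK andbC.
  by rewrite s_x => /andP[/negPf-> _].
have le_op p : opener x p -> (pos p <= if s p then pos p else pos (x p))%N.
  by rewrite /opener; case: ifP => // _ /ltnW.
rewrite sumE; split; first exact: leq_sum.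
move=> le_sum p.
have s_op q : opener x q -> s q.
  move=> op_q; apply: contraTT le_sum => /negPf sq; rewrite -ltnNge.
  rewrite /opener_sum (bigD1 q) //= [X in (_ < X)%N](bigD1 q) //= sq -addSn leq_add //.
  by apply: leq_sum => r /andP[/le_op].
apply/idP/idP => [sp|/s_op //]; apply: contraLR sp => op_p.
by rewrite -s_x s_op // op_x.
Qed.

Lemma dmat_openers (R : fieldType) (gamma : R) (x y : diagram m n) : gamma != 0 ->
  dmat gamma x (top_openers y) (bottom_openers y) != 0 ->
  (opener_sum x <= opener_sum y)%N /\ ((opener_sum y <= opener_sum x)%N -> x = y).
Proof.
move=> gamma_neq0; rewrite /dmat size_top_openers size_bottom_openers !eqxx /=.
rewrite mulf_eq0 negb_or glue_seq_neq0 //= weight_neq0 // => /forallP opp.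
have [] := @opener_sum_le x (opener y).
  by move=> p; rewrite -!bent_openers; apply/eqP.
move=> le1 le2; split=> // /le2 eq_op; apply/val_inj/ffunP => p.
exact/esym/opener_inj.
Qed.

Lemma dmat_openers_neq0 (R : fieldType) (gamma : R) (x : diagram m n) : gamma != 0 ->
  dmat gamma x (top_openers x) (bottom_openers x) != 0.
Proof.
move=> gamma_neq0; rewrite /dmat size_top_openers size_bottom_openers !eqxx /=.
rewrite mulf_neq0 ?glue_seq_neq0 // weight_neq0 //; apply/forallP => p.
have [_ x_neq xK _] := @diagram_planar _ _ x p (in_setT p).
rewrite !bent_openers /opener xK; case: ltngtP => // /pos_inj eq_p.
by rewrite eq_p eqxx in x_neq.
Qed.

End Triangular.

(** * The projector onto q-symmetric tensors *)

Section Projector.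
Variables (R : fieldType) (gamma : R).
Hypotheses (gamma_neq0 : gamma != 0) (real_R : formally_real R).

(* q-symmetric tensors of weight [k] are the multiples of [rho] restricted to the
   words with [k] minus signs. *)
Fixpoint rho (s : seq bool) : R :=
  if s is b :: s' then (if b then (- gamma^-1) ^+ count negb s' else 1) * rho s'
  else 1.

(** These are the equations saying that every cap between neighbours kills [x], its weights being 1
    on + - and gamma^-1 on - +. *)
Definition swap_symmetric (n : nat) (x : seq bool -> R) : Prop :=
  forall w w', (size w + (size w').+2)%N = n ->
    x (w ++ true :: false :: w') = - gamma^-1 * x (w ++ false :: true :: w').

Definition norm (n k : nat) : R :=
  \sum_(s <- states n | count negb s == k) rho s ^+ 2.

(** On the words with a given number of minus signs this is the orthogonal projector onto the line
    spanned by [rho]. *)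
Definition proj (n : nat) : mat R := fun u s =>
  if [&& size u == n, size s == n & count negb u == count negb s] then
    rho u * rho s / norm n (count negb s) else 0.

Lemma rho_neq0 s : rho s != 0.
Proof.
elim: s => [|b s IHs] /=; first exact: oner_neq0.
rewrite mulf_neq0 //; case: b; last exact: oner_neq0.
by rewrite expf_neq0 // oppr_eq0 invr_eq0.
Qed.

Lemma rho_swap w w' : rho (w ++ true :: false :: w') = - gamma^-1 * rho (w ++ false :: true :: w').
Proof.
elim: w => [|b w IHw] /=; first by rewrite add1n exprS !mul1r mulrA.
by rewrite IHw !count_cat /= mulrCA.
Qed.

Lemma norm_neq0 s : norm (size s) (count negb s) != 0.
Proof.
apply/eqP => norm0; have /eqP := rho_neq0 s; apply.
have := real_R (r := [seq t <- states (size s) | count negb t == count negb s]) (F := rho).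
rewrite big_filter => /(_ norm0 s); apply.
by rewrite mem_filter eqxx mem_states eqxx.
Qed.

Lemma supported_proj n : supported n n (proj n).
Proof.
by move=> u s; rewrite /proj; case: ifP => [/and3P[/eqP-> /eqP->]|_] //; rewrite eqxx.
Qed.

Lemma trm_proj n : trm (proj n) = proj n.
Proof.
apply: matP => u s; rewrite /trm /proj [count negb s == _]eq_sym andbCA.
by case: ifP => // /and3P[_ _ /eqP->]; rewrite [rho s * _]mulrC.
Qed.

Lemma proj_diag_neq0 n u : size u = n -> proj n u u != 0.
Proof.
move=> <-; rewrite /proj !eqxx /= mulf_neq0 ?mulf_neq0 ?rho_neq0 //.
by rewrite invr_neq0 // norm_neq0.
Qed.

Lemma proj_count n u s : proj n u s != 0 -> count negb u = count negb s.
Proof. by rewrite /proj; case: ifP => [/and3P[_ _ /eqP]|_] //; rewrite eqxx. Qed.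

Lemma proj_swap_symmetric n s : swap_symmetric n (fun u => proj n u s).
Proof.
move=> w w' size_n; rewrite /proj !size_cat !count_cat /= size_n eqxx /= add1n add0n.
by case: ifP => _; rewrite ?mulr0 // rho_swap -!mulrA.
Qed.

(** The quotient of [x] by [rho] is invariant under exchanges of adjacent letters, so it depends
    only on the number of minus signs. *)
Lemma swap_symmetric_eq n x : swap_symmetric n x ->
  forall u s, size u = n -> size s = n -> count negb u = count negb s ->
  x u * rho s = x s * rho u.
Proof.
move=> symx u s; pose y t := x t / rho t.
suff yE w u' s' : size (w ++ u') = n -> size u' = size s' ->
    count negb u' = count negb s' -> y (w ++ u') = y (w ++ s').
  move=> size_u size_s cnt; have := yE [::] u s size_u _ cnt.
  rewrite size_u size_s => /(_ erefl)/eqP; rewrite /y /= eqr_div ?rho_neq0 //.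
  by move/eqP.
have y_swap w0 w1 : (size w0 + (size w1).+2)%N = n ->
    y (w0 ++ true :: false :: w1) = y (w0 ++ false :: true :: w1).
  by move=> size_w; rewrite /y symx // rho_swap -mulf_div divff ?mul1r //
    oppr_eq0 invr_eq0.
have [k] : exists k, size u' = k by exists (size u').
elim: k w u' s' => [|k IHk] w [|a u'] [|b s'] // [size_u] size_n [size_us] /=.
have step c v t : size v = k -> size t = k -> count negb v = count negb t ->
    (size w + k.+1)%N = n -> y (w ++ c :: v) = y (w ++ c :: t).
  move=> size_v size_t cnt size_w; rewrite -!cat_rcons.
  by apply: IHk; rewrite // ?size_cat ?size_rcons ?size_v ?size_t // addSn -addnS.
have {size_n} size_w : (size w + k.+1)%N = n by move: size_n; rewrite size_cat /= size_u.
have mid v t : size v = k -> size t = k -> (count negb v).+1 = count negb t ->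
    y (w ++ false :: v) = y (w ++ true :: t).
  move=> size_v size_t cnt.
  pose c := count negb v; have le_c : (c <= k)%N by rewrite -size_v count_size.
  have le_c1 : (c.+1 <= k)%N by rewrite /c cnt -size_t count_size.
  (* Both tails are rearranged so that after [w] there stands a mixed pair followed by the same [m],
     which holds the other [c] minus signs; one exchange then relates the words. *)
  pose m := nseq (k - c.+1) true ++ nseq c false.
  have size_m : size m = k.-1 by rewrite size_cat !size_nseq; lia.
  have cnt_m : count negb m = c by rewrite count_cat !count_nseq /=; lia.
  rewrite (step false v (true :: m)) ?(step true t (false :: m)) //= ?size_m ?cnt_m //; try lia.
  by rewrite y_swap //= size_m; lia.
case: a; case: b => /= cnt.
- by apply: step; rewrite -?size_us //; lia.
- by apply/esym/mid; rewrite -?size_us //; lia.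
- by apply: mid; rewrite -?size_us //; lia.
- by apply: step; rewrite -?size_us //; lia.
Qed.

Lemma proj_fixes n x : swap_symmetric n x -> forall u, size u = n ->
  \sum_(s <- states n) proj n u s * x s = x u.
Proof.
move=> symx u size_u.
transitivity (\sum_(s <- states n | count negb s == count negb u)
    (x u / norm n (count negb u)) * rho s ^+ 2); last first.
  by rewrite -mulr_sumr -/(norm _ _) mulfVK // -size_u norm_neq0.
rewrite [RHS]big_mkcond big_seq [RHS]big_seq; apply: eq_bigr => s.
rewrite mem_states => /eqP size_s; rewrite /proj size_u size_s eqxx /= eq_sym.
case: eqP => [cnt|_]; last by rewrite mul0r.
rewrite cnt mulrAC [rho u * _ * _]mulrAC [rho u * x s]mulrC -(swap_symmetric_eq symx) //.
by ring.
Qed.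

Lemma mulm_proj_fixes n c M : supported n c M ->
  (forall s, swap_symmetric n (fun u => M u s)) -> mulm n (proj n) M = M.
Proof.
move=> suppM symM; apply: matP => u s.
have [size_u|size_u] := eqVneq (size u) n; first exact: proj_fixes.
rewrite (supported_eq0 suppM) ?size_u // /mulm big1 // => t _.
by rewrite (supported_eq0 (@supported_proj n)) ?size_u ?mul0r.
Qed.

Lemma proj_idem n : mulm n (proj n) (proj n) = proj n.
Proof. exact: mulm_proj_fixes (@supported_proj n) (@proj_swap_symmetric n). Qed.

(** Each number k = 0, ..., n of minus signs contributes norm n k / norm n k = 1; a word with [k]
    minus signs is exhibited to see that the denominator is non-zero. *)
Lemma mtrace_proj n : mtrace n (proj n) = n.+1%:R.
Proof.
rewrite /mtrace.
transitivity (\sum_(s <- states n) \sum_(k < n.+1 | k == count negb s :> nat)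
    (rho s ^+ 2 / norm n k)).
  rewrite big_seq [RHS]big_seq; apply: eq_bigr => s; rewrite mem_states => /eqP size_s.
  have lt_c : (count negb s < n.+1)%N by rewrite ltnS -size_s count_size.
  rewrite (big_pred1 (Ordinal lt_c)) => [|k]; last by rewrite /= -val_eqE.
  by rewrite /proj size_s !eqxx /= expr2.
rewrite (exchange_big_dep xpredT) //= -[in RHS](card_ord n.+1) -sum1_card natr_sum.
apply: eq_bigr => k _; rewrite -mulr_suml.
have -> : \sum_(s <- states n | k == count negb s :> nat) rho s ^+ 2 = norm n k.
  by apply: eq_bigl => s; rewrite eq_sym.
pose s := nseq (n - k) true ++ nseq k false.
have size_s : size s = n by rewrite size_cat !size_nseq subnK // -ltnS.
have cnt_s : count negb s = k by rewrite count_cat !count_nseq /= mul0n mul1n.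
by rewrite -cnt_s -{1 2}size_s divff // norm_neq0.
Qed.

(** Of the four pairs of signs under the cap only + - and - + survive, and swap symmetry makes them
    cancel. *)
Lemma mulm_cap_proj m n (d : diagram m n) (x : seq bool -> R) u : has_cap d ->
  swap_symmetric m x -> \sum_(s <- states m) dmat gamma d u s * x s = 0.
Proof.
case/existsP=> u0 /existsP[v0 /andP[/eqP v0E /eqP d_u0]] symx.
have lt_v := ltn_ord v0.
have m_eq : m = (u0 + (2 + (m - u0.+2)))%N by lia.
rewrite [states m](congr1 states m_eq) big_states_cat.
rewrite big_seq big1 // => w; rewrite mem_states => /eqP size_w.
rewrite big_states_cat !big_statesS big_seq1 /=.
have capE a b w' : dmat gamma d u (w ++ a :: b :: w') =
    capw gamma a b * dmat gamma d u (w ++ true :: false :: w').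
  by apply: (dmat_cap v0E d_u0).
rewrite -!big_split big_seq big1 //= => w'; rewrite mem_states => /eqP size_w'.
rewrite [dmat gamma d u (w ++ true :: true :: w')]capE.
rewrite [dmat gamma d u (w ++ false :: true :: w')]capE.
rewrite [dmat gamma d u (w ++ false :: false :: w')]capE.
rewrite symx; last by rewrite size_w size_w'; lia.
by rewrite /=; ring.
Qed.

(** The word of pluses is alone with its number of minus signs. Its diagonal entry, equal to 1,
    serves below to read off the scalar in a multiple of the projector. *)
Lemma proj_plus n u : proj n (nseq n true) u = (u == nseq n true)%:R.
Proof.
have [->|neq_u] := eqVneq u (nseq n true); last first.
  rewrite /proj; case: ifP => // /and3P[_ /eqP size_u].
  rewrite count_nseq mul0n eq_sym -leqn0 leqNgt -has_count => /hasPn no.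
  case/eqP: neq_u; rewrite -size_u; apply/all_pred1P/allP => b /no.
  by case: b.
have rho_plus k : rho (nseq k true) = 1.
  by elim: k => //= k ->; rewrite count_nseq mul0n expr0 mulr1.
rewrite /proj !size_nseq !eqxx /= !rho_plus count_nseq mul0n /norm mulr1.
rewrite big_mkcond (bigD1_seq (nseq n true)) ?states_uniq ?mem_states ?size_nseq //=.
rewrite count_nseq mul0n eqxx rho_plus.
rewrite big1_seq ?addr0 ?expr1n ?divr1 // => s; rewrite mem_states => /andP[neq_s /eqP size_s].
case: ifP => //; rewrite -leqn0 leqNgt -has_count => /hasPn no.
case/eqP: neq_s; rewrite -size_s; apply/all_pred1P/allP => b /no.
by case: b.
Qed.

End Projector.

(** * The representation of the Temperley-Lieb category *)

Section Phi.
Variables m n : nat.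
Implicit Types X Y : TL m n.

Definition Phi X : mat K := fun u s =>
  \sum_(d : diagram m n) (X d : K) * dmat gamma d u s.

Lemma supported_Phi X : supported n m (Phi X).
Proof.
move=> u s; have [/andP[/eqP-> /eqP->] //|] := boolP ((size u == n) && (size s == m)).
rewrite negb_and => us; rewrite /Phi big1 ?eqxx // => d _.
by rewrite (supported_eq0 (@supported_dmat m n K gamma d) us) mulr0.
Qed.

Lemma Phi_linear (k : K) X Y u s : Phi (k *: X + Y) u s = k * Phi X u s + Phi Y u s.
Proof.
rewrite /Phi mulr_sumr -big_split; apply: eq_bigr => d _.
have -> : ((k *: X + Y) d : K) = k * X d + Y d by rewrite !ffunE.
by rewrite mulrDl mulrA.
Qed.

Lemma Phi0 : Phi 0 = fun _ _ => 0.
Proof.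
apply: matP => u s; rewrite /Phi big1 // => d _.
by rewrite ffunE mul0r.
Qed.

Lemma PhiZ (k : K) X : Phi (k *: X) = scalem k (Phi X).
Proof. by apply: matP => u s; rewrite -[k *: X]addr0 Phi_linear Phi0 addr0. Qed.

Lemma PhiD X Y u s : Phi (X + Y) u s = Phi X u s + Phi Y u s.
Proof. by rewrite -[X]scale1r Phi_linear scale1r mul1r. Qed.

Lemma Phi_sum (I : Type) (r : seq I) (P : pred I) (F : I -> TL m n) u s :
  Phi (\sum_(i <- r | P i) F i) u s = \sum_(i <- r | P i) Phi (F i) u s.
Proof.
apply: (big_ind2 (fun X x => Phi X u s = x)) => [|X x Y y <- <-|//].
  by rewrite Phi0.
exact: PhiD.
Qed.

Lemma Phi_delta (F : diagram m n -> K) (d : diagram m n) X :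
  (forall d', X d' = (d' == d)%:R) -> Phi X = dmat gamma d.
Proof.
move=> XE; apply: matP => u s; rewrite /Phi (bigD1 d) //= XE eqxx mul1r.
rewrite big1 ?addr0 // => d' /negPf neq.
by rewrite XE neq mul0r.
Qed.

Lemma Phi_diag_of (f : point m n -> point m n) (r : rel (point m n)) :
  planar (@pos m n) setT f -> (forall p q, r p q = (f p == q)) ->
  Phi (diag_of r) = dmat gamma f.
Proof.
move=> planar_f rE; have [d df dE] := diag_of_planar planar_f rE.
by rewrite (Phi_delta (fun _ => 0) dE); apply: eq_dmat.
Qed.

Lemma Phi_eq0 X : Phi X = (fun _ _ => 0) -> X = 0.
Proof.
move=> PX0; apply/eqP/negPn/negP => X_neq0.
have [d0 Xd0] : exists d, X d != 0.
  apply/existsP; apply: contraR X_neq0 => /existsPn X0; apply/eqP/ffunP => d.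
  by rewrite ffunE; apply/eqP/negPn; apply: X0.
(* At the opener word of a diagram with minimal [opener_sum] in the support of [X], every other term
   vanishes by triangularity. *)
have [d Xd d_min] := @arg_minnP _ d0 (fun d => X d != 0) (@opener_sum m n) Xd0.
have := congr1 (fun M => M (top_openers d) (bottom_openers d)) PX0.
rewrite /Phi (bigD1 d) //= big1 ?addr0 => [|d' neq_d].
  move/eqP; rewrite mulf_eq0 (negPf Xd) (negPf (dmat_openers_neq0 d gamma_neq0)).
  by [].
have [Xd'0|Xd'] := eqVneq (X d') 0; first by rewrite Xd'0 mul0r.
have [->|neq0] := eqVneq (dmat gamma d' (top_openers d) (bottom_openers d)) 0.
  by rewrite mulr0.
have [_ eq_d] := dmat_openers gamma_neq0 neq0.
by rewrite (eq_d (d_min d' Xd')) eqxx in neq_d.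
Qed.

Lemma Phi_inj X Y : Phi X = Phi Y -> X = Y.
Proof.
move=> eqP_XY; apply/eqP; rewrite -subr_eq0; apply/eqP/Phi_eq0/matP => u s.
by rewrite addrC -scaleN1r Phi_linear eqP_XY mulN1r addNr.
Qed.

End Phi.

Arguments supported_Phi {m n} X u s _.

Lemma Phi_comp a b c (X : TL b c) (Y : TL a b) :
  Phi (X ∘ Y) = mulm b (Phi X) (Phi Y).
Proof.
apply: matP => u s; rewrite /comp Phi_sum.
transitivity (\sum_(x : diagram b c) \sum_(y : diagram a b)
    X x * Y y * mulm b (dmat gamma x) (dmat gamma y) u s).
  apply: eq_bigr => x _; rewrite Phi_sum; apply: eq_bigr => y _.
  rewrite PhiZ /scalem -mulrA; have [z [planar_z zE ->]] := mulm_dmat x y gamma_neq0.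
  by rewrite (Phi_diag_of planar_z zE) /scalem -deltaE !mulrA.
rewrite /mulm /Phi.
under [RHS]eq_bigr => t _ do rewrite mulr_suml.
rewrite [RHS]exchange_big; apply: eq_bigr => x _.
under [RHS]eq_bigr => t _ do rewrite mulr_sumr.
rewrite [RHS]exchange_big; apply: eq_bigr => y _.
by rewrite mulr_sumr; apply: eq_bigr => t _; rewrite mulrACA.
Qed.

Lemma Phi_tens m1 n1 m2 n2 (X : TL m1 n1) (Y : TL m2 n2) :
  Phi (X ⊗ Y) = tensm n1 m1 (Phi X) (Phi Y).
Proof.
apply: matP => u s; rewrite /tens Phi_sum /tensm /Phi mulr_suml.
apply: eq_bigr => x _; rewrite -/(Phi _ u s) Phi_sum mulr_sumr; apply: eq_bigr => y _.
rewrite PhiZ /scalem; have [z [planar_z zE dz]] := dmat_juxt x y.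
by rewrite (Phi_diag_of planar_z zE) dz /tensm mulrACA.
Qed.

Lemma Phi_star m n (X : TL m n) :
  Phi (star X) = scalem (flip_scale m n gamma) (trm (Phi X)).
Proof.
apply: matP => u s; rewrite /star Phi_sum /scalem /trm /Phi mulr_sumr.
apply: eq_bigr => x _; rewrite -/(Phi _ u s) PhiZ /scalem mulrCA; congr (_ * _).
have rE (p q : point n m) : (x (point_flip p) == point_flip q) = (flip_fun x p == q).
  by rewrite /flip_fun -(inj_eq (can_inj (@point_flipK m n))) point_flipK.
rewrite (Phi_diag_of (@flip_planar _ _ x) rE).
by rewrite (dmat_flip x gamma_neq0).
Qed.

Lemma flip_scale_neq0 m n : flip_scale m n gamma != 0.
Proof. by rewrite mulf_neq0 ?invr_neq0 ?expf_neq0 ?gamma_neq0. Qed.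

Lemma Phi_id n : Phi (id_tl n) = idm n.
Proof.
have [f planar_f fE] := id_planar n; rewrite (Phi_diag_of planar_f fE).
apply: dmat_id gamma_neq0 _ _ => u; apply/eqP; rewrite -fE; exact: eqxx.
Qed.

Lemma Phi_conform m n m' n' (X : TL m n) : m = m' -> n = n' -> Phi (conform m' n' X) = Phi X.
Proof.
move=> eq_m eq_n; subst m' n'; rewrite /conform.
case: eqP => // em; case: eqP => // en.
by rewrite (eq_irrelevance em erefl) (eq_irrelevance en erefl).
Qed.

Lemma cupcap_diagram n j : (j.+1 < n)%N ->
  exists d : diagram n n, [/\ Phi (cupcap n j) = dmat gamma d, has_cap d,
    trm (dmat gamma d) = dmat gamma d,
    forall (u0 v0 : 'I_n), u0 = j :> nat -> v0 = j.+1 :> nat ->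
      d (inl u0) = inl v0 /\ d (inr u0) = inr v0
    & forall u0 v0 : 'I_n, u0 = v0 :> nat -> u0 != j :> nat -> u0 != j.+1 :> nat ->
      d (inl u0) = inr v0].
Proof.
move=> lt_j; have [f planar_f fE] := cupcap_planar lt_j.
have [d df dE] := diag_of_planar planar_f fE.
have d_cap (u0 v0 : 'I_n) : u0 = j :> nat -> v0 = j.+1 :> nat ->
    d (inl u0) = inl v0 /\ d (inr u0) = inr v0.
  by move=> eu ev; split; rewrite df; apply/eqP; rewrite -fE /= /hook eu ev !eqxx.
exists d; split=> //.
- exact: Phi_delta (fun _ => 0) _ _ dE.
- have lt_j' : (j < n)%N by lia.
  apply/existsP; exists (Ordinal lt_j'); apply/existsP; exists (Ordinal lt_j).
  by rewrite (d_cap (Ordinal lt_j') (Ordinal lt_j) erefl erefl).1 !eqxx.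
(* The diagram is its own reflection and [flip_scale n n] is 1, so reflection invariance becomes
   symmetry of the matrix. *)
- have d_flip : dmat gamma d = dmat gamma (flip_fun d).
    apply: eq_dmat => p; rewrite /flip_fun !df; apply/eqP; rewrite -fE.
    have := erefl (f (point_flip p)); move/eqP; rewrite -fE.
    case: p => i; case: (f _) => k //=; lia.
  by rewrite [RHS]d_flip (dmat_flip d gamma_neq0) /flip_scale subnn expr0 divr1 scale1m.
- by move=> u0 v0 e1 e2 e3; rewrite df; apply/eqP; rewrite -fE /= -e1 eqxx e2 e3.
Qed.

(** * Jones-Wenzl idempotents *)

Lemma formally_real_K : formally_real K.
Proof. exact: sum_sqr_eq0. Qed.

Section Generic.
Variables (R : fieldType) (gamma : R).
Hypotheses (gamma_neq0 : gamma != 0) (real_R : formally_real R).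

Lemma sum_sqr2_eq0 (I J : eqType) (r : seq I) (r' : seq J) (F : I -> J -> R) :
  \sum_(i <- r) \sum_(j <- r') F i j ^+ 2 = 0 ->
  forall i j, i \in r -> j \in r' -> F i j = 0.
Proof.
move=> sum0 i j i_r j_r'.
have := real_R (r := [seq (i, j) | i <- r, j <- r']) (F := fun ij => F ij.1 ij.2).
rewrite big_allpairs_dep /= => /(_ sum0 (i, j)); apply.
exact: allpairs_f.
Qed.

Lemma mulm0 n (M : mat R) : mulm n M (fun _ _ => 0) = fun _ _ => 0.
Proof. by apply: matP => u s; rewrite /mulm big1 // => t _; rewrite mulr0. Qed.

Lemma mul0m n (M : mat R) : mulm n (fun _ _ => 0) M = fun _ _ => 0.
Proof. by apply: matP => u s; rewrite /mulm big1 // => t _; rewrite mul0r. Qed.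

Lemma mulm_suml (I : Type) (r : seq I) n (M : I -> mat R) (N : mat R) :
  mulm n (fun u s => \sum_(i <- r) M i u s) N = fun u s => \sum_(i <- r) mulm n (M i) N u s.
Proof.
apply: matP => u s; rewrite /mulm exchange_big; apply: eq_bigr => t _.
by rewrite mulr_suml.
Qed.

Lemma mulm_sumr (I : Type) (r : seq I) n (M : mat R) (N : I -> mat R) :
  mulm n M (fun u s => \sum_(i <- r) N i u s) = fun u s => \sum_(i <- r) mulm n M (N i) u s.
Proof.
apply: matP => u s; rewrite /mulm exchange_big; apply: eq_bigr => t _.
by rewrite mulr_sumr.
Qed.

Lemma cap_proj m n (d : diagram m n) : has_cap d ->
  mulm m (dmat gamma d) (proj gamma m) = fun _ _ => 0.
Proof.
move=> cap; apply: matP => u s; rewrite /mulm.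
exact: (mulm_cap_proj gamma_neq0 u cap (@proj_swap_symmetric _ _ _ s)).
Qed.

Lemma proj_diagram m n (d : diagram m n) :
  exists c, mulm n (proj gamma n) (mulm m (dmat gamma d) (proj gamma m)) = scalem c (proj gamma n)
    /\ (m != n -> c = 0).
Proof.
have scale0 (M : mat R) : (fun _ _ => 0) = scalem 0 M.
  by apply: matP => u s; rewrite /scalem mul0r.
case: (trichotomy d) => [cap|[d' def_d' cap]|[eq_mn up down]].
- by exists 0; split=> //; rewrite (cap_proj cap) mulm0 -scale0.
- exists 0; split=> //; rewrite mulmA.
  have -> : mulm n (proj gamma n) (dmat gamma d) = fun _ _ => 0.
    have := cap_proj cap; rewrite (eq_dmat gamma def_d') (dmat_flip d gamma_neq0).
    rewrite mul_scalem => /(congr1 (fun M => scalem (flip_scale m n gamma)^-1 M)).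
    rewrite scalemA mulVf; last by rewrite mulf_neq0 ?invr_neq0 ?expf_neq0.
    rewrite scale1m => /(congr1 (@trm R)); rewrite trm_mul trmK trm_proj => ->.
    by apply: matP => u s; rewrite /trm /scalem mulr0.
  by rewrite mul0m -scale0.
move: d up down; rewrite -eq_mn => d up down; exists 1; rewrite eqxx; split=> //.
rewrite scale1m (dmat_id gamma_neq0); first by rewrite (mul1m (@supported_proj _ _ m)) proj_idem.
- by case=> u lt_u; apply: up.
- by case=> u lt_u; apply: down.
Qed.

(** The row of e_j at a word with + - in the relevant place has only two non-zero entries, at + -
    and - +, with ratio gamma^-1. Its vanishing on [x] is thus one equation of [swap_symmetric]. *)
Lemma cupcap_swap n (d : diagram n n) (u0 v0 : 'I_n) (x : seq bool -> R) w w' :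
  v0 = u0.+1 :> nat -> d (inl u0) = inl v0 -> d (inr u0) = inr v0 ->
  (forall i, i != u0 -> i != v0 -> d (inl i) = inr i) ->
  size w = u0 -> (size w + (size w').+2)%N = n ->
  \sum_(t <- states n) dmat gamma d (w ++ true :: false :: w') t * x t = 0 ->
  x (w ++ true :: false :: w') = - gamma^-1 * x (w ++ false :: true :: w').
Proof.
move=> v0E d_u0 d_u0' d_thr size_w size_n.
have [dK d_neq] : (forall p, d (d p) = p) /\ (forall p, d p != p).
  by split=> p; have [] := @diagram_planar _ _ d p (in_setT p).
pose t0 a b := w ++ a :: b :: w'; rewrite -/(t0 true false) -/(t0 false true).
have size_t0 a b : size (t0 a b) = n by rewrite size_cat.
have nth0 a b : nth false (t0 a b) u0 = a by rewrite nth_cat size_w ltnn subnn.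
have nth1 a b : nth false (t0 a b) v0 = b.
  by rewrite nth_cat size_w v0E ltnNge leqnSn /= subSnn.
have nth2 a b c e (i : nat) : i != u0 -> i != v0 -> nth false (t0 a b) i = nth false (t0 c e) i.
  rewrite v0E => iu iv; rewrite !nth_cat size_w; case: ltnP => // le_i.
  by have -> : (i - u0 = (i - u0.+2).+2)%N by lia.
have t0_inj : t0 false true != t0 true false.
  by apply/eqP => /(congr1 (fun t => nth false t u0)); rewrite !nth0.
rewrite (bigD1_seq (t0 true false)) ?states_uniq ?mem_states ?size_t0 //=.
rewrite -big_filter (bigD1_seq (t0 false true)) ?filter_uniq ?states_uniq //=; last first.
  by rewrite mem_filter t0_inj mem_states size_t0 eqxx.
rewrite big_filter_cond big1_seq ?addr0 => [|t /andP[/andP[neq_t1 neq_t2]]]; last first.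
  rewrite mem_states => /eqP size_t.
  have [->|] := eqVneq (dmat gamma d (t0 true false) t) 0; first by rewrite mul0r.
  rewrite /dmat size_t0 size_t !eqxx mulf_eq0 negb_or => /andP[_].
  rewrite weight_neq0 // => /forallP opp.
  have thr (i : 'I_n) : i != u0 -> i != v0 -> nth false t i = nth false (t0 true false) i.
    move=> iu iv; have := opp (inl i); rewrite d_thr //= => /eqP/negb_inj ->.
    by [].
  have capped : nth false t v0 = ~~ nth false t u0.
    by have := opp (inl u0); rewrite d_u0 => /eqP.
  have tE : t = t0 (nth false t u0) (nth false t v0).
    apply: (@eq_from_nth _ false) => [|i]; first by rewrite size_t0.
    rewrite size_t => lt_i; have [->|iu] := eqVneq i u0; first by rewrite nth0.
    have [->|iv] := eqVneq i v0; first by rewrite nth1.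
    by rewrite (thr (Ordinal lt_i)) //=; apply: nth2.
  move: neq_t1 neq_t2; rewrite tE capped.
  by case: (nth false t u0); rewrite /= eqxx.
rewrite [dmat gamma d _ (t0 false true)](dmat_cap v0E d_u0 gamma_neq0) //=.
rewrite -/(t0 true false) [gamma^-1 * _]mulrC -mulrA -mulrDr => /eqP.
rewrite mulf_eq0 addr_eq0 mulNr; case: eqP => [D0|_ /eqP //].
have : dmat gamma d (t0 true false) (t0 true false) != 0.
  rewrite /dmat size_t0 !eqxx /= mulf_neq0 ?glue_seq_neq0 // weight_neq0 //.
  have thr_inr i : i != u0 -> i != v0 -> d (inr i) = inl i.
    by move=> iu iv; rewrite -d_thr // dK.
  have d_v0 : d (inl v0) = inl u0 by rewrite -d_u0 dK.
  have d_v0' : d (inr v0) = inr u0 by rewrite -d_u0' dK.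
  apply/forallP => -[i|i].
    have [->|iu] := eqVneq i u0; first by rewrite d_u0 /= nth0 nth1.
    have [->|iv] := eqVneq i v0; first by rewrite d_v0 /= nth0 nth1.
    by rewrite d_thr.
  have [->|iu] := eqVneq i u0; first by rewrite d_u0' /= nth0 nth1.
  have [->|iv] := eqVneq i v0; first by rewrite d_v0' /= nth0 nth1.
  by rewrite thr_inr //= negbK.
by rewrite D0 eqxx.
Qed.

(** The hypothesis makes the kernel and the image meet in 0, and rank-nullity makes their sum the
    whole space. *)
Lemma ker_im_decomposition (V : vectType R) (phi : 'End(V)) :
  (forall v, phi (phi v) = 0 -> phi v = 0) ->
  forall w, exists u v, phi u = 0 /\ w = u + phi v.
Proof.
move=> ker_phi w.
have disj : (lker phi :&: limg phi = 0)%VS.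
  apply/eqP; rewrite -subv0; apply/subvP => v; rewrite memv_cap memv_ker.
  case/andP=> /eqP phi_v /memv_imgP[u _ def_v]; rewrite memv0; apply/eqP.
  by rewrite def_v ker_phi // -def_v.
have full : (lker phi + limg phi == fullv)%VS.
  rewrite eqEdim subvf /= dimv_disjoint_sum //.
  by rewrite -(limg_ker_dim phi fullv) capfv.
have : w \in (lker phi + limg phi)%VS by rewrite (eqP full) memvf.
case/memv_addP=> u ker_u [_ /memv_imgP[v _ ->] ->].
by exists u, v; split=> //; apply/eqP; rewrite -memv_ker.
Qed.

End Generic.

(* Its matrix is the sum of the E_j^T E_j, so by formal reality its kernel is the
   common kernel of the E_j. *)
Definition cap_energy n : TL n n :=
  \sum_(j < n.-1) (cupcap n j ∘ cupcap n j).

Lemma cupcap_dmat n (j : 'I_n.-1) :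
  exists2 d : diagram n n, Phi (cupcap n j) = dmat gamma d /\ trm (dmat gamma d) = dmat gamma d
  & has_cap d.
Proof.
have lt_j : (j.+1 < n)%N by have := ltn_ord j; lia.
by have [d [? ? ? _ _]] := cupcap_diagram lt_j; exists d.
Qed.

Lemma trm_cupcap n (j : 'I_n.-1) : trm (Phi (cupcap n j)) = Phi (cupcap n j).
Proof. by have [d [-> ->] _] := cupcap_dmat j. Qed.

Lemma cupcap_proj n (j : 'I_n.-1) :
  mulm n (Phi (cupcap n j)) (proj gamma n) = fun _ _ => 0.
Proof. by have [d [-> _] cap] := cupcap_dmat j; apply: cap_proj gamma_neq0 _ _ _ cap. Qed.

Lemma proj_cupcap n (j : 'I_n.-1) :
  mulm n (proj gamma n) (Phi (cupcap n j)) = fun _ _ => 0.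
Proof.
by rewrite -[LHS]trmK trm_mul trm_proj trm_cupcap cupcap_proj.
Qed.

Lemma cupcap_kernel n c (M : mat K) : supported n c M ->
  (forall j : 'I_n.-1, mulm n (Phi (cupcap n j)) M = fun _ _ => 0) ->
  mulm n (proj gamma n) M = M.
Proof.
move=> suppM ker_M; apply: (mulm_proj_fixes gamma_neq0 formally_real_K suppM) => s w w' size_n.
have lt_j : (size w < n.-1)%N by lia.
have lt_v : ((size w).+1 < n)%N by lia.
have lt_u : (size w < n)%N by lia.
have [d [d_E _ _ d_cap d_thr]] := cupcap_diagram lt_v.
have [d_u d_u'] := d_cap (Ordinal lt_u) (Ordinal lt_v) erefl erefl.
apply: (@cupcap_swap _ _ gamma_neq0 n d (Ordinal lt_u) (Ordinal lt_v)
  (fun u => M u s)) => // [i iu iv|].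
  by apply: d_thr => //; rewrite -val_eqE in iu iv.
have := congr1 (fun N => N (w ++ true :: false :: w') s) (ker_M (Ordinal lt_j)).
by rewrite /mulm d_E.
Qed.

Lemma Phi_cap_energy n :
  Phi (cap_energy n) =
  fun u s => \sum_(j < n.-1) mulm n (Phi (cupcap n j)) (Phi (cupcap n j)) u s.
Proof.
apply: matP => u s; rewrite Phi_sum; apply: eq_bigr => j _.
by rewrite Phi_comp.
Qed.

Lemma trm_cap_energy n : trm (Phi (cap_energy n)) = Phi (cap_energy n).
Proof.
rewrite Phi_cap_energy; apply: matP => u s; rewrite /trm; apply: eq_bigr => j _.
by rewrite -[LHS]/(trm _ u s) trm_mul trm_cupcap.
Qed.

Lemma cap_energy_kernel n c (M : mat K) : supported n c M ->
  mulm n (Phi (cap_energy n)) M = (fun _ _ => 0) -> mulm n (proj gamma n) M = M.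
Proof.
move=> suppM HM0; apply: (cupcap_kernel suppM) => j; apply: matP => t s.
have suppE k : supported n n (Phi (cupcap n k)) by apply: supported_Phi.
have [size_t|size_t] := eqVneq (size t) n; last first.
  by rewrite (supported_eq0 (supported_mul (suppE j) suppM)) // size_t.
apply: (@sum_sqr2_eq0 K formally_real_K _ _ (enum 'I_n.-1) (states n)
  (fun k t' => mulm n (Phi (cupcap n k)) M t' s)); rewrite ?mem_enum ?mem_states ?size_t //.
(* With H the matrix of [cap_energy] and E_k that of [cupcap n k], the diagonal entry of M^T H M at
   [s] is the sum over k of the squares in column [s] of E_k M. *)
have := congr1 (fun N => mulm n (trm M) N s s) HM0; rewrite mulm0.
apply: etrans; rewrite Phi_cap_energy mulm_suml mulm_sumr big_enum; apply: eq_bigr => k _.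
set E := Phi (cupcap n k).
transitivity (mulm n (trm (mulm n E M)) (mulm n E M) s s).
  by apply: eq_bigr => t' _; rewrite expr2.
by rewrite trm_mul trm_cupcap -!mulmA.
Qed.

(** Left multiplication by the cap energy H satisfies the hypothesis of [ker_im_decomposition], H
    being symmetric, so the identity is f + H g with H f = 0. Multiplying by the projector P, and
    using P H = 0 and P f = f, gives P = f. *)
Lemma proj_in_TL n : exists f : TL n n, Phi f = proj gamma n.
Proof.
pose h (X : TL n n) := cap_energy n ∘ X.
have h_lin : linear h by move=> k X Y; rewrite /h comp_linearr.
pose hB := GRing.isLinear.Build _ _ _ _ h h_lin.
pose hL : {linear _ -> _} := HB.pack h hB.
have hE X : linfun hL X = cap_energy n ∘ X by rewrite lfunE.
have Hsupp : supported n n (Phi (cap_energy n)) by apply: supported_Phi.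
have [X|f [g [f_ker id_fg]]] := @ker_im_decomposition _ _ (linfun hL) _ (id_tl n).
  rewrite !hE => /(congr1 (@Phi n n)); rewrite !Phi_comp Phi0 => HHX.
  apply: Phi_eq0; rewrite Phi_comp.
  apply: (mulm_sqr_eq0 formally_real_K (supported_mul Hsupp (supported_Phi X))).
  by rewrite trm_mul trm_cap_energy -mulmA HHX mulm0.
exists f; rewrite -(@cap_energy_kernel n n (Phi f)); last 2 first.
- exact: supported_Phi.
- by rewrite -Phi_comp -hE f_ker Phi0.
have PH : mulm n (proj gamma n) (Phi (cap_energy n)) = fun _ _ => 0.
  rewrite Phi_cap_energy mulm_sumr; apply: matP => u s; rewrite big1 // => j _.
  by rewrite mulmA proj_cupcap mul0m.
have := congr1 (fun X => mulm n (proj gamma n) (Phi X)) id_fg.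
rewrite Phi_id (mulm1 (@supported_proj _ _ n)) hE => projE; rewrite [RHS]projE.
apply: matP => u s; rewrite /mulm.
under [RHS]eq_bigr => t _ do rewrite PhiD mulrDr.
rewrite big_split /= Phi_comp -[X in _ = _ + X]/(mulm n _ (mulm n _ _) u s).
by rewrite mulmA PH mul0m addr0.
Qed.

Lemma proj_TL_proj m n (X : TL m n) :
  exists c, mulm n (proj gamma n) (mulm m (Phi X) (proj gamma m)) = scalem c (proj gamma n)
    /\ (m != n -> c = 0).
Proof.
have /choice[c cP] : forall d : diagram m n, exists c : K,
    mulm n (proj gamma n) (mulm m (dmat gamma d) (proj gamma m)) = scalem c (proj gamma n)
    /\ (m != n -> c = 0).
  by move=> d; exact: (proj_diagram gamma_neq0 formally_real_K d).
exists (\sum_d (X d : K) * c d); split=> [|neq_mn]; last first.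
  by rewrite big1 // => d _; rewrite (cP d).2 ?mulr0.
have PhiE : Phi X = fun u s => \sum_(d : diagram m n) scalem (X d : K) (dmat gamma d) u s by [].
rewrite PhiE mulm_suml mulm_sumr; apply: matP => u s; rewrite /scalem mulr_suml.
apply: eq_bigr => d _; rewrite mul_scalem mulm_scale (cP d).1.
by rewrite /scalem mulrA.
Qed.

Lemma proj_neq0 n : proj gamma n <> fun _ _ => 0.
Proof.
move/(congr1 (fun M : mat K => M (nseq n true) (nseq n true))) => /eqP; apply/negP.
by rewrite proj_diag_neq0 ?size_nseq //; [exact: gamma_neq0 | exact: formally_real_K].
Qed.

(** Existence is shown first, so that the choice made by [jw] is a genuine Jones-Wenzl idempotent.
    Any such g satisfies P g = g = g P, hence is a multiple c P, and idempotence forces c = 1. *)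
Lemma Phi_jw n : Phi (jw n) = proj gamma n.
Proof.
have jw_P : is_jones_wenzl (jw n).
  have [f Phi_f] := proj_in_TL n; apply: (@classical_sets.xgetPex _ 0); exists f; split.
  - by apply/eqP => f0; apply: (@proj_neq0 n); rewrite -Phi_f f0 Phi0.
  - by apply: Phi_inj; rewrite Phi_comp Phi_f proj_idem //;
      [exact: gamma_neq0 | exact: formally_real_K].
  move=> j lt_j; have lt_j' : (j < n.-1)%N by lia.
  split; apply: Phi_eq0; rewrite Phi_comp Phi_f.
    exact: (cupcap_proj (Ordinal lt_j')).
  exact: (proj_cupcap (Ordinal lt_j')).
move: (jw n) jw_P => g [g_neq0 g_idem g_ker].
have suppG := supported_Phi g.
have PG : mulm n (proj gamma n) (Phi g) = Phi g.
  apply: (cupcap_kernel suppG) => j; have lt_j : (j.+1 < n)%N by have := ltn_ord j; lia.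
  by rewrite -Phi_comp (g_ker j lt_j).1 Phi0.
have GP : mulm n (Phi g) (proj gamma n) = Phi g.
  rewrite -[LHS]trmK trm_mul trm_proj.
  rewrite (cupcap_kernel (supported_tr suppG)) ?trmK // => j.
  have lt_j : (j.+1 < n)%N by have := ltn_ord j; lia.
  by rewrite -trm_cupcap -trm_mul -Phi_comp (g_ker j lt_j).2 Phi0.
have [c [cE _]] := proj_TL_proj g; rewrite GP PG in cE.
have c_neq0 : c != 0.
  apply: contra_neq g_neq0 => c0; apply: Phi_eq0; rewrite cE c0.
  by apply: matP => u s; rewrite /scalem mul0r.
have := congr1 (@Phi n n) g_idem; rewrite Phi_comp cE mul_scalem mulm_scale.
rewrite proj_idem; [| exact: gamma_neq0 | exact: formally_real_K].
move/(congr1 (fun M : mat K => M (nseq n true) (nseq n true))); rewrite /scalem.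
have P_neq0 : proj gamma n (nseq n true) (nseq n true) != 0.
  by apply: proj_diag_neq0; [exact: gamma_neq0 | exact: formally_real_K | exact: size_nseq].
move/(mulfI c_neq0); rewrite -[RHS]mul1r => /(mulIf P_neq0) ->.
by apply: matP => u s; rewrite mul1r.
Qed.

(** * Trivalent vertices *)

Lemma projK_idem n : mulm n (proj gamma n) (proj gamma n) = proj gamma n.
Proof. exact: (proj_idem gamma_neq0 formally_real_K n). Qed.

Lemma projK_supported n : supported n n (proj gamma n).
Proof. exact: supported_proj. Qed.

(** Keeps transposes within the image of [Phi], so that [proj_TL_proj] applies to products involving
    them. *)
Lemma trm_Phi m n (X : TL m n) : exists Y : TL n m, trm (Phi X) = Phi Y.
Proof.
exists ((flip_scale m n gamma)^-1 *: star X).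
by rewrite PhiZ Phi_star scalemA mulVf ?scale1m // flip_scale_neq0.
Qed.

Definition pairproj (x y : nat) : mat K := tensm x x (proj gamma x) (proj gamma y).

Lemma supported_pairproj x y : supported (x + y) (x + y) (pairproj x y).
Proof. exact: (supported_tens (@projK_supported x) (@projK_supported y)). Qed.

Lemma trm_pairproj x y : trm (pairproj x y) = pairproj x y.
Proof. by rewrite /pairproj trm_tens !trm_proj. Qed.

Lemma pairproj_idem x y : mulm (x + y) (pairproj x y) (pairproj x y) = pairproj x y.
Proof. by rewrite /pairproj tensm_mul !projK_idem. Qed.

Lemma mtrace_pairproj x y : mtrace (x + y) (pairproj x y) = (x.+1 * y.+1)%:R.
Proof.
rewrite /pairproj mtrace_tens natrM.
by congr (_ * _); exact: (mtrace_proj gamma_neq0 formally_real_K).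
Qed.

Lemma Phi_pairproj x y : Phi (jw x ⊗ jw y) = pairproj x y.
Proof. by rewrite Phi_tens !Phi_jw. Qed.

Definition vmat (x y z : nat) : mat K :=
  mulm z (proj gamma z) (mulm (x + y) (Phi (vertex_diagram x y z)) (pairproj x y)).

Lemma Phi_vertex x y z : Phi (vertex x y z) = vmat x y z.
Proof. by rewrite /vertex !Phi_comp Phi_jw Phi_pairproj /vmat mulmA. Qed.

Lemma supported_vmat x y z : supported z (x + y) (vmat x y z).
Proof. by rewrite -Phi_vertex; exact: supported_Phi. Qed.

Lemma proj_vmat x y z : mulm z (proj gamma z) (vmat x y z) = vmat x y z.
Proof. by rewrite /vmat mulmA projK_idem. Qed.

Lemma vmat_pairproj x y z : mulm (x + y) (vmat x y z) (pairproj x y) = vmat x y z.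
Proof. by rewrite /vmat -!mulmA pairproj_idem. Qed.

(** The scalar in V V^T = theta P_z, read off at the entry where P_z is 1. *)
Definition theta (x y z : nat) : K :=
  mulm (x + y) (vmat x y z) (trm (vmat x y z)) (nseq z true) (nseq z true).

Lemma proj_plus_plus z : proj gamma z (nseq z true) (nseq z true) = 1.
Proof. by rewrite proj_plus eqxx. Qed.

Lemma vmat_orthogonal x y z z' :
  mulm (x + y) (vmat x y z) (trm (vmat x y z')) =
  scalem (if z == z' then theta x y z else 0) (proj gamma z).
Proof.
have [Y YE] := trm_Phi (vertex x y z').
have VV : mulm (x + y) (vmat x y z) (trm (vmat x y z')) =
    mulm z (proj gamma z) (mulm z' (Phi (vertex x y z ∘ Y)) (proj gamma z')).
  rewrite Phi_comp -YE !Phi_vertex -mulmA -(trm_proj gamma z') -trm_mul.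
  by rewrite proj_vmat mulmA proj_vmat.
have [c [cE c0]] := proj_TL_proj (vertex x y z ∘ Y).
rewrite VV cE; congr scalem; have [eq_z|neq_z] := eqVneq z z'; last first.
  by rewrite c0 // eq_sym.
by subst z'; rewrite /theta VV cE /scalem proj_plus_plus mulr1.
Qed.

(** Put pluses on the top and on the last [y] bottom points. The arcs then force a minus at their
    [p] left ends, and the prescribed number of minus signs leaves only pluses elsewhere. *)
Lemma vertex_diagram_entry x y z : admissible x y z ->
  let p := ((x + y - z)./2)%N in
  [/\ (p <= x)%N,
     Phi (vertex_diagram x y z) (nseq z true)
       (nseq (x - p) true ++ nseq p false ++ nseq y true) != 0
   & forall s, Phi (vertex_diagram x y z) (nseq z true) (s ++ nseq y true) != 0 ->
       size s = x -> count negb s = p -> s = nseq (x - p) true ++ nseq p false].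
Proof.
move=> adm p; have [f planar_f fE] := vertex_planar adm; rewrite -/p in fE.
have [d df dE] := diag_of_planar planar_f fE.
have PhiE : Phi (vertex_diagram x y z) = dmat gamma d by exact: Phi_delta (fun _ => 0) _ _ dE.
have eq_p : (2 * p + z = x + y)%N.
  case/and4P: adm => even_xyz le_x le_y le_z.
  have := odd_double_half (x + y - z); rewrite -/p.
  have -> : odd (x + y - z) = false by rewrite oddB //; move: even_xyz; rewrite !oddD; lia.
  by rewrite -mul2n; lia.
have [le_px le_py] : (p <= x)%N /\ (p <= y)%N by case/and4P: adm => _ *; lia.
have nth_plus k j : nth false (nseq k true) j = (j < k)%N by rewrite nth_nseq; case: ltnP.
split=> //.
  rewrite PhiE (dmat_neq0 _ _ _ gamma_neq0) !size_cat !size_nseq eqxx /=.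
  have -> : ((x - p + (p + y))%N == (x + y)%N) by apply/eqP; lia.
  apply/forallP => q; have := eqxx (d q); rewrite {1}df -fE.
  have nthE j : nth false (nseq (x - p) true ++ nseq p false ++ nseq y true) j =
      (j < x - p)%N || (x <= j < x + y)%N.
    rewrite !nth_cat !size_nseq !nth_plus nth_nseq.
    by case: ltnP => //=; case: ltnP => /=; rewrite ?if_same; lia.
  case: q => i; case: (d _) => j //=; rewrite ?nthE ?nth_plus;
    have := ltn_ord i; have := ltn_ord j; lia.
move=> s; rewrite PhiE (dmat_neq0 _ _ _ gamma_neq0) => /and3P[_ _ /forallP opp] size_s cnt_s.
have tailE : drop (x - p) s = nseq p false.
  apply: (@eq_from_nth _ true) => [|j]; first by rewrite size_drop size_nseq; lia.
  rewrite size_drop => lt_j; rewrite nth_nseq nth_drop; case: ltnP => [lt_jp|]; last by lia.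
  have lt_u : (x - p + j < x + y)%N by lia.
  have lt_v : (x + p - j.+1 < x + y)%N by lia.
  have := opp (inl (Ordinal lt_u)); have -> : d (inl (Ordinal lt_u)) = inl (Ordinal lt_v).
    by rewrite df; apply/eqP; rewrite -fE /=; lia.
  rewrite /= !nth_cat size_s; case: ltnP; first by lia.
  case: ltnP => [_ _|]; last by lia.
  rewrite nth_plus; have -> : (x + p - j.+1 - x < y)%N by lia.
  move/eqP/esym/negbTE; rewrite (set_nth_default true) //; first by rewrite size_s; lia.
have headE : take (x - p) s = nseq (x - p) true.
  have := cnt_s; rewrite -{1}(cat_take_drop (x - p) s) count_cat tailE count_nseq /= mul1n.
  move=> cnt; have {cnt} : (count negb (take (x - p) s) = 0)%N by lia.
  move/eqP; rewrite -leqn0 leqNgt -has_count => /hasPn no.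
  have size_t : size (take (x - p) s) = (x - p)%N by rewrite size_take_min size_s; lia.
  by rewrite -{2}size_t; apply/all_pred1P/allP => b /no; case: b.
by rewrite -[LHS](cat_take_drop (x - p)) tailE headE.
Qed.

(** If theta were 0, formal reality would give V = 0. But the entry of V at the pluses and at
    [t1 ++ t2] is a single non-zero product: P_z and P_y are trivial at words of pluses, P_x
    preserves the number of minus signs, and [vertex_diagram_entry] then leaves one word. *)
Lemma theta_neq0 x y z : admissible x y z -> theta x y z != 0.
Proof.
move=> adm; apply/eqP => theta0.
have V0 : trm (vmat x y z) = fun _ _ => 0.
  apply: (mulm_sqr_eq0 formally_real_K (supported_tr (@supported_vmat x y z))).
  rewrite trmK vmat_orthogonal eqxx theta0.
  by apply: matP => u s; rewrite /scalem mul0r.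
have [] := vertex_diagram_entry adm; set p := ((x + y - z)./2)%N => le_px E_neq0 E_supp.
pose t1 := nseq (x - p) true ++ nseq p false; pose t2 := nseq y true.
have size_t1 : size t1 = x by rewrite size_cat !size_nseq; lia.
have size_t : size (t1 ++ t2) = (x + y)%N by rewrite size_cat size_t1 size_nseq.
have := congr1 (fun M : mat K => M (t1 ++ t2) (nseq z true)) V0; rewrite /trm => V_entry.
have {V_entry} : mulm (x + y) (Phi (vertex_diagram x y z)) (pairproj x y)
    (nseq z true) (t1 ++ t2) = 0.
  rewrite -V_entry /vmat /mulm.
  under [RHS]eq_bigr => u _ do rewrite proj_plus.
  by rewrite big_states1 ?size_nseq.
rewrite /mulm (bigD1_seq (t1 ++ t2)) ?states_uniq ?mem_states ?size_t //=.
rewrite big1_seq ?addr0 => [|s /andP[neq_s]]; last first.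
  rewrite mem_states => /eqP size_s.
  have [->|Q_neq0] := eqVneq (pairproj x y s (t1 ++ t2)) 0; first by rewrite mulr0.
  have [->|E_neq] := eqVneq (Phi (vertex_diagram x y z) (nseq z true) s) 0; first by rewrite mul0r.
  case/eqP: neq_s; move: Q_neq0; rewrite /pairproj /tensm take_size_cat // drop_size_cat //.
  rewrite mulf_eq0 negb_or => /andP[/proj_count cnt1].
  rewrite -[proj gamma y _ _]/(trm (proj gamma y) _ _) trm_proj proj_plus.
  case: (drop x s =P nseq y true) => [drop_s _|_]; last by rewrite eqxx.
  rewrite -(cat_take_drop x s) drop_s; congr (_ ++ _); apply: E_supp.
  - by rewrite -drop_s cat_take_drop.
  - by rewrite size_take_min size_s; lia.
  - by rewrite cnt1 count_cat !count_nseq /= mul0n mul1n.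
apply/eqP; apply: mulf_neq0; first by rewrite -catA; exact: E_neq0.
rewrite /pairproj /tensm (take_size_cat _ size_t1) (drop_size_cat _ size_t1).
apply: mulf_neq0.
  exact: (proj_diag_neq0 gamma_neq0 formally_real_K size_t1).
exact: (proj_diag_neq0 gamma_neq0 formally_real_K (size_nseq _ _)).
Qed.

Definition fusion (x y : nat) : seq nat := [seq z <- iota 0 (x + y).+1 | admissible x y z].

Lemma mem_fusion x y z : (z \in fusion x y) = admissible x y z.
Proof.
rewrite mem_filter mem_iota; case: (boolP (admissible x y z)) => //= /and4P[_ *].
by lia.
Qed.

(** The dimension count of the Clebsch-Gordan rule, needed for the comparison of traces. *)
Lemma sum_fusion x y : (\sum_(z <- fusion x y) z.+1 = x.+1 * y.+1)%N.
Proof.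
have arith l k : (\sum_(0 <= z < (l + 2 * k).+1 | (l <= z) && ~~ odd (l + z)) z.+1 =
    k.+1 * (l + k).+1)%N.
  elim: k => [|k IHk].
    rewrite muln0 addn0 big_mkcond big_nat_recr //= leqnn addnn odd_double /= mul1n.
    rewrite big_nat big1 // => z /andP[_ lt_z].
    by rewrite leqNgt lt_z.
  have -> : (l + 2 * k.+1 = (l + 2 * k).+2)%N by lia.
  rewrite big_mkcond big_nat_recr //= big_nat_recr //= -big_mkcond IHk.
  have -> : (l <= (l + 2 * k).+1)%N && ~~ odd (l + (l + 2 * k).+1) = false.
    by rewrite oddD oddS oddD oddM /= addbN addbF addbb andbF.
  have -> : (l <= (l + 2 * k).+2)%N && ~~ odd (l + (l + 2 * k).+2).
    by rewrite oddD !oddS oddD oddM /= negbK addbF addbb andbT; lia.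
  nia.
(* With truncated subtraction l is |x - y|; the admissible z are l, l + 2, ..., l + 2k. *)
pose l := ((x - y) + (y - x))%N; pose k := minn x y.
have -> : (x.+1 * y.+1 = k.+1 * (l + k).+1)%N.
  by rewrite /l /k; case: (leqP x y) => le_xy; [|rewrite mulnC]; congr (_ * _)%N; lia.
rewrite -(arith l k) big_filter.
have -> : (l + 2 * k)%N = (x + y)%N by rewrite /l /k; lia.
rewrite /index_iota subn0 big_seq_cond [RHS]big_seq_cond; apply: eq_bigl => z.
rewrite mem_iota; have [le_z /=|//] := ltnP z (0 + (x + y).+1); rewrite add0n in le_z.
have [i iE] : exists i, (l + 2 * i = x + y)%N by exists k; rewrite /l /k; lia.
have odd_l : odd (l + z) = odd (x + y + z) by rewrite -iE oddD [RHS]oddD oddD oddM addbF.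
rewrite odd_l /admissible /l.
case: (odd _) => /=; lia.
Qed.

(* The right-hand side is a symmetric idempotent dominated by the left-hand side
   and has the same trace, so the sum of the squared entries of the difference
   is 0. *)
Lemma pairproj_decomposition x y :
  pairproj x y = fun u s =>
    \sum_(z <- fusion x y)
      scalem (theta x y z)^-1 (mulm z (trm (vmat x y z)) (vmat x y z)) u s.
Proof.
set Q := pairproj x y; set N := (x + y)%N; set S := RHS.
have suppS : supported N N S.
  move=> u s; have [/andP[/eqP-> /eqP->] //|us] := boolP ((size u == N) && (size s == N)).
  rewrite /S big1 ?eqxx // => z _; rewrite /scalem.
  rewrite (supported_eq0 (supported_mul
    (supported_tr (@supported_vmat x y z)) (@supported_vmat x y z))).
    by rewrite mulr0.
  by rewrite -negb_and.
have trS : trm S = S.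
  apply: matP => u s; rewrite /trm /S; apply: eq_bigr => z _.
  rewrite -[LHS]/(trm (scalem _ _) u s) trm_scale trm_mul trmK.
  by [].
have QS : mulm N Q S = S.
  rewrite /S mulm_sumr; apply: matP => u s; apply: eq_bigr => z _.
  by rewrite mulm_scale mulmA -[Q]trm_pairproj -trm_mul vmat_pairproj.
have SS : mulm N S S = S.
  rewrite {1}/S mulm_suml; apply: matP => u s; rewrite big_seq [RHS]big_seq.
  apply: eq_bigr => z; rewrite mem_fusion => adm.
  rewrite /S mulm_sumr (bigD1_seq z) ?mem_fusion ?filter_uniq ?iota_uniq //=.
  have VVV z' : mulm N (scalem (theta x y z)^-1 (mulm z (trm (vmat x y z)) (vmat x y z)))
      (scalem (theta x y z')^-1 (mulm z' (trm (vmat x y z')) (vmat x y z'))) =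
      scalem ((theta x y z)^-1 * (theta x y z')^-1)
        (mulm z (trm (vmat x y z))
          (mulm z' (mulm N (vmat x y z) (trm (vmat x y z'))) (vmat x y z'))).
    by rewrite mul_scalem mulm_scale scalemA -!mulmA.
  rewrite VVV vmat_orthogonal eqxx mul_scalem proj_vmat mulm_scale scalemA.
  rewrite divfK ?theta_neq0 // big1 ?addr0 // => z' neq_z.
  rewrite VVV vmat_orthogonal eq_sym (negPf neq_z) mul_scalem mulm_scale scalemA mulr0.
  by rewrite /scalem mul0r.
have tr_SQ : mtrace N S = mtrace N Q.
  rewrite mtrace_pairproj -sum_fusion natr_sum /mtrace /S exchange_big.
  rewrite big_seq [RHS]big_seq; apply: eq_bigr => z; rewrite mem_fusion => adm.
  rewrite -/(mtrace _ _) mtrace_scale mtrace_mulC vmat_orthogonal eqxx mtrace_scale.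
  rewrite mulrA mulVf ?theta_neq0 // mul1r.
  exact: (mtrace_proj gamma_neq0 formally_real_K).
apply: matP => u s.
have [/andP[size_u size_s]|us] := boolP ((size u == N) && (size s == N)); last first.
  transitivity (0 : K); last apply: esym.
    by apply: (supported_eq0 (@supported_pairproj x y)); rewrite -negb_and.
  by apply: (supported_eq0 suppS); rewrite -negb_and.
apply/eqP; rewrite -subr_eq0; apply/eqP.
apply: (@sum_sqr2_eq0 K formally_real_K _ _ (states N) (states N) (fun u' s' => Q u' s' - S u' s'));
  rewrite ?mem_states //.
(* By symmetry of [Q] and [S] the sum of squares is the trace of (Q - S)^2, that is tr Q - 2 tr S +
   tr S = 0. *)
transitivity (mtrace N (mulm N Q Q) - mtrace N (mulm N Q S) *+ 2 + mtrace N (mulm N S S)).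
  rewrite /mtrace -sumrMnl -sumrB -big_split; apply: eq_bigr => u' _.
  rewrite /mulm -sumrMnl -sumrB -big_split; apply: eq_bigr => s' _.
  have -> : S s' u' = S u' s' by rewrite -[LHS]/(trm S u' s') trS.
  have -> : Q s' u' = Q u' s' by rewrite -[LHS]/(trm Q u' s') trm_pairproj.
  by rewrite sqrrB.
rewrite pairproj_idem QS SS tr_SQ mulr2n.
by rewrite opprD addrA subrr sub0r addNr.
Qed.

(** * Graph elements *)

(* Sequences are stored in reverse: the head of [r] is the last term [s_k]. *)
Fixpoint gmat (i : nat) (r : seq nat) : mat K :=
  match r with
  | c :: ((b :: _) as r') =>
      mulm (b + i) (vmat b i c) (tensm b (size r' * i) (gmat i r') (idm i))
  | _ => proj gamma i
  end.

Fixpoint gnorm (i : nat) (r : seq nat) : K :=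
  match r with
  | c :: ((b :: _) as r') => theta b i c * gnorm i r'
  | _ => 1
  end.

Fixpoint rpaths (i k : nat) : seq (seq nat) :=
  if k is k'.+1 then [seq c :: r | r <- rpaths i k', c <- fusion (head 0%N r) i]
  else [:: [:: i]].

Lemma rpathsS i k r : r \in rpaths i k.+1 ->
  exists c b r', [/\ r = c :: b :: r', b :: r' \in rpaths i k & admissible b i c].
Proof.
case/allpairsPdep=> r' [c [r'_k]]; rewrite mem_fusion => adm ->.
case: r' r'_k adm => [|b r'] r'_k adm; last by exists c, b, r'.
by case: k r'_k => [|k] //= /allpairsPdep[? [? []]].
Qed.

Lemma rpathsS_cons i k c b r' : (c :: b :: r' \in rpaths i k.+1) =
  (b :: r' \in rpaths i k) && admissible b i c.
Proof.
apply/idP/andP => [/rpathsS[c' [b' [r'' [[-> -> ->]]]]] //|[r_k adm]].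
by apply/allpairsPdep; exists (b :: r'), c; rewrite mem_fusion.
Qed.

Lemma mem_rpaths i k r : (r \in rpaths i k) =
  [&& size r == k.+1, last 0%N r == i & sorted (fun c b => admissible b i c) r].
Proof.
elim: k r => [|k IHk] [|c [|b r]].
- by [].
- by rewrite mem_seq1 eqseq_cons /= !andbT.
- by rewrite mem_seq1 eqseq_cons andbF.
- by apply/negP => /rpathsS[? [? [? []]]].
- by rewrite andFb; apply/negP => /rpathsS[? [? [? []]]].
- rewrite rpathsS_cons IHk /= eqSS.
  by case: (admissible b i c); rewrite /= ?andbT ?andbF.
Qed.

Lemma rpaths_uniq i k : uniq (rpaths i k).
Proof.
elim: k => //= k IHk; apply: allpairs_uniq_dep => // [r _|].
  by rewrite filter_uniq ?iota_uniq.
by move=> [r c] [r' c'] _ _ /= [-> ->].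
Qed.

Lemma rpath_head i k r : r \in rpaths i k -> exists h r0, r = h :: r0.
Proof. by rewrite mem_rpaths; case: r => [|h r0] //; exists h, r0. Qed.

Lemma rpath_size i k r : r \in rpaths i k -> size r = k.+1.
Proof. by rewrite mem_rpaths => /andP[/eqP]. Qed.

Lemma gmat_cons i k c b r' : b :: r' \in rpaths i k ->
  gmat i (c :: b :: r') =
  mulm (b + i) (vmat b i c) (tensm b (k.+1 * i) (gmat i (b :: r')) (idm i)).
Proof. by move=> /rpath_size size_r; rewrite -size_r. Qed.

Lemma dimS i k : (k.+1 * i = k * i + i)%N.
Proof. by rewrite mulSn addnC. Qed.

Lemma proj_gmat i k r : r \in rpaths i k ->
  mulm (head 0%N r) (proj gamma (head 0%N r)) (gmat i r) = gmat i r.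
Proof.
case: k => [|k]; first by rewrite mem_seq1 => /eqP-> /=; exact: projK_idem.
case/rpathsS=> c [b [r' [-> r'_k adm]]]; rewrite (gmat_cons c r'_k).
by rewrite mulmA proj_vmat.
Qed.

(** Pairing the inner graph elements leaves a projector on the first group of strands; the vertex
    absorbs it. *)
Lemma vmat_tens_proj x y z :
  mulm (x + y) (vmat x y z) (tensm x x (proj gamma x) (idm y)) = vmat x y z.
Proof.
rewrite -{1}vmat_pairproj -mulmA /pairproj tensm_mul projK_idem.
by rewrite (mulm1 (@projK_supported y)) vmat_pairproj.
Qed.

(** By induction the inner pairing vanishes unless the tails coincide, and otherwise leaves a
    multiple of P_b beside the identity. The vertex absorbs P_b, and orthogonality of vertices
    compares the heads and contributes one theta. *)
Lemma gmat_orthogonal i k r r' : r \in rpaths i k -> r' \in rpaths i k ->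
  mulm (k.+1 * i) (gmat i r) (trm (gmat i r')) =
  scalem (if r == r' then gnorm i r else 0) (proj gamma (head 0%N r)).
Proof.
elim: k r r' => [|k IHk] r r'.
  rewrite !mem_seq1 => /eqP-> /eqP->; rewrite eqxx /= mul1n trm_proj scale1m.
  exact: projK_idem.
case/rpathsS=> c [b [s [-> s_k adm]]] /rpathsS[c' [b' [s' [-> s'_k adm']]]].
rewrite (gmat_cons c s_k) (gmat_cons c' s'_k) trm_mul trm_tens trm_id dimS.
rewrite -mulmA [X in mulm _ _ X]mulmA tensm_mul IHk //.
rewrite (mul1m (@supported_id K i)) [c :: _ == _]eqseq_cons.
have [eq_s|_] := eqVneq (b :: s) (b' :: s'); last first.
  rewrite andbF; apply: matP => u t; rewrite /scalem mul0r /mulm big1 // => v _.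
  rewrite big1 ?mulr0 // => v' _.
  by rewrite scale_tensm /scalem !mul0r.
case: eq_s => <- _; rewrite andbT scale_tensm mul_scalem mulm_scale mulmA.
rewrite vmat_tens_proj vmat_orthogonal scalemA; congr scalem.
by case: eqP => _; rewrite /= ?mulr0 // mulrC.
Qed.

Lemma gnorm_neq0 i k r : r \in rpaths i k -> gnorm i r != 0.
Proof.
elim: k r => [|k IHk] r; first by rewrite mem_seq1 => /eqP-> /=; exact: oner_neq0.
case/rpathsS=> c [b [r' [-> r'_k adm]]] /=.
by apply: mulf_neq0; [exact: theta_neq0 | exact: (IHk _ r'_k)].
Qed.

(** * Resolution of the tensor power of the idempotent *)

Definition fmat (i k : nat) : mat K := Phi (jw_pow i k).

Lemma fmatS i k : fmat i k.+1 = tensm i i (proj gamma i) (fmat i k).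
Proof. by rewrite /fmat /= Phi_tens Phi_jw. Qed.

(** [jw_pow] grows on the left, graph elements on the right; associativity of the tensor product
    reconciles the two recursions. *)
Lemma fmatSr i k : fmat i k.+1 = tensm (k * i) (k * i) (fmat i k) (proj gamma i).
Proof.
elim: k => [|k IHk].
  rewrite fmatS /fmat /= Phi_id mul0n tens0m tensm0 //.
  exact: projK_supported.
by rewrite fmatS {1}IHk tensmA -fmatS mulSn.
Qed.

Lemma trm_fmat i k : trm (fmat i k) = fmat i k.
Proof.
elim: k => [|k IHk]; first by rewrite /fmat /= Phi_id trm_id.
by rewrite fmatS trm_tens trm_proj IHk.
Qed.

Lemma tensm_suml (I : Type) (s : seq I) r c (M : I -> mat K) (N : mat K) :
  tensm r c (fun u t => \sum_(j <- s) M j u t) N =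
  fun u t => \sum_(j <- s) tensm r c (M j) N u t.
Proof. by apply: matP => u t; rewrite /tensm mulr_suml. Qed.

(** In the resolution of the first factors each [gmat i r] already absorbs P_b on its top. Hence P_b
    (x) P_i may be inserted in the middle and resolved into vertices, which extends every path by
    one step. *)
Lemma gmat_decomposition i k :
  fmat i k.+1 = fun u t => \sum_(r <- rpaths i k)
    scalem (gnorm i r)^-1 (mulm (head 0%N r) (trm (gmat i r)) (gmat i r)) u t.
Proof.
elim: k => [|k IHk].
  apply: matP => u t; rewrite big_seq1 /= invr1 scale1m trm_proj projK_idem.
  rewrite fmatS /fmat /= Phi_id tensm0 //.
  exact: projK_supported.
rewrite fmatSr IHk tensm_suml; apply: matP => u t.
rewrite /= big_allpairs_dep big_seq [RHS]big_seq; apply: eq_bigr => r r_k.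
have [b [r' def_r]] := rpath_head r_k; rewrite def_r in r_k *.
rewrite [head _ _]/=.
transitivity (scalem (gnorm i (b :: r'))^-1
   (mulm (b + i) (tensm (k.+1 * i) b (trm (gmat i (b :: r'))) (idm i))
     (mulm (b + i) (pairproj b i) (tensm b (k.+1 * i) (gmat i (b :: r')) (idm i)))) u t).
  rewrite scale_tensm /pairproj !tensm_mul (mulm1 (@projK_supported i)).
  rewrite (mul1m (@projK_supported i)).
  by rewrite (proj_gmat r_k).
rewrite pairproj_decomposition mulm_suml mulm_sumr /scalem mulr_sumr.
apply: eq_bigr => c _; rewrite (gmat_cons c r_k) trm_mul trm_tens trm_id.
rewrite mul_scalem mulm_scale /scalem /= invfM mulrA [_^-1 * _^-1]mulrC.
by rewrite !mulmA.
Qed.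

Lemma gmat_fmat i k r : r \in rpaths i k ->
  mulm (k.+1 * i) (gmat i r) (fmat i k.+1) = gmat i r.
Proof.
move=> r_k; rewrite gmat_decomposition mulm_sumr; apply: matP => u t.
rewrite (bigD1_seq r) ?rpaths_uniq //= big1_seq ?addr0 => [|r' /andP[neq_r r'_k]].
  rewrite mulm_scale mulmA gmat_orthogonal // eqxx mul_scalem scalemA.
  by rewrite mulVf ?scale1m ?(proj_gmat r_k) // (gnorm_neq0 r_k).
rewrite mulm_scale mulmA gmat_orthogonal // eq_sym (negPf neq_r) mul_scalem /scalem.
by rewrite mul0r mulr0.
Qed.

(** * From pairs of paths to the family D *)

Fixpoint rprefix (s : seq nat) (k : nat) : seq nat :=
  if k is k'.+1 then nth 0%N s k :: rprefix s k' else [:: nth 0%N s 0].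

Lemma size_rprefix s k : size (rprefix s k) = k.+1.
Proof. by elim: k => //= k ->. Qed.

Lemma rprefix_rev s k : (k < size s)%N -> rprefix s k = rev (take k.+1 s).
Proof.
elim: k => [|k IHk] lt_k /=.
  by case: s lt_k => //= x s _; rewrite take0.
by rewrite (take_nth 0%N) // rev_rcons -IHk // ltnW.
Qed.

Lemma Phi_graph_upto i s k : nth 0%N s 0 = i ->
  Phi (graph_upto i s k) = gmat i (rprefix s k).
Proof.
move=> s0; elim: k => [|k IHk] /=.
  by rewrite Phi_conform ?mul1n // Phi_jw.
rewrite Phi_conform //; last by rewrite [RHS]dimS.
rewrite Phi_comp Phi_vertex Phi_tens Phi_id IHk.
by case: k {IHk} => [|k] //=; rewrite size_rprefix.
Qed.

Lemma Phi_graph_elt i s : (0 < size s)%N -> nth 0%N s 0 = i ->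
  Phi (graph_elt i s) = gmat i (rev s).
Proof.
move=> s_gt0 s0; rewrite /graph_elt Phi_conform ?prednK //; last by rewrite nth_last.
by rewrite Phi_graph_upto // rprefix_rev ?prednK // take_size.
Qed.

(** With both paths stored in reverse, [rev rr.1] is a_1, ..., a_n and [rr.2] is a_n, ..., a_(2n-1);
    the common term a_n is kept once. *)
Definition glue_paths (rr : seq nat * seq nat) : seq nat := rev rr.1 ++ behead rr.2.

Definition path_pairs (i k : nat) : seq (seq nat * seq nat) :=
  [seq rr <- [seq (r, r') | r <- rpaths i k, r' <- rpaths i k]
     | head 0%N rr.1 == head 0%N rr.2].

Lemma mem_path_pairs i k rr : (rr \in path_pairs i k) =
  [&& head 0%N rr.1 == head 0%N rr.2, rr.1 \in rpaths i k & rr.2 \in rpaths i k].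
Proof.
rewrite mem_filter; congr (_ && _); case: rr => r r' /=.
by apply/allpairsP/andP => [[[s s'] [? ? [-> ->]]] //|[? ?]]; exists (r, r').
Qed.

Lemma path_pairs_uniq i k : uniq (path_pairs i k).
Proof.
apply/filter_uniq/allpairs_uniq; rewrite ?rpaths_uniq //.
by move=> [? ?] [? ?] _ _ /= [-> ->].
Qed.

Lemma glue_paths_parts i k rr (a := glue_paths rr) : rr \in path_pairs i k ->
  [/\ take k.+1 a = rev rr.1, drop k a = rr.2 & nth 0%N a k = head 0%N rr.1].
Proof.
case: rr @a => r r' a; rewrite mem_path_pairs => /and3P[/= /eqP eq_h r_k r'_k].
have size_r := rpath_size r_k.
have [h [r0 def_r]] := rpath_head r_k; have [h' [r0' def_r']] := rpath_head r'_k.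
move: eq_h size_r; rewrite /a /glue_paths def_r def_r' /= => eq_h [size_r].
have size_rev : size (rev r0) = k by rewrite size_rev.
have aE : rev (h :: r0) ++ r0' = rev r0 ++ h :: r0' by rewrite rev_cons cat_rcons.
split.
- by rewrite take_size_cat // rev_cons size_rcons size_rev.
- by rewrite aE drop_size_cat // eq_h.
- by rewrite aE nth_cat size_rev ltnn subnn.
Qed.

Lemma Phi_D i k rr : rr \in path_pairs i k ->
  Phi (D k.+1 i (glue_paths rr)) =
  scalem (flip_scale (k.+1 * i) (head 0%N rr.1) gamma)
    (mulm (head 0%N rr.1) (trm (gmat i rr.1)) (gmat i rr.2)).
Proof.
move=> rr_in; have [take_a drop_a nth_a] := glue_paths_parts rr_in.
move: rr_in; rewrite mem_path_pairs => /and3P[/eqP eq_h r_k r'_k].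
have elt r : r \in rpaths i k -> head 0%N r = head 0%N rr.1 ->
    Phi (conform (k.+1 * i) (head 0%N rr.1) (graph_elt i (rev r))) = gmat i r.
  move=> r_k' eq_hr; have size_r := rpath_size r_k'.
  rewrite Phi_conform ?size_rev ?size_r //; last first.
    by have [h [r0 def_r]] := rpath_head r_k'; rewrite -eq_hr def_r rev_cons last_rcons.
  rewrite Phi_graph_elt ?revK ?size_rev ?size_r //.
  rewrite nth_rev ?size_r // subn1 /=.
  by move: r_k'; rewrite mem_rpaths => /and3P[_ /eqP<- _]; rewrite -nth_last size_r.
rewrite /D take_a drop_a nth_a Phi_comp Phi_star !elt //.
by rewrite mul_scalem.
Qed.

Lemma glue_paths_inj i k rr rr' : rr \in path_pairs i k -> rr' \in path_pairs i k ->
  glue_paths rr = glue_paths rr' -> rr = rr'.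
Proof.
move=> /glue_paths_parts[take_a drop_a _] /glue_paths_parts[take_a' drop_a' _] eq_a.
rewrite eq_a in take_a drop_a; rewrite [rr]surjective_pairing [rr']surjective_pairing.
by rewrite -drop_a drop_a' -[rr.1]revK -take_a take_a' revK.
Qed.

Lemma admissible_sym x y i : admissible x i y = admissible y i x.
Proof.
have eq_sum : (x + i + y = y + i + x)%N by lia.
by rewrite /admissible eq_sum; lia.
Qed.

Lemma admissible_rot x y i : admissible x y i = admissible y i x.
Proof.
have eq_sum : (x + y + i = y + i + x)%N by lia.
by rewrite /admissible eq_sum; lia.
Qed.

Lemma mem_glue_paths i k a :
  (a \in [seq glue_paths rr | rr <- path_pairs i k]) = admissible_seq k.+1 i a.
Proof.
pose e := fun a' a'' => admissible a'' a' i.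
have eE a' a'' : e a' a'' = admissible a' i a''.
  by rewrite /e admissible_rot.
(* The step relation is symmetric, so either half of the sequence may be read in the direction that
   a path requires. *)
have eC a' a'' : e a' a'' = admissible a'' i a' by rewrite eE admissible_sym.
have size_eq : (2 * k.+1 - 1 = k + k.+1)%N by lia.
apply/mapP/idP => [[[r r'] rr_in def_a]|].
  have := rr_in; rewrite mem_path_pairs => /and3P[/= /eqP eq_h r_k r'_k].
  have [h [r0 def_r]] := rpath_head r_k; have [h' [r0' def_r']] := rpath_head r'_k.
  move: eq_h r_k r'_k def_a; rewrite /= def_r def_r' /= => <-.
  rewrite !mem_rpaths => /and3P[/= /eqP[size_r] last_r sort_r].
  move=> /and3P[/= /eqP[size_r'] last_r' sort_r'] ->.
  rewrite /admissible_seq /glue_paths /= size_cat size_rev /= size_r size_r' size_eq.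
  rewrite [(k.+1 + k)%N]addnC eqxx /= rev_cons cat_rcons; apply/and3P; split.
  - by case/lastP: (r0) last_r => [|s x]; rewrite ?rev_rcons ?last_rcons.
  - by rewrite last_cat.
  rewrite -/e sorted_cat_cons -rev_cons rev_sorted; apply/andP; split.
    by rewrite (eq_sorted (e' := fun c b => admissible b i c)) // => c b; apply: eE.
  by rewrite (eq_path (e' := fun c b => admissible b i c)) // => c b; apply: eC.
case/and4P=> /eqP size_a head_a last_a sort_a; rewrite size_eq in size_a.
exists (rev (take k.+1 a), drop k a); last first.
  rewrite /glue_paths revK /= -drop1 drop_drop add1n cat_take_drop.
  by [].
have lt_k : (k < size a)%N by rewrite size_a; lia.
have size_t : size (take k.+1 a) = k.+1 by rewrite size_take_min; lia.
rewrite mem_path_pairs /= (take_nth 0%N lt_k) rev_rcons /= (drop_nth 0%N lt_k) eqxx /=.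
rewrite -(drop_nth 0%N lt_k) -rev_rcons -(take_nth 0%N lt_k) !mem_rpaths.
rewrite size_rev size_t size_drop size_a eqxx addKn eqxx /=.
apply/andP; split; apply/andP; split.
- by case: (a) head_a size_t => //= x s /eqP->; rewrite rev_cons last_rcons.
- rewrite rev_sorted -(eq_sorted (e := e)) ?take_sorted //.
- rewrite -nth_last nth_drop size_drop size_a addKn /=.
  by move: last_a; rewrite -nth_last size_a addnS.
- by rewrite -(eq_sorted (e := e)) ?drop_sorted.
Qed.

(** The element is unchanged by F on either side, hence is its own witness X in F X F. *)
Lemma D_in_colored_tl i k rr : rr \in path_pairs i k ->
  D k.+1 i (glue_paths rr) \in colored_tl k.+1 i.
Proof.
move=> rr_in; have := Phi_D rr_in; move: (D k.+1 i (glue_paths rr)) => d dE.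
apply/colored_tlP; exists d; apply: Phi_inj; rewrite !Phi_comp -/(fmat i k.+1) dE.
move: rr_in; rewrite mem_path_pairs => /and3P[_ r_k r'_k].
rewrite mulm_scale mul_scalem mulmA -{1}(trm_fmat i k.+1) -trm_mul (gmat_fmat r_k).
by rewrite -mulmA (gmat_fmat r'_k).
Qed.

Lemma gmat_in_TL i k r : r \in rpaths i k ->
  exists X : TL (k.+1 * i) (head 0%N r), Phi X = gmat i r.
Proof.
elim: k r => [|k IHk] r.
  rewrite mem_seq1 => /eqP-> /=; exists (conform (1 * i) i (jw i)).
  by rewrite Phi_conform ?mul1n // Phi_jw.
case/rpathsS=> c [b [r' [-> r'_k adm]]]; have [X XE] := IHk _ r'_k.
exists (conform (k.+2 * i) c (vertex b i c ∘ (X ⊗ id_tl i))).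
rewrite Phi_conform //; last by rewrite [RHS]dimS.
by rewrite Phi_comp Phi_vertex Phi_tens Phi_id XE (gmat_cons c r'_k).
Qed.

(** Resolving both copies of F gives terms v_r^T (v_r X v_r'^T) v_r'. The bracket lies between two
    projectors, so it is a scalar multiple of one, and it vanishes unless the paths end at the same
    colour. *)
Lemma sandwich_in_span_D i k (X : TL (k.+1 * i) (k.+1 * i)) :
  exists c : seq nat * seq nat -> K,
  jw_pow i k.+1 ∘ X ∘ jw_pow i k.+1 =
  \sum_(rr <- path_pairs i k) c rr *: D k.+1 i (glue_paths rr).
Proof.
pose N := (k.+1 * i)%N.
(* [choice] ranges over all pairs of sequences; 0 is a dummy value off the listed paths. *)
have /choice[mu muP] : forall rr : seq nat * seq nat, exists c : K,
    rr.1 \in rpaths i k -> rr.2 \in rpaths i k ->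
    mulm N (mulm N (gmat i rr.1) (Phi X)) (trm (gmat i rr.2)) =
      scalem c (proj gamma (head 0%N rr.1)) /\ (head 0%N rr.1 != head 0%N rr.2 -> c = 0).
  move=> [r r'] /=; have [r_k|] := boolP (r \in rpaths i k); last by exists 0.
  have [r'_k|] := boolP (r' \in rpaths i k); last by exists 0.
  have [Y YE] := gmat_in_TL r_k; have [Y' Y'E] := gmat_in_TL r'_k.
  have [Z ZE] := trm_Phi Y'.
  have [c [cE c0]] := proj_TL_proj (Y ∘ X ∘ Z); exists c => _ _.
  split; last by rewrite eq_sym.
  rewrite -cE !Phi_comp -ZE Y'E YE -[X in _ = mulm _ _ X]mulmA.
  rewrite -(trm_proj gamma (head 0%N r')) -trm_mul (proj_gmat r'_k).
  by rewrite !mulmA (proj_gmat r_k).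
(* Compensates the scalar by which [star], used in [D], differs from transposition. *)
pose kap (rr : seq nat * seq nat) := flip_scale N (head 0%N rr.1) gamma.
exists (fun rr => (gnorm i rr.1)^-1 * (gnorm i rr.2)^-1 * mu rr / kap rr).
apply: Phi_inj; rewrite !Phi_comp -/(fmat i k.+1); apply: matP => u t.
transitivity (\sum_(r <- rpaths i k) \sum_(r' <- rpaths i k)
    scalem ((gnorm i r)^-1 * (gnorm i r')^-1 * mu (r, r'))
      (mulm (head 0%N r) (trm (gmat i r)) (gmat i r')) u t).
  rewrite {1}gmat_decomposition mulm_suml mulm_suml.
  rewrite big_seq [RHS]big_seq; apply: eq_bigr => r r_k.
  rewrite [in LHS]gmat_decomposition mulm_sumr.
  rewrite big_seq [RHS]big_seq; apply: eq_bigr => r' r'_k.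
  rewrite !mul_scalem mulm_scale scalemA.
  have -> : mulm N (mulm N (mulm (head 0%N r) (trm (gmat i r)) (gmat i r)) (Phi X))
      (mulm (head 0%N r') (trm (gmat i r')) (gmat i r')) =
    mulm (head 0%N r) (trm (gmat i r)) (mulm (head 0%N r')
      (mulm N (mulm N (gmat i r) (Phi X)) (trm (gmat i r'))) (gmat i r')).
    by rewrite !mulmA.
  have [-> c0] := muP (r, r') r_k r'_k; rewrite /= mul_scalem mulm_scale scalemA.
  have [eq_h|neq_h] := eqVneq (head 0%N r) (head 0%N r').
    by rewrite eq_h (proj_gmat r'_k).
  by rewrite c0 // mulr0 /scalem !mul0r.
rewrite Phi_sum /path_pairs big_filter [RHS]big_mkcond big_allpairs_dep /=.
rewrite big_seq [RHS]big_seq; apply: eq_bigr => r r_k.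
rewrite big_seq [RHS]big_seq; apply: eq_bigr => r' r'_k.
have [eq_h|neq_h] := eqVneq (head 0%N r) (head 0%N r'); last first.
  have [_ c0] := muP (r, r') r_k r'_k; rewrite /= in c0.
  by rewrite c0 // mulr0 /scalem mul0r.
have rr_in : (r, r') \in path_pairs i k by rewrite mem_path_pairs /= eq_h eqxx r_k.
rewrite PhiZ (Phi_D rr_in) scalemA divfK //.
exact: flip_scale_neq0.
Qed.

(** Sandwiching between two graph elements is, up to a non-zero factor, the coordinate functional
    dual to the corresponding [D]. *)
Lemma D_dual i k rr rr' (N := (k.+1 * i)%N) (h := head 0%N rr.1) :
  rr \in path_pairs i k -> rr' \in path_pairs i k ->
  mulm N (mulm N (gmat i rr.1) (Phi (D k.+1 i (glue_paths rr')))) (trm (gmat i rr.2)) =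
  scalem (if rr == rr' then flip_scale N h gamma * (gnorm i rr.1 * gnorm i rr.2) else 0)
    (proj gamma h).
Proof.
move=> rr_in rr'_in; rewrite (Phi_D rr'_in) -/N mulm_scale mul_scalem.
move: rr_in rr'_in; rewrite !mem_path_pairs.
move=> /and3P[/eqP eq_h r_k s_k] /and3P[/eqP eq_h' r'_k s'_k].
rewrite [X in mulm _ X _]mulmA -mulmA !gmat_orthogonal // mul_scalem mulm_scale !scalemA.
have -> : (rr == rr') = (rr.1 == rr'.1) && (rr.2 == rr'.2).
  by case: rr rr' {eq_h eq_h' r_k s_k r'_k s'_k h} => ? ? [? ?].
have [eq1|_] := eqVneq rr.1 rr'.1; last first.
  by rewrite mulr0 mul0r; apply: matP => u t; rewrite /scalem !mul0r.
rewrite /h -eq_h' -eq1 projK_idem; congr scalem; rewrite [rr.2 == _]eq_sym.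
case: eqVneq => [->|_] /=; last by rewrite !mulr0.
by rewrite mulrA.
Qed.

Lemma D_span i k :
  (<<[seq D k.+1 i (glue_paths rr) | rr <- path_pairs i k]>> = colored_tl k.+1 i)%VS.
Proof.
apply/eqP; rewrite eqEsubv; apply/andP; split.
  by apply/span_subvP => _ /mapP[rr rr_in ->]; apply: D_in_colored_tl.
apply/subvP => _ /colored_tlP[X ->]; have [c ->] := sandwich_in_span_D X.
rewrite big_seq; apply: rpred_sum => rr rr_in; apply/rpredZ/memv_span.
exact: map_f.
Qed.

Lemma D_free i k : free [seq D k.+1 i (glue_paths rr) | rr <- path_pairs i k].
Proof.
set B := [seq _ | rr <- _]; pose N := (k.+1 * i)%N.
have sizeB : size B = size (path_pairs i k) by rewrite size_map.
apply/(@freeP _ _ _ (in_tuple B)) => c sum0 j.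
have lt_size (l : 'I_(size B)) : (l < size (path_pairs i k))%N by rewrite -sizeB.
pose rr (l : 'I_(size B)) := nth ([::], [::]) (path_pairs i k) l.
have rr_in l : rr l \in path_pairs i k by rewrite mem_nth.
have BE (l : 'I_(size B)) : (in_tuple B)`_l = D k.+1 i (glue_paths (rr l)).
  by rewrite /= (nth_map ([::], [::])).
pose h := head 0%N (rr j).1.
pose dual (X : TL N N) : mat K := mulm N (mulm N (gmat i (rr j).1) (Phi X)) (trm (gmat i (rr j).2)).
have dualE : dual (\sum_(l < size B) c l *: (in_tuple B)`_l) =
    fun u t => \sum_(l < size B) scalem (c l) (dual (D k.+1 i (glue_paths (rr l)))) u t.
  have -> : dual (\sum_(l < size B) c l *: (in_tuple B)`_l) =
      mulm N (mulm N (gmat i (rr j).1) (fun u t =>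
        \sum_(l < size B) scalem (c l) (Phi (D k.+1 i (glue_paths (rr l)))) u t))
        (trm (gmat i (rr j).2)).
    congr (mulm N (mulm N _ _) _); apply: matP => u t; rewrite Phi_sum.
    by apply: eq_bigr => l _; rewrite PhiZ BE.
  rewrite mulm_sumr mulm_suml; apply: matP => u t; apply: eq_bigr => l _.
  by rewrite mulm_scale mul_scalem.
(* At the word of pluses the projector has entry 1, so the matrix identity becomes an equation for
   the coefficient [c j] alone. *)
have := congr1 (fun M : mat K => M (nseq h true) (nseq h true)) dualE.
rewrite sum0 /dual Phi0 mulm0 mul0m (bigD1 j) //=.
rewrite big1 => [|l neq_l]; last first.
  rewrite D_dual // /scalem; case: eqP => [eq_rr|_]; last by rewrite mul0r mulr0.
  case/eqP: neq_l; apply: val_inj; apply/eqP.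
  by rewrite -(nth_uniq ([::], [::]) (lt_size l) (lt_size j) (path_pairs_uniq i k)) -/(rr j) eq_rr.
rewrite addr0 D_dual // eqxx /scalem proj_plus_plus mulr1 => /esym/eqP.
rewrite mulf_eq0 => /orP[/eqP //|].
have := rr_in j; rewrite mem_path_pairs => /and3P[_ r_k r'_k].
by rewrite mulf_eq0 (negPf (flip_scale_neq0 _ _)) mulf_eq0 (negPf (gnorm_neq0 r_k))
  (negPf (gnorm_neq0 r'_k)).
Qed.

Theorem theorem3p7 (n i : nat) (hn : (1 <= n)%N) (hi : (1 <= i)%N) :
  exists S : seq (seq nat),
    [/\ uniq S,
        forall a : seq nat, (a \in S) = admissible_seq n i a
      & basis_of (colored_tl n i) [seq D n i a | a <- S]].
Proof.
case: n hn => // k _; exists [seq glue_paths rr | rr <- path_pairs i k]; split.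
- rewrite map_inj_in_uniq ?path_pairs_uniq // => rr rr' rr_in rr'_in.
  exact: glue_paths_inj rr_in rr'_in.
- exact: mem_glue_paths.
by rewrite -map_comp /basis_of D_span D_free eqxx.
Qed.
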